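(* Let $X$ be a purely discontinuous rotationally symmetric L\'evy process in $\mathbb{R}^d$ with L\'evy exponent $\Psi$ and L\'evy density $J_X(x)=j_X(|x|)$ satisfying, for some constant $\gamma>1$, $\gamma^{-1}\phi(|\xi|^2)\le \Psi(|\xi|)\le\gamma\phi(|\xi|^2)$ for all $\xi\in\mathbb{R}^d$ and $\gamma^{-1}j(r)\le j_X(r)\le\gamma j(r)$ for all $r>0$, where $\phi$ is a complete Bernstein function satisfying the growth condition (A) stated in the context. For any constant $T>0$ there exists $c=c(T,\gamma,\phi)>0$ such that for all $(t,x,y)\in(0,T]\times\mathbb{R}^d\times\mathbb{R}^d$, $$p(t,x,y)\ge c\left((\Phi^{-1}(t))^{-d}\wedge tJ(x,y)\right).$$
   Context: Here $d\ge1$, $a\wedge b=\min\{a,b\}$, and $c=c(\alpha,\beta,\dots)$ means that $c$ depends only on the listed quantities (and on $d$). The function $\phi$ is the Laplace exponent of a subordinator: $\phi(\lambda)=b\lambda+\int_0^\infty(1-e^{-\lambda t})\mu(dt)$ with $b\ge0$ and $\int_0^\infty(1\wedge t)\mu(dt)<\infty$. It is a complete Bernstein function: $\mu(dt)$ has a completely monotone density $\mu(t)$, i.e. $(-1)^nD^n\mu\ge0$ for all integers $n\ge0$. Condition (A): there exist $\delta_1,\delta_2\in(0,1)$, $a_1\in(0,1)$, $a_2\in(1,\infty)$, $R_0>0$ such that $a_1\lambda^{\delta_1}\phi(r)\le\phi(\lambda r)\le a_2\lambda^{\delta_2}\phi(r)$ for all $\lambda\ge1$ and $r\ge R_0$ (this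 forces $b=0$). $\Phi(r)=1/\phi(r^{-2})$ for $r>0$, and $\Phi^{-1}$ is the inverse function of $\Phi$. $j(r)=\int_0^\infty(4\pi t)^{-d/2}e^{-r^2/(4t)}\mu(t)\,dt$ for $r>0$, and $J(x,y)=j(|x-y|)$, with $J(x,x)=+\infty$. The process $X$ satisfies $\mathbb{E}_x[e^{i\xi\cdot(X_t-X_0)}]=e^{-t\Psi(|\xi|)}$ with $\Psi(|\xi|)=\int_{\mathbb{R}^d}(1-\cos(\xi\cdot x))J_X(x)\,dx$, and $j_X$ is continuous on $(0,\infty)$. $X$ has a continuous transition density $p(t,x,y)$ with respect to Lebesgue measure on $\mathbb{R}^d$. *)

(* Defs.v *)
From HB Require Import structures.
From mathcomp Require Import all_boot all_order all_algebra.
From mathcomp Require Import all_classical all_reals all_analysis.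
From mathcomp Require Import complex.

Set Implicit Arguments.
Unset Strict Implicit.
Unset Printing Implicit Defensive.

Import Order.TTheory GRing.Theory Num.Theory.
Import numFieldNormedType.Exports.

Local Open Scope classical_set_scope.
Local Open Scope ring_scope.

(* Euclidean space is 'rV[R]_d. The norm that mathcomp-analysis puts on 'rV[R]_d
   is the sup norm, so that the Euclidean norm is defined here; the topology is
   the usual one. *)
Definition dotp (R : realType) (d : nat) (x y : 'rV[R]_d) : R :=
  \sum_(i < d) x ord0 i * y ord0 i.

Definition enorm (R : realType) (d : nat) (x : 'rV[R]_d) : R :=
  Num.sqrt (dotp x x).

(* The product sigma-algebra on row vectors, which over R is the Borel one. *)
Definition measure_rV_display : measure_display -> measure_display.
Proof. exact. Qed.

Section measurable_rV.
Context {disp : measure_display} {T : measurableType disp}.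
Variable n : nat.

Let coors : 'I_n -> 'rV[T]_n -> T := fun i x => x ord0 i.

Let rV_set0 : g_sigma_preimage coors set0.
Proof. exact: sigma_algebra0. Qed.

Let rV_setC A : g_sigma_preimage coors A -> g_sigma_preimage coors (~` A).
Proof. exact: sigma_algebraC. Qed.

Let rV_bigcup (F : _^nat) : (forall i, g_sigma_preimage coors (F i)) ->
  g_sigma_preimage coors (\bigcup_i (F i)).
Proof. exact: sigma_algebra_bigcup. Qed.

HB.instance Definition _ := @isMeasurable.Build (measure_rV_display disp)
  'rV[T]_n (g_sigma_preimage coors) rV_set0 rV_setC rV_bigcup.

Lemma measurable_coord (i : 'I_n) :
  measurable_fun [set: 'rV[T]_n] (fun x : 'rV[T]_n => x ord0 i).
Proof.
move=> _ Y mY; rewrite setTI; apply: sub_sigma_algebra => /=.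
rewrite -bigcup_seq/=; exists i => /=; first by rewrite mem_index_enum.
by exists Y => //; rewrite setTI.
Qed.

Lemma measurable_fun_rV (disp' : measure_display) (T' : measurableType disp')
    (f : T' -> 'rV[T]_n) :
  (forall i, measurable_fun [set: T'] (fun x => f x ord0 i)) ->
  measurable_fun [set: T'] f.
Proof.
move=> mf _ Y mY; rewrite setTI.
suff : g_sigma_preimage coors `<=` (fun A => measurable (f @^-1` A)) by exact.
apply: smallest_sub.
  split => [|A mA|F mF] /=.
  - by rewrite preimage_set0.
  - by rewrite setTD preimage_setC; exact: measurableC.
  - by rewrite preimage_bigcup; exact: bigcupT_measurable.
rewrite -bigcup_seq/=; apply: bigcup_sub => i _ A [B mB <-].
by rewrite setTI; have := mf i measurableT _ mB; rewrite setTI.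
Qed.

End measurable_rV.

Section sigma_finite_pushforward.
Context d1 d2 (T1 : measurableType d1) (T2 : measurableType d2) (R : realType).

Lemma sigma_finite_pushforward (m : set T1 -> \bar R)
    (f : T1 -> T2) (g : T2 -> T1) :
  sigma_finite setT m -> measurable_fun setT g -> cancel f g -> sigma_finite setT (pushforward m f).
Proof.
move=> [F FT mF] mg fK.
exists (fun i => g @^-1` F i) => [|i]; first by rewrite -preimage_bigcup -FT.
have [mFi Foo] := mF i; split.
  by rewrite -[X in measurable X]setTI; exact: mg.
rewrite /pushforward -comp_preimage.
by rewrite (_ : g \o f = id)//; apply/funext => x /=; rewrite fK.
Qed.

End sigma_finite_pushforward.

Section sigma_finite_product_measure.
Context d1 d2 (T1 : measurableType d1) (T2 : measurableType d2) (R : realType).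
Variable m1 : {sigma_finite_measure set T1 -> \bar R}.
Variable m2 : {sigma_finite_measure set T2 -> \bar R}.

Lemma sigma_finite_product_measure : sigma_finite setT (m1 \x m2)%E.
Proof.
have /sigma_finiteP[F [TF ndF Foo]] := sigma_finiteT m1.
have /sigma_finiteP[G [TG ndG Goo]] := sigma_finiteT m2.
exists (fun n => F n `*` G n).
  rewrite -setXTT TF TG predeqE => -[x y]; split.
    move=> [/= [n _ Fnx] [k _ Gky]]; exists (maxn n k) => //; split.
    - by move: x Fnx; exact/subsetPset/ndF/leq_maxl.
    - by move: y Gky; exact/subsetPset/ndG/leq_maxr.
  by move=> [n _ []/= ? ?]; split; exists n.
move=> k; have [? ?] := Foo k; have [? ?] := Goo k.
split; first exact: measurableX.
by rewrite product_measure1E// lte_mul_pinfty// ge0_fin_numE.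
Qed.

End sigma_finite_product_measure.

Section lebesgue_rV.
Context {R : realType}.

Definition cons_rV (n : nat) (p : measurableTypeR R * 'rV[R]_n) : 'rV[R]_n.+1 :=
  \row_(i < n.+1) oapp (p.2 ord0) p.1 (unlift ord0 i).

Definition uncons_rV (n : nat) (x : 'rV[R]_n.+1) :
    measurableTypeR R * 'rV[R]_n :=
  (x ord0 ord0, \row_(i < n) x ord0 (lift ord0 i)).

Lemma cons_rVK n : cancel (@cons_rV n) (@uncons_rV n).
Proof.
move=> [a x]; congr pair; first by rewrite mxE unlift_none.
by apply/rowP => i; rewrite !mxE liftK.
Qed.

Lemma uncons_rVK n : cancel (@uncons_rV n) (@cons_rV n).
Proof.
move=> x; apply/rowP => i; rewrite mxE.
by case: unliftP => [j|] -> //=; rewrite mxE.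
Qed.

Lemma measurable_cons_rV n : measurable_fun setT (@cons_rV n).
Proof.
apply: measurable_fun_rV => i; case: (unliftP ord0 i) => [j|] ->.
- rewrite (_ : (fun _ => _) = (fun x : 'rV[R]_n => x ord0 j) \o snd).
    by apply: measurableT_comp => //; exact: measurable_coord.
  by apply/funext => p; rewrite mxE liftK.
- rewrite (_ : (fun _ => _) = fst); first exact: measurable_fst.
  by apply/funext => p; rewrite mxE unlift_none.
Qed.

Lemma measurable_uncons_rV n : measurable_fun setT (@uncons_rV n).
Proof.
apply: measurable_fun_pair; first exact: (measurable_coord ord0).
apply: measurable_fun_rV => i.
rewrite (_ : (fun _ => _) = fun x : 'rV[R]_n.+1 => x ord0 (lift ord0 i)).
  exact: measurable_coord.
by apply/funext => x; rewrite mxE.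
Qed.

Section lebesgue_step.
Variables (n : nat) (mu : {sigma_finite_measure set 'rV[R]_n -> \bar R}).

Definition lebesgue_step : set 'rV[R]_n.+1 -> \bar R :=
  pushforward (lebesgue_measure \x mu)%E (@cons_rV n).

Let lebesgue_step0 : lebesgue_step set0 = 0%E.
Proof. by rewrite /lebesgue_step /pushforward preimage_set0 measure0. Qed.

Let lebesgue_step_ge0 A : (0 <= lebesgue_step A)%E.
Proof. by rewrite /lebesgue_step /pushforward; exact: integral_ge0. Qed.

Let lebesgue_step_sigma_additive : semi_sigma_additive lebesgue_step.
Proof.
have mcons A : measurable A -> measurable (@cons_rV n @^-1` A).
  by move=> mA; rewrite -[X in measurable X]setTI; exact: measurable_cons_rV.
move=> F mF tF mUF; rewrite /lebesgue_step /pushforward preimage_bigcup.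
apply: measure_semi_sigma_additive.
- by move=> i; exact: mcons.
- apply/trivIsetP => /= i j _ _ ij; rewrite -preimage_setI.
  by move/trivIsetP : tF => /(_ _ _ _ _ ij) ->//; rewrite preimage_set0.
- by rewrite -preimage_bigcup; exact: mcons.
Qed.

HB.instance Definition _ := isMeasure.Build _ _ _ lebesgue_step
  lebesgue_step0 lebesgue_step_ge0 lebesgue_step_sigma_additive.

Let lebesgue_step_sigma_finite : sigma_finite setT lebesgue_step.
Proof.
apply: sigma_finite_pushforward (@measurable_uncons_rV n) (@cons_rVK n).
exact: sigma_finite_product_measure.
Qed.

HB.instance Definition _ := Measure_isSigmaFinite.Build _ _ _ lebesgue_step
  lebesgue_step_sigma_finite.

End lebesgue_step.

(* Lebesgue measure on 'rV[R]_n: a point mass for n = 0, and the product of the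
   one-dimensional Lebesgue measure with the measure on 'rV[R]_n for n.+1 *)
Fixpoint lebesgue_rV (n : nat) : {sigma_finite_measure set 'rV[R]_n -> \bar R} :=
  match n with
  | 0%N => \d_(0 : 'rV[R]_0)
  | n'.+1 => lebesgue_step (lebesgue_rV n')
  end.

Lemma lebesgue_rV_box (n : nat) (A : 'I_n -> set R) :
  (forall i, measurable (A i)) ->
  lebesgue_rV n [set x | forall i, A i (x ord0 i)] =
    \big[mule/1%E]_(i < n) lebesgue_measure (A i).
Proof.
elim: n A => [|n IH] A mA.
  by rewrite big_ord0 /= diracE mem_set// => -[].
rewrite big_ord_recl -(IH (fun i => A (lift ord0 i)))//=.
rewrite /lebesgue_step /pushforward.
rewrite (_ : _ @^-1` _ = A ord0 `*`
    [set x : 'rV[R]_n | forall i, A (lift ord0 i) (x ord0 i)]); last first.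
  apply/seteqP; split => [[a x] /= Ax|[a x] /= [Aa Ax] i].
    split; first by have := Ax ord0; rewrite mxE unlift_none.
    by move=> i; have := Ax (lift ord0 i); rewrite mxE liftK.
  by rewrite mxE; case: unliftP => [j|] ->.
apply: product_measure1E; first exact: mA.
set B := (X in measurable X).
have -> : B = \bigcap_(i in [set: 'I_n])
    [set x : 'rV[R]_n | A (lift ord0 i) (x ord0 i)].
  by apply/seteqP; split => [x Ax i _|x Ax i]; exact: Ax.
apply: fin_bigcap_measurable => // i _.
have := @measurable_coord _ R n i measurableT _ (mA (lift ord0 i)).
by rewrite setTI.
Qed.

End lebesgue_rV.

Section bernstein.
Context {R : realType}.
Implicit Types (b : R) (m phi : R -> R).

Definition completely_monotone m : Prop :=
  forall (n : nat) (t : R), 0 < t ->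
    derivable (derive1n n m) t 1 /\ 0 <= (-1) ^+ n * derive1n n m t.

(* phi is the Laplace exponent of the subordinator with drift b and Levy measure
   m(t)dt, m completely monotone; only the values of m on ]0, +oo[ and those of
   phi on [0, +oo[ matter. *)
Record complete_bernstein b m phi : Prop := {
  bernstein_drift_ge0 : 0 <= b;
  bernstein_density_cm : completely_monotone m;
  bernstein_density_integrable :
    (\int[lebesgue_measure]_(t in `]0%R, +oo[) (Num.min 1 t * m t)%:E < +oo)%E;
  bernstein_exponentE : forall l : R, 0 <= l ->
    ((phi l)%:E = (b * l)%:E +
      \int[lebesgue_measure]_(t in `]0%R, +oo[)
        ((1 - expR (- (l * t))) * m t)%:E)%E }.

Definition growth_condition phi : Prop :=
  exists delta1 delta2 a1 a2 R0 : R,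
    [/\ 0 < delta1 < 1, 0 < delta2 < 1, 0 < a1 < 1, 1 < a2 & 0 < R0] /\
    forall l r : R, 1 <= l -> R0 <= r ->
      a1 * l `^ delta1 * phi r <= phi (l * r) <= a2 * l `^ delta2 * phi r.

Definition Phi phi (r : R) : R := (phi (r ^- 2))^-1.

Definition Phi_inv phi : R -> R := pinv (`]0, +oo[ : set R) (Phi phi).

(* Density at distance r of the Levy measure of Brownian motion in dimension d
   run at speed 2 (Gaussian kernel (4 pi t)^(-d/2) exp(-r^2/(4t))), subordinated
   by the subordinator with Levy density m. *)
Definition jfun (d : nat) m (r : R) : \bar R :=
  (\int[lebesgue_measure]_(t in `]0%R, +oo[)
    ((4 * pi * t) `^ (- (d%:R / 2)) * expR (- (r ^+ 2 / (4 * t))) * m t)%:E)%E.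

Definition Jfun (d : nat) m (x y : 'rV[R]_d) : \bar R :=
  if x == y then +oo%E else jfun d m (enorm (x - y)).

End bernstein.

Section levy_process.
Context {R : realType} {d : nat} {disp : measure_display}
  {Omega : measurableType disp}.
Implicit Types (P : 'rV[R]_d -> probability Omega R)
  (X : R -> Omega -> 'rV[R]_d) (p : R -> 'rV[R]_d -> 'rV[R]_d -> R).

Definition cadlag (f : R -> 'rV[R]_d) : Prop :=
  (forall t : R, 0 <= t -> f u @[u --> t^'+] --> f t) /\
  (forall t : R, 0 < t -> cvg (f u @[u --> t^'-])).

(* P x is the law under which X starts from x; only times t >= 0 matter. *)
Record levy_process P X : Prop := {
  levy_measurable : forall t, 0 <= t -> measurable_fun setT (X t);
  levy_start : forall x, P x [set w | X 0 w = x] = 1%E;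
  levy_independent_increments :
    forall x (s : nat -> R) (n : nat) (B : nat -> set 'rV[R]_d),
    0 <= s 0%N -> {homo s : i j / (i <= j)%N >-> i <= j} ->
    (forall i, measurable (B i)) ->
    (P x (\bigcap_(i in `I_n) [set w | B i (X (s i.+1) w - X (s i) w)%R]) =
     \prod_(i < n) P x [set w | B i (X (s i.+1) w - X (s i) w)%R])%E;
  levy_stationary_increments :
    forall x (s t : R) (B : set 'rV[R]_d), 0 <= s -> 0 <= t -> measurable B ->
    P x [set w | B (X (s + t) w - X s w)] = P x [set w | B (X t w - X 0 w)];
  levy_cadlag : forall x, {ae P x, forall w, cadlag (fun t => X t w)} }.

Definition rotationally_symmetric P X : Prop :=
  forall (U : 'M[R]_d) x (t : R) (B : set 'rV[R]_d),
    U *m U^T = 1%:M -> 0 <= t -> measurable B ->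
    P x [set w | B ((X t w - X 0 w) *m U)] = P x [set w | B (X t w - X 0 w)].

(* E[exp(i xi . Y)], by its real and imaginary parts *)
Definition char_fun (Q : probability Omega R) (Y : Omega -> 'rV[R]_d)
    (xi : 'rV[R]_d) : R[i] :=
  Complex (\int[Q]_w cos (dotp xi (Y w))) (\int[Q]_w sin (dotp xi (Y w))).

Definition levy_exponent P X (psi : 'rV[R]_d -> R) : Prop :=
  forall x (t : R) (xi : 'rV[R]_d), 0 <= t ->
    char_fun (P x) (fun w => X t w - X 0 w) xi =
    Complex (expR (- (t * psi xi))) 0.

Definition levy_density (J : 'rV[R]_d -> R) : Prop :=
  [/\ measurable_fun setT J,
      forall x, x != 0 -> 0 <= J x &
      (\int[lebesgue_rV d]_x (Num.min 1 (enorm x ^+ 2) * J x)%:E < +oo)%E].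

(* X is a symmetric pure jump process: no Gaussian part and no drift in the
   Levy-Khintchine formula. *)
Definition purely_discontinuous P X (psi J : 'rV[R]_d -> R) : Prop :=
  [/\ levy_exponent P X psi, levy_density J &
      forall xi, ((psi xi)%:E =
        \int[lebesgue_rV d]_x ((1 - cos (dotp xi x)) * J x)%:E)%E].

Record continuous_transition_density P X p : Prop := {
  density_ge0 : forall t x y, 0 < t -> 0 <= p t x y;
  density_transition : forall t x (B : set 'rV[R]_d),
    0 < t -> measurable B ->
    P x [set w | B (X t w)] = (\int[lebesgue_rV d]_(y in B) (p t x y)%:E)%E;
  density_continuous : forall t x y, 0 < t ->
    {for (t, x, y), continuous
      (fun z : R * 'rV[R]_d * 'rV[R]_d => p z.1.1 z.1.2 z.2)} }.

End levy_process.

(* Main.v *)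
Require Import Defs.
From HB Require Import structures.
From mathcomp Require Import all_boot all_order all_algebra.
From mathcomp Require Import all_classical all_reals all_analysis.
From mathcomp Require Import measurable_realfun ring lra.

Set Implicit Arguments.
Unset Strict Implicit.
Unset Printing Implicit Defensive.

Import Order.TTheory GRing.Theory Num.Theory.
Import numFieldNormedType.Exports.

Local Open Scope classical_set_scope.
Local Open Scope ring_scope.

(* Let rho = Phi^-1(t), so that phi(rho^-2) = 1/t. A product f of tent functions
   supported in a small cube is a positive combination of cosines,
   f(z) = int cos(w . z) kappa(dw), hence E f(X_t - X_0 - y) is the integral of
   e^(-t Psi(w)) cos(w . y) against kappa, and p(t, x, x + y) is bounded below by
   bounding this integral below. Truncate the jumps at a small radius eps and
   split them into nu1 (size at most rho) and nu2 (size above rho):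
   e^(-t Psi_eps) = e^(-t |nu1| - t |nu2|) e^(t nu1^) e^(t nu2^), and multiplying
   by the transform of a measure convolves f with the symmetrized measure. Keep
   the term t^2/2 (nu2^)^2 of the last exponential: two jumps of size at least
   C rho steered into the cube contribute at least
   m = const j(C' rho) min(j(|y|), j(C' rho)) rho^d |cube| from every starting
   point within C rho of the target. All the jumps from nu1 are kept, and they
   move the starting point by more than C rho with small probability, because
   t times the second moment of nu1 is at most const rho^2. Moreover t |nu2| is
   bounded and j(C' rho) >= const rho^-d / t. The bound does not depend on eps, so
   that eps tends to 0, and dividing by the volume of the cube gives the theorem. *)

(** * Finite measures and bounded integrands *)

(** All that is known of the law of X_t - X_0 is its characteristic function. No jump-by-jump
    construction of the process is therefore made: conditioning on the jumps is replaced by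
    discarding terms of an exponential series, which are nonnegative because convolution with a
    measure preserves nonnegativity. One large jump would not do: nu2 has no jump of size at most
    rho, so that it cannot carry a point already close to its target into the cube, and from a point
    beyond y the jump would need j at a distance larger than |y|. With two jumps, monotonicity is
    the only property of j used for the comparison with j(|y|). The bounds on the second moment of
    nu1 and on |nu2| both come from the upper bound on Psi, tested on the coordinate axes at
    frequencies at most d / rho, where phi is at most d^2 phi(rho^-2) = d^2 / t. Condition (A) bears
    on large arguments of phi only, hence on small radii; the horizon T keeps rho bounded, which is
    why the constant depends on T. The function phi = 0 also satisfies (A) and is dealt with
    separately: no process with a density has exponent 0. *)

Section density.
Context d (T : measurableType d) (R : realType).
Variables (mu : {measure set T -> \bar R}) (g : T -> R).

(** The three proofs are arguments of the definition so that the measure and finite measure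
    instances below can find them in the term itself. *)
Definition density (g0 : forall x, 0 <= g x) (mg : measurable_fun setT g)
    (ig : (\int[mu]_x (g x)%:E < +oo)%E) (A : set T) : \bar R :=
  (\int[mu]_(x in A) (g x)%:E)%E.

Hypotheses (g0 : forall x, 0 <= g x) (mg : measurable_fun setT g)
  (ig : (\int[mu]_x (g x)%:E < +oo)%E).

Local Notation nu := (density g0 mg ig).

Let density0 : nu set0 = 0%E. Proof. by rewrite /density integral_set0. Qed.

Let density_ge0 A : (0 <= nu A)%E.
Proof. by apply: integral_ge0 => x _; rewrite lee_fin. Qed.

Let density_sigma_additive : semi_sigma_additive nu.
Proof.
move=> A mA tA mUA; rewrite /density ge0_integral_bigcup//=.
- by apply: is_cvg_ereal_nneg_natsum_cond => n _ _; exact: density_ge0.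
- by apply/measurable_EFinP; exact: measurable_funTS.
- by move=> x _; rewrite lee_fin.
Qed.

HB.instance Definition _ := isMeasure.Build _ _ _ nu
  density0 density_ge0 density_sigma_additive.

Let density_finite : fin_num_fun nu.
Proof.
move=> A mA; rewrite ge0_fin_numE; last exact: density_ge0.
apply: le_lt_trans ig; apply: ge0_subset_integral => //.
- exact/measurable_EFinP.
- by move=> x _; rewrite lee_fin.
Qed.

HB.instance Definition _ := Measure_isFinite.Build _ _ _ nu density_finite.

Import HBNNSimple.

Let integral_density_nnsfun (f : {nnsfun T >-> R}) :
  (\int[nu]_x (f x)%:E = \int[mu]_x ((f x)%:E * (g x)%:E))%E.
Proof.
under [in LHS]eq_integral do rewrite fimfunE -fsumEFin//.
rewrite ge0_integral_fsum//; last 2 first.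
  - by move=> r; exact/measurable_EFinP/measurableT_comp.
  - by move=> r z _; rewrite EFinM nnfun_muleindic_ge0.
have eqg : (\int[mu]_x ((f x)%:E * (g x)%:E) = \int[mu]_x
    (\sum_(r \in range f) (r * \1_(f @^-1` [set r]) x * g x)%:E)%E)%E.
  apply: eq_integral => x _.
  by rewrite fsumEFin// -mulr_fsuml -fimfunE.
rewrite [RHS]eqg.
rewrite ge0_integral_fsum//; last 2 first.
  - by move=> r; apply/measurable_EFinP/measurable_funM => //; exact: measurable_funM.
  - move=> r z _; rewrite lee_fin mulr_ge0//.
    by have := nnfun_muleindic_ge0 f r z; rewrite -EFinM lee_fin.
apply: eq_fsbigr => r _.
rewrite (integralZl_indic _ (fun r => f @^-1` [set r]))//; last first.
  by move=> r0; rewrite preimage_nnfun0.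
rewrite integral_indic// setIT.
have mfr : measurable (f @^-1` [set r]) by [].
rewrite /= /density integral_mkcond.
have [r0|r0] := leP 0 r.
  rewrite -ge0_integralZl//; last 2 first.
    - by apply/(measurable_restrictT _ mfr)/measurable_EFinP/measurable_funTS.
    - by move=> x _; rewrite patchE; case: ifP => // _; rewrite lee_fin.
  apply: eq_integral => x _; rewrite patchE indicE; case: ifP => _.
    by rewrite mulr1 EFinM.
  by rewrite mulr0 mul0r mule0.
rewrite preimage_nnfun0//.
under eq_integral do rewrite patch_set0.
rewrite integral0 mule0 integral0_eq// => x _.
by rewrite indic0 mulr0 mul0r.
Qed.

Lemma integral_density (f : T -> \bar R) : measurable_fun setT f ->
  (forall x, (0 <= f x)%E) ->
  (\int[nu]_x f x = \int[mu]_x (f x * (g x)%:E))%E.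
Proof.
move=> mf f0.
pose f_ := nnsfun_approx measurableT mf.
transitivity (limn (fun n => \int[nu]_x (f_ n x)%:E)%E).
  rewrite -monotone_convergence//.
  - apply: eq_integral => y _; apply/esym/cvg_lim => //.
    exact: cvg_nnsfun_approx.
  - by move=> n; exact/measurable_EFinP.
  - by move=> n y _; rewrite lee_fin.
  - by move=> y _ m n mn; rewrite lee_fin; exact/lefP/nd_nnsfun_approx.
under eq_fun do rewrite integral_density_nnsfun.
rewrite -monotone_convergence//; last 3 first.
  - by move=> n; apply: emeasurable_funM; exact/measurable_EFinP.
  - by move=> n x _; rewrite -EFinM lee_fin mulr_ge0.
  - move=> x _ m n mn; rewrite -!EFinM lee_fin ler_wpM2r//.
    exact/lefP/nd_nnsfun_approx.
apply: eq_integral => x _; apply/cvg_lim => //.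
by apply: cvgeZr => //; exact: cvg_nnsfun_approx.
Qed.

End density.

Section bounded_measurable.
Context d (T : measurableType d) (R : realType).
Implicit Types f g : T -> R.

(** A real integral is the real part of an extended one and is a default value when the latter is
    infinite. Against finite measures this class excludes that case, and it is stable under sums,
    products, composition and partial integration. *)
Definition bounded_measurable f :=
  measurable_fun setT f /\ exists M, forall x, `|f x| <= M.

Lemma bounded_measurable_integrable (mu : {finite_measure set T -> \bar R}) f :
  bounded_measurable f -> mu.-integrable setT (EFin \o f).
Proof.
move=> [mf [M fM]]; apply: measurable_bounded_integrable => //.
  by rewrite ltey_eq fin_num_measure.
exists M; split; first exact: num_real.
by move=> x Mx y _ /=; rewrite (le_trans (fM y))// ltW.
Qed.

Lemma bounded_measurable_cst (c : R) : bounded_measurable (fun=> c).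
Proof. by split => //; exists `|c|. Qed.

Lemma bounded_measurableD f g : bounded_measurable f -> bounded_measurable g ->
  bounded_measurable (fun x => f x + g x).
Proof.
move=> [mf [M fM]] [mg [N gN]]; split; first exact: measurable_funD.
by exists (M + N) => x; rewrite (le_trans (ler_normD _ _))// lerD.
Qed.

Lemma bounded_measurableM f g : bounded_measurable f -> bounded_measurable g ->
  bounded_measurable (fun x => f x * g x).
Proof.
move=> [mf [M fM]] [mg [N gN]]; split; first exact: measurable_funM.
by exists (M * N) => x; rewrite normrM ler_pM.
Qed.

Lemma bounded_measurableX f n : bounded_measurable f ->
  bounded_measurable (fun x => f x ^+ n).
Proof.
move=> bf; elim: n => [|n IH]; first by under eq_fun do rewrite expr0; exact: bounded_measurable_cst.
by under eq_fun do rewrite exprS; exact: bounded_measurableM.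
Qed.

Lemma bounded_measurable_cos f : measurable_fun setT f ->
  bounded_measurable (fun x => cos (f x)).
Proof.
move=> mf; split; last by exists 1 => x; exact: cos_max.
apply: measurableT_comp mf; exact: continuous_measurable_fun (@continuous_cos R).
Qed.

Lemma bounded_measurable_expR f : bounded_measurable f ->
  bounded_measurable (fun x => expR (f x)).
Proof.
move=> [mf [M fM]]; split; first exact: measurableT_comp.
exists (expR M) => x; rewrite ger0_norm ?expR_ge0// ler_expR.
by rewrite (le_trans (ler_norm _)).
Qed.

End bounded_measurable.

Lemma bounded_measurable_comp d1 d2 (T1 : measurableType d1)
    (T2 : measurableType d2) (R : realType) (f : T2 -> R) (h : T1 -> T2) :
  bounded_measurable f -> measurable_fun setT h ->
  bounded_measurable (fun x => f (h x)).
Proof.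
move=> [mf [M fM]] mh; split; first exact: measurableT_comp.
by exists M.
Qed.

Section bounded_fubini.
Context d1 d2 (T1 : measurableType d1) (T2 : measurableType d2) (R : realType).
Variables (m1 : {finite_measure set T1 -> \bar R})
  (m2 : {finite_measure set T2 -> \bar R}) (f : T1 * T2 -> R).
Hypothesis bf : bounded_measurable f.

Lemma bounded_measurable_integrable_prod :
  (m1 \x m2)%E.-integrable setT (EFin \o f).
Proof.
case: bf => mf [M fM]; apply: measurable_bounded_integrable => //.
  have : ((m1 \x m2) (setT `*` setT) < +oo)%E.
    rewrite product_measure1E// lte_mul_pinfty// ?fin_num_measure//.
    by rewrite ltey_eq fin_num_measure.
  by rewrite setXTT.
exists M; split; first exact: num_real.
by move=> x Mx y _ /=; rewrite (le_trans (fM y))// ltW.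
Qed.

Lemma bounded_measurable_Rintegral :
  bounded_measurable (fun x => \int[m2]_y f (x, y)).
Proof.
case: (bf) => mf [M fM]; split.
  exact: measurableT_comp (measurable_fubini_F bounded_measurable_integrable_prod).
exists (M * fine (m2 setT)) => x.
have bfx : bounded_measurable (fun y => f (x, y)).
  by apply: bounded_measurable_comp => //; exact: pair1_measurable.
rewrite (le_trans (le_normr_Rintegral _ _))//; first exact: bounded_measurable_integrable.
rewrite -Rintegral_cst//; apply: le_Rintegral => //.
- apply: bounded_measurable_integrable; case: bfx => mfx _; split.
    exact: measurableT_comp.
  by exists M => y; rewrite normr_id.
- by apply: bounded_measurable_integrable; exact: bounded_measurable_cst.
Qed.

Lemma bounded_fubini :
  \int[m1]_x \int[m2]_y f (x, y) = \int[m2]_y \int[m1]_x f (x, y).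
Proof.
have bf2 y : bounded_measurable (fun x => f (x, y)).
  by apply: bounded_measurable_comp => //; exact: pair2_measurable.
have bf1 x : bounded_measurable (fun y => f (x, y)).
  by apply: bounded_measurable_comp => //; exact: pair1_measurable.
have := Fubini bounded_measurable_integrable_prod; rewrite /Rintegral => /(congr1 fine).
congr (_ = _); congr fine; apply: eq_integral => z _.
- rewrite fineK//; apply: integrable_fin_num => //.
  exact: (bounded_measurable_integrable _ (bf1 z)).
- rewrite fineK//; apply: integrable_fin_num => //.
  exact: (bounded_measurable_integrable _ (bf2 z)).
Qed.

Lemma bounded_integral_prod :
  \int[(m1 \x m2)%E]_z f z = \int[m1]_x \int[m2]_y f (x, y).
Proof.
rewrite /Rintegral -(integral12_prod_meas1 bounded_measurable_integrable_prod); congr fine.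
apply: eq_integral => x _; rewrite fineK//; apply: integrable_fin_num => //.
apply: (@bounded_measurable_integrable _ _ _ m2 (fun y => f (x, y))).
by apply: bounded_measurable_comp => //; exact: pair1_measurable.
Qed.

End bounded_fubini.

(** * Integrals of cosines *)

Section euclidean.
Context {R : realType} {d : nat}.
Implicit Types x y z w : 'rV[R]_d.

Lemma dotpC x y : dotp x y = dotp y x.
Proof. by apply: eq_bigr => i _; rewrite mulrC. Qed.

Lemma dotpDr x y z : dotp x (y + z) = dotp x y + dotp x z.
Proof. by rewrite /dotp -big_split; apply: eq_bigr => i _; rewrite mxE mulrDr. Qed.

Lemma dotpNr x y : dotp x (- y) = - dotp x y.
Proof. by rewrite /dotp -sumrN; apply: eq_bigr => i _; rewrite mxE mulrN. Qed.

Lemma dotpDl x y z : dotp (x + y) z = dotp x z + dotp y z.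
Proof. by rewrite dotpC dotpDr !(dotpC z). Qed.

Lemma dotpNl x y : dotp (- x) y = - dotp x y.
Proof. by rewrite dotpC dotpNr dotpC. Qed.

Lemma dotpZl a x y : dotp (a *: x) y = a * dotp x y.
Proof. by rewrite /dotp mulr_sumr; apply: eq_bigr => i _; rewrite mxE mulrA. Qed.

Lemma dotp_ge0 x : 0 <= dotp x x.
Proof. by apply: sumr_ge0 => i _; rewrite -expr2 sqr_ge0. Qed.

Lemma dotp_parallelogram x y :
  dotp (x + y) (x + y) + dotp (x - y) (x - y) = 2 * (dotp x x + dotp y y).
Proof. rewrite !dotpDl !dotpDr !dotpNl !dotpNr (dotpC y x); ring. Qed.

Lemma cos_dotp_sym w y x :
  cos (dotp w (y + x)) + cos (dotp w (y - x)) =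
  2 * (cos (dotp w y) * cos (dotp w x)).
Proof. rewrite !dotpDr dotpNr cosD cosB; ring. Qed.

Lemma measurable_dotp d' (T : measurableType d') (f g : T -> 'rV[R]_d) :
  measurable_fun setT f -> measurable_fun setT g ->
  measurable_fun setT (fun t => dotp (f t) (g t)).
Proof.
move=> mf mg; rewrite /dotp; apply: measurable_sum => i.
by apply: measurable_funM; exact: (measurableT_comp (measurable_coord i)).
Qed.

Lemma measurable_addrV d' (T : measurableType d') (f g : T -> 'rV[R]_d) :
  measurable_fun setT f -> measurable_fun setT g ->
  measurable_fun setT (fun t => f t + g t).
Proof.
move=> mf mg; apply: measurable_fun_rV => i.
under eq_fun do rewrite mxE.
by apply: measurable_funD; exact: (measurableT_comp (measurable_coord i)).
Qed.

Lemma measurable_opprV d' (T : measurableType d') (f : T -> 'rV[R]_d) :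
  measurable_fun setT f -> measurable_fun setT (fun t => - f t).
Proof.
move=> mf; apply: measurable_fun_rV => i.
under eq_fun do rewrite mxE.
by apply: measurableT_comp => //; exact: (measurableT_comp (measurable_coord i)).
Qed.

End euclidean.

Section semigroup.
Context {R : realType} {d : nat}.
Local Notation V := 'rV[R]_d.
Local Notation meas := {finite_measure set V -> \bar R}.
Implicit Types (kappa nu : meas) (h : V -> R) (w x y z : V).

(** The real part of the Fourier transform, nu^ in the overview. *)
Definition cos_transform nu w : R := \int[nu]_x cos (dotp w x).

(** The multiplier [h] acts on the frequency side: [h] = 1 gives the test function f with spectral
    measure [kappa], and h(w) = e^(-t psi(w)) gives E f(X_t - X_0 - y). *)
Definition cos_synthesis kappa h y : R := \int[kappa]_w (h w * cos (dotp w y)).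

Lemma bounded_measurable_cos_dotp d' (T : measurableType d') (f g : T -> V) :
  measurable_fun setT f -> measurable_fun setT g ->
  bounded_measurable (fun t => cos (dotp (f t) (g t))).
Proof. by move=> mf mg; apply: bounded_measurable_cos; exact: measurable_dotp. Qed.

Lemma bounded_measurable_cos_transform nu :
  bounded_measurable (cos_transform nu).
Proof.
apply: (@bounded_measurable_Rintegral _ _ _ _ _ nu nu (fun p => cos (dotp p.1 p.2))).
exact: bounded_measurable_cos_dotp.
Qed.

Lemma cos_transform_le nu w : `|cos_transform nu w| <= fine (nu setT).
Proof.
have bc : bounded_measurable (fun x => cos (dotp w x)).
  exact: bounded_measurable_cos_dotp.
rewrite (le_trans (le_normr_Rintegral _ _))//; first exact: bounded_measurable_integrable.
rewrite -[leRHS]mul1r -Rintegral_cst//; apply: le_Rintegral => //.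
- apply: bounded_measurable_integrable; case: bc => mc _; split.
    exact: measurableT_comp.
  by exists 1 => y; rewrite normr_id cos_max.
- by apply: bounded_measurable_integrable; exact: bounded_measurable_cst.
- by move=> x _; exact: cos_max.
Qed.

Lemma bounded_measurable_cos_synthesis kappa h : bounded_measurable h ->
  bounded_measurable (cos_synthesis kappa h).
Proof.
move=> bh.
apply: (@bounded_measurable_Rintegral _ _ _ _ _ kappa kappa
  (fun p => h p.2 * cos (dotp p.2 p.1))).
apply: bounded_measurableM; first exact: bounded_measurable_comp.
exact: bounded_measurable_cos_dotp.
Qed.

Lemma cos_synthesis_shift kappa h x y : bounded_measurable h ->
  2^-1 * (cos_synthesis kappa h (y + x) + cos_synthesis kappa h (y - x)) =
  \int[kappa]_w (h w * (cos (dotp w y) * cos (dotp w x))).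
Proof.
move=> bh; have bhc u : bounded_measurable (fun w => h w * cos (dotp w u)).
  by apply: bounded_measurableM => //; exact: bounded_measurable_cos_dotp.
rewrite /cos_synthesis -RintegralD//; do ?exact: bounded_measurable_integrable.
rewrite -RintegralZl//; last first.
  by apply: bounded_measurable_integrable; exact: bounded_measurableD.
apply: eq_Rintegral => w _; rewrite -mulrDr cos_dotp_sym.
by rewrite mulrCA (mulrCA _ 2) mulVKf// pnatr_eq0.
Qed.

Lemma bounded_measurable_cos_synthesis_shift kappa h y : bounded_measurable h ->
  bounded_measurable (fun x =>
    2^-1 * (cos_synthesis kappa h (y + x) + cos_synthesis kappa h (y - x))).
Proof.
move=> bh; have bF := bounded_measurable_cos_synthesis kappa bh.
apply: bounded_measurableM; first exact: bounded_measurable_cst.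
apply: bounded_measurableD; apply: bounded_measurable_comp bF _.
  exact: measurable_addrV.
by apply: measurable_addrV => //; exact: measurable_opprV.
Qed.

(* Multiplying by the transform of nu amounts to convolving with the
   symmetrization of nu; no reflection invariance of nu is needed. *)
Lemma cos_synthesisM kappa nu h y : bounded_measurable h ->
  cos_synthesis kappa (fun w => h w * cos_transform nu w) y =
  \int[nu]_x (2^-1 * (cos_synthesis kappa h (y + x) + cos_synthesis kappa h (y - x))).
Proof.
move=> bh.
under [RHS]eq_Rintegral do rewrite cos_synthesis_shift//.
have bf : bounded_measurable
    (fun p : V * V => h p.2 * (cos (dotp p.2 y) * cos (dotp p.2 p.1))).
  apply: bounded_measurableM; first exact: bounded_measurable_comp.
  by apply: bounded_measurableM; exact: bounded_measurable_cos_dotp.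
rewrite (bounded_fubini nu kappa bf) /=.
apply: eq_Rintegral => w _.
under [RHS]eq_Rintegral do rewrite mulrA.
rewrite RintegralZl//; last first.
  by apply: bounded_measurable_integrable; exact: bounded_measurable_cos_dotp.
by rewrite mulrAC.
Qed.

(** By [cos_synthesisM] the new function is an average of translates of the old one. This is what
    allows terms of the exponential series to be discarded. *)
Lemma cos_synthesisM_ge0 kappa nu h : bounded_measurable h ->
  (forall y, 0 <= cos_synthesis kappa h y) ->
  forall y, 0 <= cos_synthesis kappa (fun w => h w * cos_transform nu w) y.
Proof.
move=> bh h0 y; rewrite cos_synthesisM//; apply: Rintegral_ge0 => x _.
by rewrite mulr_ge0// addr_ge0.
Qed.

Lemma cos_synthesisMX_ge0 kappa nu h n : bounded_measurable h ->
  (forall y, 0 <= cos_synthesis kappa h y) ->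
  forall y, 0 <= cos_synthesis kappa (fun w => h w * cos_transform nu w ^+ n) y.
Proof.
move=> bh h0; elim: n => [|n IH] y.
  by under [X in cos_synthesis _ X]eq_fun do rewrite expr0 mulr1.
under [X in cos_synthesis _ X]eq_fun do rewrite exprSr mulrA.
apply: cos_synthesisM_ge0 => //; apply: bounded_measurableM => //.
by apply: bounded_measurableX; exact: bounded_measurable_cos_transform.
Qed.

End semigroup.

Section exponential.
Context {R : realType}.

(** A bound uniform in [n], which dominates the partial sums when they are integrated against
    [kappa]. *)
Lemma series_exp_coeff_norm_le (x : R) n : `|series (exp_coeff x) n| <= expR `|x|.
Proof.
rewrite /series/= (le_trans (ler_norm_sum _ _ _))//.
apply: (@le_trans _ _ (series (exp_coeff `|x|) n)).
  rewrite /series/=; apply: ler_sum => i _.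
  by rewrite !exp_coeffE normrM normrX ger0_norm ?invr_ge0.
apply: nondecreasing_cvgn_le; last exact: is_cvg_series_exp_coeff.
apply/nondecreasing_seqP => k; rewrite !seriesEnat/= big_nat_recr//= lerDl.
exact: exp_coeff_ge0.
Qed.

Lemma cvg_series_exp_coeff (x : R) : series (exp_coeff x) n @[n --> \oo] --> expR x.
Proof. exact: is_cvg_series_exp_coeff. Qed.

Lemma series_exp_coeffM (t x : R) n :
  series (exp_coeff (t * x)) n = \sum_(0 <= k < n) t ^+ k / k`!%:R * x ^+ k.
Proof.
by rewrite seriesEnat/=; apply: eq_bigr => k _; rewrite exp_coeffE exprMn mulrC mulrAC.
Qed.

End exponential.

Section semigroup_bound.
Context {R : realType} {d : nat}.
Local Notation V := 'rV[R]_d.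
Local Notation meas := {finite_measure set V -> \bar R}.
Implicit Types (kappa nu : meas) (h : V -> R) (w x y z : V).

Lemma cos_synthesis_sum kappa h (F : nat -> V -> R) (a : nat -> R) n y :
  bounded_measurable h -> (forall k, bounded_measurable (F k)) ->
  cos_synthesis kappa (fun w => h w * \sum_(0 <= k < n) a k * F k w) y =
  \sum_(0 <= k < n) a k * cos_synthesis kappa (fun w => h w * F k w) y.
Proof.
move=> bh bF.
have bs m : bounded_measurable (fun w => \sum_(0 <= k < m) a k * F k w).
  elim: m => [|m IH].
    by under eq_fun do rewrite big_geq//; exact: bounded_measurable_cst.
  under eq_fun do rewrite big_nat_recr//=.
  apply: bounded_measurableD => //; apply: bounded_measurableM => //.
  exact: bounded_measurable_cst.
have bcos : bounded_measurable (fun w => cos (dotp w y)).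
  exact: bounded_measurable_cos_dotp.
elim: n => [|n IH].
  rewrite [RHS]big_geq// /cos_synthesis.
  under eq_Rintegral do rewrite big_geq// mulr0 mul0r.
  by rewrite Rintegral_cst// mul0r.
rewrite [RHS]big_nat_recr//= -IH /cos_synthesis -RintegralZl//; last first.
  apply: bounded_measurable_integrable; apply: bounded_measurableM => //.
  exact: bounded_measurableM.
rewrite -RintegralD//.
- by apply: eq_Rintegral => w _; rewrite big_nat_recr//=; ring.
- apply: bounded_measurable_integrable; apply: bounded_measurableM => //.
  exact: bounded_measurableM.
- apply: bounded_measurable_integrable; apply: bounded_measurableM => //.
    exact: bounded_measurable_cst.
  by apply: bounded_measurableM => //; exact: bounded_measurableM.
Qed.

Lemma cvg_cos_synthesis kappa (h_ : nat -> V -> R) h (M : R) y :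
  (forall n, measurable_fun setT (h_ n)) -> measurable_fun setT h ->
  (forall n w, `|h_ n w| <= M) ->
  (forall w, h_ n w @[n --> \oo] --> h w) ->
  cos_synthesis kappa (h_ n) y @[n --> \oo] --> cos_synthesis kappa h y.
Proof.
move=> mh_ mh hM hh.
have M0 : 0 <= M by exact: le_trans (hM 0%N 0).
have mcos : measurable_fun setT (fun w => cos (dotp w y)).
  by have [] := bounded_measurable_cos_dotp (@measurable_id _ V setT) (measurable_cst y).
apply: fine_cvg; rewrite fineK; last first.
  apply: integrable_fin_num => //; apply: (@bounded_measurable_integrable _ _ _ kappa).
  split; first exact: measurable_funM.
  exists M => w; rewrite normrM -[leRHS]mulr1 ler_pM// ?cos_max//.
  have /cvg_norm cn := hh w.
  rewrite -(cvg_lim _ cn)//; apply: limr_le; first by apply/cvg_ex; eexists; exact: cn.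
  by near=> n; exact: hM.
apply: (@dominated_cvg _ _ _ _ _ measurableT _ _ (fun=> M%:E)) => //.
- by move=> n; apply/measurable_EFinP; exact: measurable_funM.
- by move=> w _; apply: cvg_EFin; [by near=> n | exact: cvgMr_tmp (hh w)].
- by apply: (@bounded_measurable_integrable _ _ _ kappa (fun=> M)); exact: bounded_measurable_cst.
- by move=> n w _; rewrite lee_fin normrM -[leRHS]mulr1 ler_pM// cos_max.
Unshelve. all: by end_near.
Qed.

(** The exponential series converges boundedly because the transform of [nu] is at most its mass, so
    that integration commutes with the limit. The sequence [s] is free: it records which terms of
    the series are kept. *)
Lemma cos_synthesis_expR_ge kappa nu h (t : R) (s : nat -> R) (l : R) y :
  bounded_measurable h -> 0 <= t ->
  (forall n, s n <= \sum_(0 <= k < n) t ^+ k / k`!%:R *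
     cos_synthesis kappa (fun w => h w * cos_transform nu w ^+ k) y) ->
  s n @[n --> \oo] --> l ->
  l <= cos_synthesis kappa (fun w => h w * expR (t * cos_transform nu w)) y.
Proof.
move=> bh t0 sle sl.
have [mh [M hM]] := bh.
have M0 : 0 <= M by exact: le_trans (hM 0).
have [mc _] := bounded_measurable_cos_transform nu.
have bcX k : bounded_measurable (fun w => cos_transform nu w ^+ k).
  by apply: bounded_measurableX; exact: bounded_measurable_cos_transform.
have cv : cos_synthesis kappa
    (fun w => h w * series (exp_coeff (t * cos_transform nu w)) n) y @[n --> \oo]
    --> cos_synthesis kappa (fun w => h w * expR (t * cos_transform nu w)) y.
  apply: (@cvg_cos_synthesis _ _ _ (M * expR (t * fine (nu setT)))).
  - move=> n; apply: measurable_funM => //.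
    under eq_fun do rewrite series_exp_coeffM.
    apply: measurable_sum => k; apply: measurable_funM => //.
    exact: (bcX k).1.
  - apply: measurable_funM => //; apply: measurableT_comp => //.
    exact: measurable_funM.
  - move=> n w; rewrite normrM ler_pM//.
    rewrite (le_trans (series_exp_coeff_norm_le _ _))// ler_expR normrM ger0_norm//.
    by rewrite ler_wpM2l// cos_transform_le.
  - by move=> w; apply: cvgMl_tmp; exact: cvg_series_exp_coeff.
apply: (ler_cvg_to sl cv); near=> n.
rewrite (le_trans (sle n))// -cos_synthesis_sum//.
by under [leRHS]eq_Rintegral do rewrite series_exp_coeffM.
Unshelve. all: by end_near.
Qed.

End semigroup_bound.

(** * Two large jumps combined with all the small ones *)

Section jump_bound.
Context {R : realType} {d : nat}.
Local Notation V := 'rV[R]_d.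
Local Notation meas := {finite_measure set V -> \bar R}.
Implicit Types (kappa nu : meas) (h : V -> R) (w x y z : V).

Variables (kappa nu1 nu2 : meas) (A sigma m t : R) (y : V).
Hypotheses (A0 : 0 < A) (m0 : 0 <= m) (t0 : 0 <= t).
Hypothesis isig : nu1.-integrable setT (EFin \o (fun x : V => dotp x x)).
Hypothesis sig : \int[nu1]_x dotp x x <= sigma.

Local Notation l1 := (fine (nu1 setT)).

(* The second moment sigma of nu1 is what keeps the convolution powers of nu1
   from leaving the region where h is large: the right-hand side is the exact
   k-fold image of the minorant m (1 - |z - y|^2 / A). *)
Lemma cos_synthesis_quadratic h k z : bounded_measurable h ->
  (forall z, m * (1 - dotp (z - y) (z - y) / A) <= cos_synthesis kappa h z) ->
  m * (l1 ^+ k * (1 - dotp (z - y) (z - y) / A) - k%:R * l1 ^+ k.-1 * sigma / A)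
  <= cos_synthesis kappa (fun w => h w * cos_transform nu1 w ^+ k) z.
Proof.
move=> bh Hh; elim: k z => [|k IH] z.
  rewrite expr0 mul1r !mul0r subr0.
  by under [leRHS]eq_Rintegral do rewrite mulr1; exact: Hh.
under [X in cos_synthesis _ X]eq_fun do rewrite exprSr mulrA.
have bhk : bounded_measurable (fun w => h w * cos_transform nu1 w ^+ k).
  apply: bounded_measurableM => //.
  by apply: bounded_measurableX; exact: bounded_measurable_cos_transform.
rewrite cos_synthesisM//=.
have l0 : 0 <= l1 by rewrite fine_ge0.
set q := dotp (z - y) (z - y).
set c := m * (l1 ^+ k * (1 - q / A) - k%:R * l1 ^+ k.-1 * sigma / A).
(* Averaging the quadratic minorant over z + x and z - x kills the linear terms, by the
   parallelogram identity; what is lost is exactly a multiple of |x|^2. *)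
have step x : c - m * l1 ^+ k / A * dotp x x <= 2^-1 *
    (cos_synthesis kappa (fun w => h w * cos_transform nu1 w ^+ k) (z + x) +
     cos_synthesis kappa (fun w => h w * cos_transform nu1 w ^+ k) (z - x)).
  apply: le_trans (ler_wpM2l _ (lerD (IH (z + x)) (IH (z - x)))); last first.
    by rewrite invr_ge0.
  have := dotp_parallelogram (z - y) x.
  rewrite (addrAC z x) (addrAC z (- x)) -/q.
  set q1 := dotp (_ + _) _; set q2 := dotp (_ - _) (_ - _) => q12.
  have -> : q2 = 2 * (q + dotp x x) - q1 by rewrite -q12; ring.
  have An0 : A != 0 by rewrite gt_eqF.
  by rewrite le_eqVlt; apply/orP; left; apply/eqP; rewrite /c; field.
have ic : nu1.-integrable setT (EFin \o (fun=> c)).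
  by apply: bounded_measurable_integrable; exact: bounded_measurable_cst.
have iq : nu1.-integrable setT (EFin \o (fun x => m * l1 ^+ k / A * dotp x x)).
  by apply: (@integrableZl _ _ _ _ _ measurableT (m * l1 ^+ k / A) (EFin \o (fun x : V => dotp x x))).
apply: (@le_trans _ _ (\int[nu1]_x (c - m * l1 ^+ k / A * dotp x x))); last first.
  apply: le_Rintegral => //.
  - exact: (integrableB measurableT ic iq).
  - apply: bounded_measurable_integrable.
    exact: bounded_measurable_cos_synthesis_shift.
rewrite RintegralB// RintegralZl// Rintegral_cst//.
apply: (@le_trans _ _ (c * l1 - m * l1 ^+ k / A * sigma)); last first.
  by rewrite lerB// ler_wpM2l// !mulr_ge0 ?invr_ge0 ?exprn_ge0// ltW.
rewrite le_eqVlt; apply/orP; left; apply/eqP; rewrite /c /=.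
have An0 : A != 0 by rewrite gt_eqF.
(* The case k = 0 is apart because [k.-1] is then 0 as well, but its coefficient k vanishes. *)
by case: (k) => [|n]; rewrite ?expr0 ?exprS /= -?[n.+2%:R]natr1 -?[n.+1%:R]natr1; field.
Qed.

Hypothesis F0 : forall z, 0 <= cos_synthesis kappa (fun=> 1) z.
Hypothesis Fm : forall z, dotp (z - y) (z - y) <= A ->
  m <= cos_synthesis kappa (fun w => cos_transform nu2 w ^+ 2) z.

(* Exactly two jumps from nu2 are kept, and all the jumps from nu1. *)
Lemma cos_synthesis_two_jumps :
  m * t ^+ 2 / 2 * expR (t * l1) * (1 - t * sigma / A) <=
  cos_synthesis kappa
    (fun w => expR (t * cos_transform nu2 w) * expR (t * cos_transform nu1 w)) y.
Proof.
have b1 : bounded_measurable (cos_transform nu1) by exact: bounded_measurable_cos_transform.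
have b2 : bounded_measurable (cos_transform nu2) by exact: bounded_measurable_cos_transform.
have bX1 k : bounded_measurable (fun w => cos_transform nu1 w ^+ k) by exact: bounded_measurableX.
have bX2 k : bounded_measurable (fun w => cos_transform nu2 w ^+ k) by exact: bounded_measurableX.
have bone : bounded_measurable (fun _ : V => 1 : R) by exact: bounded_measurable_cst.
(* The value at z = y of the quadratic minorant after [k] convolutions with [nu1]. *)
pose a k := m * (l1 ^+ k - k%:R * l1 ^+ k.-1 * sigma / A).
have jk0 j k : 0 <= cos_synthesis kappa
    (fun w => cos_transform nu1 w ^+ k * cos_transform nu2 w ^+ j) y.
  apply: cos_synthesisMX_ge0 => // z.
  have := @cos_synthesisMX_ge0 _ _ kappa nu1 _ k bone F0 z.
  by under [X in cos_synthesis _ X]eq_fun do rewrite mul1r.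
have G0 z : 0 <= cos_synthesis kappa (fun w => cos_transform nu2 w ^+ 2) z.
  have := @cos_synthesisMX_ge0 _ _ kappa nu2 _ 2 bone F0 z.
  by under [X in cos_synthesis _ X]eq_fun do rewrite mul1r.
have k2 k : a k <= cos_synthesis kappa
    (fun w => cos_transform nu1 w ^+ k * cos_transform nu2 w ^+ 2) y.
  under [X in cos_synthesis _ X]eq_fun do rewrite mulrC.
  apply: le_trans (cos_synthesis_quadratic k y (bX2 2%N) _).
    by rewrite subrr /dotp big1 ?mul0r ?subr0 ?mulr1// => i _; rewrite mxE mulr0.
  (* Outside the ball |z - y|^2 <= A the quadratic is nonpositive, so that nonnegativity is enough
     there. *)
  move=> z; have [zA|Az] := leP (dotp (z - y) (z - y)) A.
    apply: le_trans (Fm zA); rewrite -[leRHS]mulr1 ler_wpM2l// lerBlDr lerDl.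
    by rewrite divr_ge0 ?dotp_ge0// ltW.
  apply: le_trans (G0 z); rewrite mulr_ge0_le0// subr_le0 ler_pdivlMr// mul1r.
  exact: ltW.
have expk k : t ^+ 2 / 2 * a k <= cos_synthesis kappa
    (fun w => cos_transform nu1 w ^+ k * expR (t * cos_transform nu2 w)) y.
  (* Of the series in [nu2] only the term of index 2 is kept; it belongs to the partial sums with at
     least three terms. *)
  apply: (@cos_synthesis_expR_ge _ _ _ _ _ _ (fun n => if (n < 3)%N then 0 else t ^+ 2 / 2 * a k)) => //.
    move=> n; case: ltnP => [_|n3].
      by apply: sumr_ge0 => j _; rewrite mulr_ge0// divr_ge0// exprn_ge0.
    rewrite (bigD1_seq 2%N)//= ?iota_uniq//; last by rewrite mem_index_iota.
    apply: ler_wpDr.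
      by apply: sumr_ge0 => j _; rewrite mulr_ge0// divr_ge0// exprn_ge0.
    by rewrite ler_wpM2l// divr_ge0// exprn_ge0.
  by apply: cvg_near_cst; exists 3%N => // n /= n3; rewrite ltnNge n3.
pose E := series (exp_coeff (t * l1)).
(* Since k t^k / k! = t t^(k-1) / (k-1)!, the terms carrying [sigma] add up to t times a partial sum
   with one term fewer, whence [n.-1]. *)
apply: (@cos_synthesis_expR_ge _ _ kappa nu1
  (fun w => expR (t * cos_transform nu2 w)) t
  (fun n => m * t ^+ 2 / 2 * (E n - t * sigma / A * E n.-1))) => //.
- apply: bounded_measurable_expR; apply: bounded_measurableM => //.
  exact: bounded_measurable_cst.
- case=> [|n].
    by rewrite /E /series/= !big_geq// mulr0 subrr mulr0.
  apply: (@le_trans _ _ (\sum_(0 <= k < n.+1) t ^+ k / k`!%:R * (t ^+ 2 / 2 * a k))); last first.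
    apply: ler_sum => k _; rewrite ler_wpM2l//; first by rewrite divr_ge0// exprn_ge0.
    by under [leRHS]eq_Rintegral do rewrite [X in X * _]mulrC; exact: expk.
  have -> : t * sigma / A * E n = sigma / A *
      \sum_(0 <= k < n.+1) t ^+ k / k`!%:R * (k%:R * l1 ^+ k.-1).
    rewrite big_nat_recl//= mul0r mulr0 add0r /E series_exp_coeffM.
    rewrite !mulr_sumr; apply: eq_bigr => k _; rewrite factS natrM exprS.
    by field; rewrite nat1r !pnatr_eq0 (lt0r_neq0 A0) /= andbT -lt0n fact_gt0.
  rewrite /E series_exp_coeffM mulr_sumr -sumrB mulr_sumr le_eqVlt.
  apply/orP; left; apply/eqP; apply: eq_bigr => k _; rewrite /a.
  by field; rewrite pnatr_eq0 -lt0n fact_gt0 (lt0r_neq0 A0).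
- have cE : E n @[n --> \oo] --> expR (t * l1) by exact: cvg_series_exp_coeff.
  have cE1 : E n.-1 @[n --> \oo] --> expR (t * l1) by rewrite -cvg_shiftS.
  have -> : m * t ^+ 2 / 2 * expR (t * l1) * (1 - t * sigma / A) =
    m * t ^+ 2 / 2 * (expR (t * l1) - t * sigma / A * expR (t * l1)) by ring.
  apply: cvgMl_tmp; apply: cvgB => //; exact: cvgMl_tmp.
Qed.

End jump_bound.

(** * Densities and image measures as finite measures *)

Section density_Rintegral.
Context d (T : measurableType d) (R : realType).
Variables (mu : {measure set T -> \bar R}) (g : T -> R).
Hypotheses (g0 : forall x, 0 <= g x) (mg : measurable_fun setT g)
  (ig : (\int[mu]_x (g x)%:E < +oo)%E).

Lemma integrable_bounded_mul (f : T -> R) : bounded_measurable f ->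
  mu.-integrable setT (EFin \o (fun x => f x * g x)).
Proof.
move=> [mf [M fM]].
have M0 : 0 <= M by exact: le_trans (fM point).
have iMg : mu.-integrable setT (EFin \o (fun x => M * g x)).
  apply/integrableP; split; first exact/measurable_EFinP/measurable_funM.
  under eq_integral do rewrite /= ger0_norm ?mulr_ge0// EFinM.
  rewrite ge0_integralZl//; last 2 first.
  - exact/measurable_EFinP.
  - by move=> x _; rewrite lee_fin.
  by rewrite lte_mul_pinfty.
apply: (le_integrable measurableT _ _ iMg).
  exact/measurable_EFinP/measurable_funM.
by move=> x _; rewrite lee_fin !normrM ler_pM// (le_trans (fM x))// ler_norm.
Qed.

(** A bound M of |f| is added to make the integrand nonnegative, and its contribution is then
    cancelled on both sides. *)
Lemma Rintegral_density (f : T -> R) : bounded_measurable f ->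
  \int[density g0 mg ig]_x f x = \int[mu]_x (f x * g x).
Proof.
move=> bf; have [mf [M fM]] := bf.
have bM : bounded_measurable (fun _ : T => M) by exact: bounded_measurable_cst.
have bfM : bounded_measurable (fun x => f x + M) by exact: bounded_measurableD.
have fM0 x : 0 <= f x + M by rewrite -lerBlDr sub0r; have := fM x; rewrite ler_norml => /andP[].
have E h : bounded_measurable h -> (forall x, 0 <= h x) ->
    \int[density g0 mg ig]_x h x = \int[mu]_x (h x * g x).
  move=> [mh _] h0; rewrite /Rintegral integral_density//.
  exact/measurable_EFinP.
have := E _ bfM fM0; rewrite RintegralD//; do ?exact: bounded_measurable_integrable.
under [RHS]eq_Rintegral do rewrite mulrDl.
rewrite RintegralD//; do ?exact: integrable_bounded_mul.
rewrite (E _ bM)//; first exact: addIr.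
by move=> _; exact: le_trans (fM point).
Qed.

End density_Rintegral.

Section image_measures.
Context {R : realType}.

(** Finiteness of the total mass is here a hypothesis and not part of the structure; taking the
    density 1 rebuilds the measure with the finite measure structure. *)
Lemma finite_measure_of d (T : measurableType d) (m : {measure set T -> \bar R}) :
  (m setT < +oo)%E -> exists k : {finite_measure set T -> \bar R},
  forall f : T -> R, bounded_measurable f -> \int[k]_x f x = \int[m]_x f x.
Proof.
move=> moo.
have ioo : (\int[m]_(_ in setT) (1 : R)%:E < +oo)%E by rewrite integral_cst// mul1e.
have m1 : measurable_fun setT (fun _ : T => 1 : R) by [].
exists (density (fun _ : T => ler01) m1 ioo) => f bf.
by rewrite Rintegral_density//; apply: eq_Rintegral => x _; rewrite mulr1.
Qed.

Lemma finite_image_measure d d' (T : measurableType d) (T' : measurableType d')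
    (m : {measure set T -> \bar R}) (w : T -> T') :
  (m setT < +oo)%E -> measurable_fun setT w ->
  exists k : {finite_measure set T' -> \bar R},
  forall f : T' -> R, bounded_measurable f -> \int[k]_x f x = \int[m]_x f (w x).
Proof.
move=> moo mw.
unshelve epose (m' := pushforward m w : {measure set T' -> \bar R}); first exact: mw.
have [|k kE] := @finite_measure_of _ _ m'; first exact: moo.
exists k => f bf; rewrite kE// /Rintegral /m'.
rewrite integral_pushforward//; first by apply/measurable_EFinP; case: bf.
apply: (@measurable_bounded_integrable _ _ _ _ (f \o w)) => //.
- by rewrite preimage_setT.
- by rewrite preimage_setT; exact: (measurableT_comp bf.1 mw).
have [_ [M fM]] := bf; exists M; split; first exact: num_real.
by move=> x Mx y _ /=; rewrite (le_trans (fM _))// ltW.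
Qed.

End image_measures.

(** * Tents as positive combinations of cosines *)

Section trigonometry.
Context {R : realType}.
Implicit Types u x : R.

Lemma sin_MVT x : 0 <= x -> exists2 c, 0 <= c <= x & sin x = cos c * x.
Proof.
move=> x0.
have ds y : y \in `]0, x[ -> is_derive y 1 sin (cos y) by move=> _; exact: is_derive_sin.
have cs : {within `[0, x], continuous (sin : R -> R)}.
  by apply: continuous_subspaceT => y; exact: continuous_sin.
have [c] := MVT_segment x0 ds cs.
by rewrite in_itv/= sin0 !subr0 => c0x sx; exists c.
Qed.

Lemma onemcosE u : 1 - cos u = 2 * sin (`|u| / 2) ^+ 2.
Proof.
have {1}-> : u = Num.sg u * ((`|u| / 2) *+ 2).
  by rewrite -mulr_natr divfK ?pnatr_eq0// -numEsg.
have [->|u0] := eqVneq u 0.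
  by rewrite sgr0 !mul0r normr0 mul0r cos0 sin0 expr0n mulr0 subrr.
rewrite cos_sg// cos_mulr2n cos2sin2; ring.
Qed.

Lemma onemcos_ge0 u : 0 <= 1 - cos u.
Proof. by rewrite subr_ge0 cos_le1. Qed.

Lemma onemcos_le u : 1 - cos u <= u ^+ 2 / 2.
Proof.
rewrite onemcosE; have [|c _ ->] := @sin_MVT (`|u| / 2).
  by rewrite divr_ge0.
have -> : u ^+ 2 / 2 = 2 * (1 * (`|u| / 2) ^+ 2).
  by rewrite mul1r exprMn real_normK ?num_real// exprVn; field.
by rewrite ler_wpM2l// exprMn ler_wpM2r ?sqr_ge0// cos2_le1.
Qed.

(** By the half-angle formula and sin(|u|/2) = cos(c) |u|/2 with 0 <= c <= 1, where cos(c) >=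
    cos(1). The constant reappears in the bound on the second moment. *)
Lemma onemcos_ge u : `|u| <= 1 -> cos 1 ^+ 2 / 2 * u ^+ 2 <= 1 - cos u.
Proof.
move=> u1; rewrite onemcosE; have [|c /andP[c0 cu] ->] := @sin_MVT (`|u| / 2).
  by rewrite divr_ge0.
have -> : cos 1 ^+ 2 / 2 * u ^+ 2 = 2 * (cos 1 ^+ 2 * (`|u| / 2) ^+ 2).
  by rewrite exprMn real_normK ?num_real// exprVn; field.
have c1 : c <= 1 by rewrite (le_trans cu)// ler_pdivrMr// mul1r (le_trans u1)// ler1n.
have pi1 : 1 <= pi :> R by have := pi_ge2 R; lra.
have c1pi : 1 \in `[0, (pi : R)] by rewrite in_itv/= ler01.
have ccpi : c \in `[0, (pi : R)] by rewrite in_itv/= c0 (le_trans c1).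
have cc1 : cos 1 <= cos c by rewrite leNgt ltr_cos// -leNgt.
have c10 : 0 <= cos 1 :> R by exact/ltW/cos1_gt0.
by rewrite ler_wpM2l// [leRHS]exprMn ler_wpM2r ?sqr_ge0// lerXn2r// nnegrE (le_trans c10).
Qed.

End trigonometry.

Section fejer.
Context {R : realType}.
Local Notation leb := (@lebesgue_measure R).

(** Uniqueness of Lebesgue measure: the rescaled image measure agrees with it on half-open
    intervals. *)
Lemma lebesgue_measureZ (a : R) : 0 < a ->
  forall A : set R, measurable A ->
  leb A = (a%:E * leb ((fun s : R => a * s)%R @^-1` A))%E.
Proof.
move=> a0 A mA.
have ma : measurable_fun setT (fun s : measurableTypeR R => a * s : measurableTypeR R).
  exact: measurable_funM.
unshelve epose (m := mscale (NngNum (ltW a0)) (pushforward leb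
  (fun s : measurableTypeR R => a * s : measurableTypeR R)) :
  {measure set (measurableTypeR R) -> \bar R}); first exact: ma.
apply: (@lebesgue_measure_unique _ m) mA => X /ocitvP[->|[[x y] /= xy ->]].
  by rewrite !measure0.
have pre : (fun s => a * s) @^-1` `]x, y]%classic = `]x / a, y / a]%classic.
  apply/seteqP; split => s /=; rewrite !in_itv/= ler_pdivlMr// ltr_pdivrMr//;
  by rewrite ![s * a]mulrC.
have mE (B : set R) : m B = (a%:E * leb ((fun s : R => a * s)%R @^-1` B))%E by [].
rewrite mE pre !lebesgue_measure_itv/= !lte_fin ltr_pM2r ?invr_gt0// xy.
by rewrite -EFinB -!EFinB -EFinM; congr EFin; field; rewrite gt_eqF.
Qed.

Lemma ge0_integral_scale (a : R) (f : R -> \bar R) : 0 < a ->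
  measurable_fun (`]0, +oo[ : set R) f -> (forall s, 0 < s -> (0 <= f s)%E) ->
  (\int[leb]_(s in `]0%R, +oo[) f s =
   a%:E * \int[leb]_(s in `]0%R, +oo[) f (a * s)%R)%E.
Proof.
move=> a0 mf f0.
have ma : measurable_fun setT (fun s : measurableTypeR R => a * s : measurableTypeR R).
  exact: measurable_funM.
unshelve epose (p := pushforward leb
  (fun s : measurableTypeR R => a * s : measurableTypeR R) :
  {measure set (measurableTypeR R) -> \bar R}); first exact: ma.
pose m := mscale (NngNum (ltW a0)) p.
have fD : {in `]0, +oo[%classic, forall s, (0 <= f s)%E}.
  by move=> s; rewrite inE/= in_itv/= andbT; exact: f0.
rewrite (@eq_measure_integral _ _ _ _ m); last first.
  by move=> A mA _; exact: (lebesgue_measureZ a0 mA).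
rewrite ge0_integral_mscale//; last by move=> s sD; apply: fD; rewrite inE.
congr (_ * _)%E; rewrite ge0_integral_pushforward//.
suff -> : (fun s => a * s) @^-1` `]0, +oo[%classic = `]0, +oo[%classic :> set R by [].
by apply/seteqP; split => s /=; rewrite !in_itv/= !andbT pmulr_rgt0.
Qed.

(** The integrand of the formula |a| = const * int (1 - cos(a s)) / s^2 ds over s > 0; for a = 1 it
    is, up to a constant, the Fejer kernel, whose cosine transform is the tent. *)
Definition fejer (a s : R) : R := (1 - cos (a * s)) / s ^+ 2.

Lemma fejer_ge0 a s : 0 <= fejer a s.
Proof. by rewrite divr_ge0 ?onemcos_ge0 ?sqr_ge0. Qed.

Lemma measurable_fejer a : measurable_fun (`]0, +oo[ : set R) (fejer a).
Proof.
apply: open_continuous_measurable_fun; first exact: interval_open.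
move=> s; rewrite inE/= in_itv/= andbT => s0; rewrite /continuous_at.
apply: cvgM.
  apply: cvgB; first exact: cvg_cst.
  apply: (@continuous_comp _ _ _ (fun s => a * s) cos); last exact: continuous_cos.
  exact: mulrl_continuous.
apply: cvgV; first by rewrite gt_eqF// exprn_gt0.
exact: exprn_continuous.
Qed.

Lemma integral_fejer1_lty : (\int[leb]_(s in `]0%R, +oo[) (fejer 1 s)%:E < +oo)%E.
Proof.
(* From 1 - cos s <= s^2 / 2 and 1 - cos s <= 2, the product (1 - cos s) (1 + s^2) is at most (5/2)
   s^2, hence at most 4 s^2. *)
apply: (@le_lt_trans _ _ (\int[leb]_(s in `]0%R, +oo[) (4 * (oneDsqr s)^-1)%:E)%E).
  apply: ge0_le_integral => //.
  - by move=> s _; rewrite lee_fin fejer_ge0.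
  - by apply/measurable_EFinP; exact: measurable_fejer.
  - apply/measurable_EFinP/measurable_funM => //; apply: measurable_funTS.
    exact: continuous_measurable_fun continuous_oneDsqrV.
  move=> s /=; rewrite in_itv/= andbT => s0; rewrite lee_fin /fejer mul1r.
  rewrite ler_pdivrMr ?exprn_gt0// mulrAC ler_pdivlMr ?oneDsqr_gt0//.
  rewrite /oneDsqr mulrDr mulr1.
  have := onemcos_le s; have := onemcos_ge0 s; have := cos_geN1 s.
  set c := cos s => *; nra.
under eq_integral do rewrite EFinM.
rewrite ge0_integralZl//; last first.
  apply/measurable_EFinP/measurable_funTS.
  exact: continuous_measurable_fun continuous_oneDsqrV.
rewrite lte_mul_pinfty ?lee_fin//.
apply: (@le_lt_trans _ _ (\int[leb]_(s in `[0%R, +oo[) (oneDsqr s)^-1%:E)%E).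
  apply: ge0_subset_integral => //.
  - apply/measurable_EFinP/measurable_funTS.
    exact: continuous_measurable_fun continuous_oneDsqrV.
  - by move=> s /=; rewrite !in_itv/= !andbT => /ltW.
by rewrite integral0y_oneDsqr ltry.
Qed.

Lemma integral_fejer1_gt0 : (0 < \int[leb]_(s in `]0%R, +oo[) (fejer 1 s)%:E)%E.
Proof.
apply: (@lt_le_trans _ _ (\int[leb]_(s in `]0%R, 1%R]) (cos 1 ^+ 2 / 2)%:E)%E).
  rewrite integral_cst//= lebesgue_measure_itv/= lte_fin ltr01 sube0 mule1 lte_fin.
  by rewrite divr_gt0// exprn_gt0// cos1_gt0.
apply: (@le_trans _ _ (\int[leb]_(s in `]0%R, 1%R]) (fejer 1 s)%:E)%E).
  apply: ge0_le_integral => //.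
  - by move=> s _; rewrite lee_fin divr_ge0// sqr_ge0.
  - apply/measurable_EFinP; apply: measurable_funS (measurable_fejer 1) => //.
    by move=> s /=; rewrite !in_itv/= => /andP[->].
  - move=> s /=; rewrite in_itv/= => /andP[s0 s1]; rewrite lee_fin /fejer mul1r.
    rewrite ler_pdivlMr ?exprn_gt0//; apply: onemcos_ge.
    by rewrite ger0_norm// ltW.
apply: ge0_subset_integral => //.
- by apply/measurable_EFinP; exact: measurable_fejer.
- by move=> s _; rewrite lee_fin fejer_ge0.
- by move=> s /=; rewrite !in_itv/= => /andP[->].
Qed.

(** Classically pi/2. It serves as a normalizing constant, so that its positivity and finiteness are
    what matters. *)
Definition fejer_mass : R := fine (\int[leb]_(s in `]0%R, +oo[) (fejer 1 s)%:E)%E.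

Lemma fejer_mass_gt0 : 0 < fejer_mass.
Proof. by rewrite fine_gt0// integral_fejer1_gt0 integral_fejer1_lty. Qed.

(** The substitution s -> |a| s turns [fejer 1] into [fejer a] divided by |a|^2; the case a = 0 is
    direct. *)
Lemma integral_fejer a :
  (\int[leb]_(s in `]0%R, +oo[) (fejer a s)%:E = (`|a| * fejer_mass)%:E)%E.
Proof.
have fm : (\int[leb]_(s in `]0%R, +oo[) (fejer 1 s)%:E = fejer_mass%:E)%E.
  rewrite fineK// ge0_fin_numE ?integral_fejer1_lty//.
  by apply: integral_ge0 => s _; rewrite lee_fin fejer_ge0.
have [->|a0] := eqVneq a 0.
  rewrite normr0 mul0r integral0_eq// => s _.
  by rewrite /fejer mul0r cos0 subrr mul0r.
have na0 : 0 < `|a| by rewrite normr_gt0.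
rewrite EFinM -fm (@ge0_integral_scale `|a| (fun s => (fejer 1 s)%:E))//; last 2 first.
- by apply/measurable_EFinP; exact: measurable_fejer.
- by move=> s _; rewrite lee_fin fejer_ge0.
rewrite muleA -EFinM -ge0_integralZl//; last 2 first.
- apply/measurable_EFinP.
  have ms : measurable_fun (`]0, +oo[ : set R) (fun s : R => `|a| * s) by exact: measurable_funM.
  apply: (measurable_comp _ _ (measurable_fejer 1) ms) => //.
  by move=> _ [s /= + <-]; rewrite !in_itv/= !andbT pmulr_rgt0.
- by move=> s _; rewrite lee_fin fejer_ge0.
apply: eq_integral => s _; rewrite -EFinM; congr EFin; rewrite /fejer mul1r.
have -> : cos (`|a| * s) = cos (a * s).
  by rewrite -[LHS]cos_norm -[RHS]cos_norm !normrM normr_id.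
have [->|s0] := eqVneq s 0; first by rewrite !mulr0 cos0 subrr !mul0r mulr0.
by field; rewrite s0 normr_eq0.
Qed.

End fejer.

Section tent.
Context {R : realType}.
Local Notation leb := (@lebesgue_measure R).
Implicit Types a s x : R.

Definition tent x : R := Num.max 0 (1 - `|x|).

Lemma tent_ge0 x : 0 <= tent x. Proof. by rewrite le_max lexx. Qed.

Lemma tent_le1 x : tent x <= 1.
Proof. by rewrite ge_max ler01 lerBlDr lerDl normr_ge0. Qed.

Lemma tent_out x : 1 <= `|x| -> tent x = 0.
Proof. by move=> x1; apply: max_l; rewrite subr_le0. Qed.

Lemma tent_in x : `|x| <= 2^-1 -> 2^-1 <= tent x.
Proof. by move=> x1; rewrite le_max; apply/orP; right; lra. Qed.

(** The tent is half the second difference of the absolute value. Each absolute value is then an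
    integral of [fejer], which turns the tent into an integral of cosines. *)
Lemma tentE x : tent x = 2^-1 * `|1 + x| + 2^-1 * `|1 - x| - `|x|.
Proof.
rewrite /tent; have [x0|x0] := lerP 0 x; rewrite ?(ger0_norm x0) ?(ltr0_norm x0).
- rewrite (@ger0_norm _ (1 + x)); last lra.
  have [x1|x1] := lerP 0 (1 - x); rewrite ?(ger0_norm x1) ?(ltr0_norm x1); lra.
- rewrite (@ger0_norm _ (1 - x)); last lra.
  rewrite opprK; have [x1|x1] := lerP 0 (1 + x);
    rewrite ?(ger0_norm x1) ?(ltr0_norm x1); lra.
Qed.

Lemma fejer_integrable a : leb.-integrable (`]0, +oo[ : set R) (EFin \o fejer a).
Proof.
apply/integrableP; split; first by apply/measurable_EFinP; exact: measurable_fejer.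
under eq_integral do rewrite /= ger0_norm ?fejer_ge0//.
by rewrite integral_fejer ltry.
Qed.

Lemma tent_cos : exists k : {finite_measure set (measurableTypeR R) -> \bar R},
  forall x, tent x = \int[k]_s cos (s * x).
Proof.
pose D := `]0%R, +oo[%classic : set R.
(* The Fejer kernel on the positive half-line, normalized to total mass 1 = tent(0). *)
pose g (s : measurableTypeR R) : R := (fejer 1 \_ D) s / fejer_mass.
have mD : measurable (D : set (measurableTypeR R)) by exact: measurable_itv.
have K0 := @fejer_mass_gt0 R.
have g0 (s : measurableTypeR R) : 0 <= g s.
  by rewrite divr_ge0 ?(ltW K0)// patchE; case: ifP => // _; exact: fejer_ge0.
have mg : measurable_fun (setT : set (measurableTypeR R)) g.
  apply: measurable_funM => //.
  by apply/(measurable_restrictT _ mD); exact: measurable_fejer.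
have ig : (\int[leb]_s (g s)%:E < +oo)%E.
  under eq_integral do rewrite /g EFinM muleC.
  rewrite ge0_integralZl//; last 3 first.
  - by apply/measurable_EFinP/(measurable_restrictT _ mD); exact: measurable_fejer.
  - by move=> s _; rewrite lee_fin patchE; case: ifP => // _; exact: fejer_ge0.
  - by rewrite lee_fin invr_ge0 ltW.
  rewrite lte_mul_pinfty ?lee_fin ?invr_ge0 ?(ltW K0)//.
  apply: le_lt_trans (@integral_fejer1_lty R).
  rewrite [leRHS]integral_mkcond le_eqVlt; apply/orP; left; apply/eqP.
  by apply: eq_integral => s _; rewrite !patchE -/D; case: ifP.
exists (density g0 mg ig) => x.
rewrite Rintegral_density; last first.
  by apply: bounded_measurable_cos; exact: measurable_funM.
(* The second difference of [fejer] in its first argument is [fejer 1 s] times cos(s x), by the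
   addition formulas. *)
transitivity (\int[leb]_(s in D) (fejer_mass^-1 *
    (2^-1 * fejer (1 + x) s + 2^-1 * fejer (1 - x) s - fejer x s))); last first.
  rewrite Rintegral_mkcond; apply: eq_Rintegral => s _.
  rewrite /g !patchE; case: ifPn => sD; last by rewrite mul0r mulr0.
  have s0 : s != 0.
    by move: sD; rewrite inE /D/= in_itv/= andbT => /gt_eqF ->.
  have -> : fejer (1 + x) s = (1 - (cos s * cos (s * x) - sin s * sin (s * x))) / s ^+ 2.
    by rewrite /fejer [(1 + x) * s]mulrDl mul1r cosD (mulrC x).
  have -> : fejer (1 - x) s = (1 - (cos s * cos (s * x) + sin s * sin (s * x))) / s ^+ 2.
    by rewrite /fejer [(1 - x) * s]mulrBl mul1r cosB (mulrC x).
  rewrite /fejer mul1r (mulrC x).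
  by field; rewrite s0 gt_eqF.
have iZ c a : leb.-integrable D (EFin \o (fun s => c * fejer a s)).
  exact: (integrableZl mD c (fejer_integrable a)).
have i2 : leb.-integrable D (EFin \o
    (fun s => 2^-1 * fejer (1 + x) s + 2^-1 * fejer (1 - x) s)).
  exact: (integrableD mD (iZ _ _) (iZ _ _)).
have fE a : \int[leb]_(s in D) fejer a s = `|a| * fejer_mass.
  by rewrite /Rintegral integral_fejer.
rewrite RintegralZl//; last first.
  exact: (integrableB mD i2 (fejer_integrable x)).
rewrite RintegralB//; last exact: fejer_integrable.
rewrite RintegralD//; do ?exact: iZ.
rewrite !RintegralZl//; do ?exact: fejer_integrable.
by rewrite !fE tentE; field; rewrite gt_eqF.
Qed.
End tent.

Section positive_definite.
Context {R : realType} {d : nat}.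
Local Notation V := 'rV[R]_d.
Local Notation meas := {finite_measure set V -> \bar R}.
Implicit Types (f : V -> R) (y : V).

(** Real positive definite functions, in the form that Bochner's theorem gives them. Unlike
    nonnegativity of [f], this property is what gives access to the characteristic function. *)
Definition cos_positive f :=
  exists k : meas, forall y, f y = cos_synthesis k (fun=> 1) y.

Lemma cos_synthesis1 (k : meas) y : cos_synthesis k (fun=> 1) y = \int[k]_w cos (dotp w y).
Proof. by rewrite /cos_synthesis; under eq_Rintegral do rewrite mul1r. Qed.

Lemma cos_positive1 : cos_positive (fun=> 1).
Proof.
exists (\d_(0 : V)) => y; rewrite cos_synthesis1 /Rintegral integral_dirac//.
  by rewrite diracT mul1e /= /dotp big1 ?cos0// => i _; rewrite mxE mul0r.
apply/measurable_EFinP; apply: (proj1 (bounded_measurable_cos_dotp _ _)) => //.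
Qed.

(** Since cos a cos b = (cos(a + b) + cos(a - b)) / 2, the measure of the product is half the sum of
    the images of [k1] x [k2] under addition and subtraction. *)
Lemma cos_positiveM f1 f2 : cos_positive f1 -> cos_positive f2 ->
  cos_positive (fun y => f1 y * f2 y).
Proof.
move=> [k1 k1E] [k2 k2E].
have prodoo : ((k1 \x k2) setT < +oo)%E.
  have : ((k1 \x k2) (setT `*` setT) < +oo)%E.
    rewrite product_measure1E// lte_mul_pinfty// ?fin_num_measure//.
    by rewrite ltey_eq fin_num_measure.
  by rewrite setXTT.
have mD : measurable_fun setT (fun p : V * V => p.1 + p.2) by exact: measurable_addrV.
have mB : measurable_fun setT (fun p : V * V => p.1 - p.2).
  by apply: measurable_addrV => //; exact: measurable_opprV.
have [kD kDE] := finite_image_measure prodoo mD.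
have [kB kBE] := finite_image_measure prodoo mB.
have bc y : bounded_measurable (fun w : V => cos (dotp w y)).
  exact: bounded_measurable_cos_dotp.
have half0 (w : V) : 0 <= 2^-1 :> R by rewrite invr_ge0.
have mhalf : measurable_fun setT (fun _ : V => 2^-1 : R) by [].
have ihalf : (\int[measure_add kD kB]_w (2^-1 : R)%:E < +oo)%E.
  rewrite integral_cst// lte_mul_pinfty ?lee_fin//.
  rewrite [X in (X < _)%E](_ : _ = (kD setT + kB setT)%E); last exact: measure_addE.
  by rewrite lte_add_pinfty// ltey_eq fin_num_measure.
exists (density half0 mhalf ihalf) => y.
rewrite cos_synthesis1 Rintegral_density//.
have ic (k : meas) : k.-integrable setT (EFin \o (fun w => cos (dotp w y) * 2^-1)).
  apply: bounded_measurable_integrable; apply: bounded_measurableM => //.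
  exact: bounded_measurable_cst.
rewrite /Rintegral (integral_measure_add measurableT (ic kD) (ic kB)).
rewrite fineD; try by apply: integrable_fin_num; [|exact: ic].
have bc2 : bounded_measurable (fun w : V => cos (dotp w y) * 2^-1).
  by apply: bounded_measurableM => //; exact: bounded_measurable_cst.
transitivity (\int[kD]_w (cos (dotp w y) * 2^-1) + \int[kB]_w (cos (dotp w y) * 2^-1)) => //.
rewrite (kDE _ bc2) (kBE _ bc2).
have bp (h : V * V -> V) : measurable_fun setT h ->
    bounded_measurable (fun p => cos (dotp (h p) y) * 2^-1).
  move=> mh; apply: bounded_measurableM; last exact: bounded_measurable_cst.
  exact: bounded_measurable_cos_dotp.
rewrite -RintegralD//; last 2 first.
- exact: (bounded_measurable_integrable_prod k1 k2 (bp _ mD)).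
- exact: (bounded_measurable_integrable_prod k1 k2 (bp _ mB)).
transitivity (\int[(k1 \x k2)%E]_p (cos (dotp p.1 y) * cos (dotp p.2 y))); last first.
  apply: eq_Rintegral => -[a b] _ /=; rewrite !(dotpC _ y) -mulrDl cos_dotp_sym.
  by field.
rewrite bounded_integral_prod; last first.
  by apply: bounded_measurableM; exact: bounded_measurable_cos_dotp.
transitivity (\int[k1]_a (f2 y * cos (dotp a y))).
  by rewrite RintegralZl//; [rewrite -cos_synthesis1 -k1E mulrC|exact: bounded_measurable_integrable].
apply: eq_Rintegral => a _ /=; rewrite RintegralZl//; last exact: bounded_measurable_integrable.
by rewrite k2E cos_synthesis1 mulrC.
Qed.

(** The spectral measure of the one-dimensional tent is carried to the i-th axis, scaled by 1 /
    delta. *)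
Lemma cos_positive_tent (delta : R) (i : 'I_d) : 
  cos_positive (fun y => tent (y ord0 i / delta)).
Proof.
have [k kE] := @tent_cos R.
pose w (s : measurableTypeR R) : V := (s / delta) *: delta_mx ord0 i.
have mw : measurable_fun setT w.
  apply: measurable_fun_rV => j; under eq_fun do rewrite /w !mxE.
  by apply: measurable_funM => //; exact: measurable_funM.
have koo : (k setT < +oo)%E by rewrite ltey_eq fin_num_measure.
have [k' k'E] := finite_image_measure koo mw.
exists k' => y; rewrite kE cos_synthesis1 k'E; last exact: bounded_measurable_cos_dotp.
apply: eq_Rintegral => s _; congr cos.
rewrite /w dotpZl /dotp (bigD1 i)//= big1 => [|j ji]; rewrite !mxE ?eqxx ?(negbTE ji) ?andbF.
  by rewrite mul1r addr0 mulrAC mulrA.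
by rewrite mul0r.
Qed.

Lemma cos_positive_prod_tent (delta : R) :
  cos_positive (fun y => \prod_(i < d) tent (y ord0 i / delta)).
Proof.
elim: (index_enum _) => [|i s IH].
  by under eq_fun do rewrite big_nil; exact: cos_positive1.
under eq_fun do rewrite big_cons.
by apply: cos_positiveM => //; exact: cos_positive_tent.
Qed.

End positive_definite.

(** * Truncated Levy measures *)

Section enorm.
Context {R : realType} {d : nat}.
Implicit Types x y z : 'rV[R]_d.

Lemma enorm_ge0 x : 0 <= enorm x. Proof. exact: sqrtr_ge0. Qed.

Lemma sqr_enorm x : enorm x ^+ 2 = dotp x x.
Proof. by rewrite sqr_sqrtr// dotp_ge0. Qed.

Lemma enorm0 : enorm (0 : 'rV[R]_d) = 0.
Proof. by rewrite /enorm /dotp big1 ?sqrtr0// => i _; rewrite mxE mul0r. Qed.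

Lemma enorm_eq0 x : (enorm x == 0) = (x == 0).
Proof.
apply/eqP/eqP => [x0|->]; last exact: enorm0.
have : dotp x x = 0 by rewrite -sqr_enorm x0 expr0n.
move/eqP; rewrite psumr_eq0 => [/allP h|i _]; last by rewrite -expr2 sqr_ge0.
apply/rowP => i; rewrite mxE; apply/eqP.
by have := h i (mem_index_enum _); rewrite mulf_eq0 orbb.
Qed.

Lemma enorm_gt0 x : (0 < enorm x) = (x != 0).
Proof. by rewrite lt_neqAle enorm_ge0 andbT eq_sym enorm_eq0. Qed.

Lemma enormZ a x : enorm (a *: x) = `|a| * enorm x.
Proof.
by rewrite /enorm dotpZl dotpC dotpZl mulrA -expr2 sqrtrM ?sqr_ge0// sqrtr_sqr.
Qed.

Lemma enormN x : enorm (- x) = enorm x.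
Proof. by rewrite -scaleN1r enormZ normrN1 mul1r. Qed.

Lemma enormB x y : enorm (x - y) = enorm (y - x).
Proof. by rewrite -opprB enormN. Qed.

(** Cauchy-Schwarz, from the nonnegative square of |y| x - |x| y. *)
Lemma dotp_le x y : dotp x y <= enorm x * enorm y.
Proof.
have [->|x0] := eqVneq x 0.
  by rewrite enorm0 mul0r /dotp big1// => i _; rewrite mxE mul0r.
have [->|y0] := eqVneq y 0.
  by rewrite enorm0 mulr0 /dotp big1// => i _; rewrite mxE mulr0.
have xp : 0 < enorm x by rewrite enorm_gt0.
have yp : 0 < enorm y by rewrite enorm_gt0.
have := dotp_ge0 (enorm y *: x - enorm x *: y).
rewrite !(dotpDl, dotpDr, dotpNl, dotpNr) !dotpZl ![dotp _ (_ *: _)]dotpC !dotpZl.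
rewrite (dotpC y x) -!sqr_enorm => h.
rewrite -(ler_pM2l (mulr_gt0 xp yp)); nra.
Qed.

Lemma enormD x y : enorm (x + y) <= enorm x + enorm y.
Proof.
rewrite -(@ler_pXn2r _ 2) ?nnegrE ?addr_ge0 ?enorm_ge0//.
rewrite sqr_enorm dotpDl !dotpDr (dotpC y x) -!sqr_enorm.
by have := dotp_le x y; nra.
Qed.

Lemma enorm_le_add x y : enorm x <= enorm (x - y) + enorm y.
Proof. by rewrite -{1}(subrK y x) enormD. Qed.

Lemma coord_le_enorm x i : `|x ord0 i| <= enorm x.
Proof.
rewrite -sqrtr_sqr ler_sqrt ?dotp_ge0// /dotp (bigD1 i)//= -expr2 lerDl.
by apply: sumr_ge0 => j _; rewrite -expr2 sqr_ge0.
Qed.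

Lemma enorm_le_coord x r : (forall i, `|x ord0 i| <= r) -> enorm x <= d%:R * r.
Proof.
move=> h; have [d0|d0] := posnP d.
  rewrite /enorm /dotp big1 ?sqrtr0 ?d0 ?mul0r// => i _.
  by have := ltn_ord i; rewrite [X in (_ < X)%N]d0.
have r0 : 0 <= r by exact: le_trans (h (Ordinal d0)).
rewrite -(@ler_pXn2r _ 2) ?nnegrE ?mulr_ge0 ?enorm_ge0//.
rewrite sqr_enorm exprMn (@le_trans _ _ (d%:R * r ^+ 2))//.
  rewrite mulr_natl -[X in _ *+ X]card_ord -sumr_const; apply: ler_sum => i _.
  by rewrite -expr2 -real_normK ?num_real// lerXn2r// nnegrE.
by rewrite ler_wpM2r ?sqr_ge0// -natrX ler_nat expnS expn1 leq_pmulr.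
Qed.

(** Some coordinate carries at least the fraction 1/d of the norm; this reduces the tail of the Levy
    measure to one-dimensional frequencies. *)
Lemma enorm_coord x r : 0 < r -> (0 < d)%N -> r <= enorm x ->
  exists i, r / d%:R <= `|x ord0 i|.
Proof.
move=> r0 d0 rx; apply: contrapT => h.
have dR : 0 < d%:R :> R by rewrite ltr0n.
have hi i : `|x ord0 i| < r / d%:R.
  by rewrite ltNge; apply/negP => ?; apply: h; exists i.
have : enorm x < r; last by rewrite ltNge rx.
have [i0 _ hm] := @arg_maxP _ _ _ (Ordinal d0) xpredT (fun i => `|x ord0 i|) isT.
apply: (@le_lt_trans _ _ (d%:R * `|x ord0 i0|)).
  by apply: enorm_le_coord => i; exact: hm.
by rewrite mulrC -ltr_pdivlMr.
Qed.

Lemma measurable_enorm d' (T : measurableType d') (f : T -> 'rV[R]_d) :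
  measurable_fun setT f -> measurable_fun setT (fun t => enorm (f t)).
Proof.
move=> mf; rewrite /enorm; apply: measurableT_comp; last exact: measurable_dotp.
exact: continuous_measurable_fun (@sqrt_continuous R).
Qed.

Definition cube z (r : R) : set 'rV[R]_d := [set x | forall i, `|x ord0 i - z ord0 i| <= r].

Lemma cubeE z r : cube z r = [set x | forall i, (`[z ord0 i - r, z ord0 i + r]%classic) (x ord0 i)].
Proof.
by apply/seteqP; split => x h i; have := h i; rewrite /= in_itv/= ler_distl.
Qed.

Lemma measurable_cube z r : measurable (cube z r).
Proof.
have -> : cube z r = \bigcap_(i in [set: 'I_d])
    [set x : 'rV[R]_d | (`[z ord0 i - r, z ord0 i + r]%classic) (x ord0 i)].
  by rewrite cubeE; apply/seteqP; split => [x h i _|x h i]; [exact: h|exact: (h i I)].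
apply: fin_bigcap_measurable => // i _.
have := @measurable_coord _ R d i measurableT (`[z ord0 i - r, z ord0 i + r]%classic).
by rewrite setTI; apply; exact: measurable_itv.
Qed.

Lemma lebesgue_cube z r : 0 <= r -> lebesgue_rV d (cube z r) = ((2 * r) ^+ d)%:E.
Proof.
move=> r0; rewrite cubeE.
pose A i := `[z ord0 i - r, z ord0 i + r]%classic : set R.
transitivity (\big[mule/1%E]_(i < d) lebesgue_measure (A i)).
  by apply: (lebesgue_rV_box (A := A)) => i; exact: measurable_itv.
transitivity (\big[mule/1%E]_(i < d) (2 * r)%:E).
  apply: eq_bigr => i _; rewrite /A lebesgue_measure_itv/= lte_fin.
  case: ltP => [_|h]; first by rewrite -EFinB; congr EFin; ring.
  have -> : r = 0 by lra.
  by rewrite mulr0.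
by rewrite prodEFin prodr_const card_ord.
Qed.

Lemma cube_enorm z r x : cube z r x -> enorm (x - z) <= d%:R * r.
Proof. by move=> h; apply: enorm_le_coord => i; rewrite !mxE; exact: h. Qed.

End enorm.

Section levy_restriction.
Context {R : realType} {d : nat}.
Local Notation V := 'rV[R]_d.
Local Notation leb := (lebesgue_rV d : {sigma_finite_measure set V -> \bar R}).
Variable J : V -> R.
Hypothesis LJ : levy_density J.

(** The measure J(x) dx on [D], specified by its integrals of nonnegative functions. The sign of [J]
    at 0 is unknown, so that such measures are only built on sets away from 0. *)
Definition restriction (nu : set V -> \bar R) (D : set V) :=
  forall f : V -> \bar R, measurable_fun setT f -> (forall x, (0 <= f x)%E) ->
  (\int[nu]_x f x = \int[leb]_(x in D) (f x * (J x)%:E))%E.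

Definition far (r : R) : set V := [set x | r < enorm x].
Definition annulus (r s : R) : set V := [set x | r < enorm x <= s].

Lemma measurable_far r : measurable (far r).
Proof.
have : measurable_fun setT (@enorm R d) by exact: measurable_enorm.
move=> /(_ measurableT (`]r, +oo[%classic) (measurable_itv _)); rewrite setTI.
by congr measurable; apply/seteqP; split => x /=; rewrite in_itv/= andbT.
Qed.

Lemma measurable_annulus r s : measurable (annulus r s).
Proof.
have : measurable_fun setT (@enorm R d) by exact: measurable_enorm.
move=> /(_ measurableT (`]r, s]%classic) (measurable_itv _)); rewrite setTI.
by congr measurable; apply/seteqP; split => x /=; rewrite in_itv/=.
Qed.

Lemma levy_density_gt x r : 0 <= r -> r < enorm x -> 0 <= J x.
Proof.
move=> r0 rx; case: LJ => _ + _; apply; rewrite -enorm_gt0.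
exact: le_lt_trans rx.
Qed.

(** On [D] the weight min(1, |x|^2) is at least c = min(1, eps^2), so that the mass of [D] is at
    most 1/c times the integral that [levy_density] bounds. *)
Lemma levy_restriction (eps : R) (D : set V) : 0 < eps -> measurable D ->
  D `<=` far eps ->
  exists nu : {finite_measure set V -> \bar R}, restriction nu D.
Proof.
move=> e0 mD De; case: (LJ) => mJ J0 iJ.
have JD x : D x -> 0 <= J x by move=> /De; apply: levy_density_gt; exact: ltW.
pose g := J \_ D.
have g0 x : 0 <= g x by rewrite /g patchE; case: ifPn => // /set_mem /JD.
have mg : measurable_fun setT g.
  by apply/(measurable_restrictT _ mD); exact: measurable_funTS.
pose c := Num.min 1 (eps ^+ 2).
have c0 : 0 < c by rewrite lt_min ltr01 exprn_gt0.
have mmin : measurable_fun setT (fun x : V => Num.min 1 (enorm x ^+ 2) * J x).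
  apply: measurable_funM => //.
  apply: (@measurable_minr _ _ _ _ (fun=> 1) (fun x => enorm x ^+ 2)) => //.
  by apply: measurable_funX; exact: measurable_enorm.
have ig : (\int[leb]_x (g x)%:E < +oo)%E.
  apply: (@le_lt_trans _ _ (\int[leb]_x (c^-1 * (Num.min 1 (enorm x ^+ 2) * J x))%:E)%E).
    apply: ge0_le_integral => //.
    - by move=> x _; rewrite lee_fin.
    - exact/measurable_EFinP.
    - by apply/measurable_EFinP; exact: measurable_funM.
    move=> x _; rewrite lee_fin /g patchE; case: ifPn => [/set_mem Dx|_].
      rewrite mulrA ler_peMl ?JD// mulrC ler_pdivlMr// mul1r.
      rewrite le_min !ge_min lexx/=; apply/orP; right.
      by rewrite lerXn2r ?nnegrE ?enorm_ge0 ?ltW//; exact: De.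
    have [->|x0] := eqVneq x 0; first by rewrite enorm0 expr0n/= minElt ltr10 mul0r mulr0.
    rewrite !mulr_ge0 ?invr_ge0 ?(ltW c0) ?J0//.
    by rewrite le_min ler01 sqr_ge0.
  under eq_integral do rewrite EFinM.
  have pos x : (0 <= (Num.min 1 (enorm x ^+ 2) * J x)%:E)%E.
    rewrite lee_fin; have [->|x0] := eqVneq x 0; first by rewrite enorm0 expr0n/= minElt ltr10 mul0r.
    by rewrite mulr_ge0 ?J0// le_min ler01 sqr_ge0.
  rewrite ge0_integralZl//; last 2 first.
  - exact/measurable_EFinP.
  - by rewrite lee_fin invr_ge0 ltW.
  by rewrite lte_mul_pinfty// lee_fin invr_ge0 ltW.
exists (density g0 mg ig) => f mf f0; rewrite integral_density//.
rewrite [RHS]integral_mkcond; apply: eq_integral => x _.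
by rewrite /g !patchE; case: ifP => //; rewrite mule0.
Qed.

Section restriction_facts.
Variables (nu : {finite_measure set V -> \bar R}) (D : set V).
Hypotheses (nuD : restriction nu D) (mD : measurable D).
Hypothesis JD : forall x, D x -> 0 <= J x.

(** The form in which jumps are steered: they are confined to a set [W] of volume [v], on which the
    jump density is at least [c] and the target function at least [a]. *)
Lemma restriction_ge (W : set V) (v a c : R) (h : V -> R) :
  measurable W -> W `<=` D -> leb W = v%:E -> 0 <= a -> 0 <= c ->
  (forall x, W x -> c <= J x) -> bounded_measurable h ->
  (forall x, 0 <= h x) -> (forall x, W x -> a <= h x) ->
  a * c * v <= \int[nu]_x h x.
Proof.
move=> mW WD Wv a0 c0 cJ bh h0 ah; case: (LJ) => mJ _ _.
rewrite -lee_fin /Rintegral fineK; last first.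
  by apply: integrable_fin_num => //; exact: bounded_measurable_integrable.
rewrite nuD; last 2 first.
- by apply/measurable_EFinP; exact: bh.1.
- by move=> x; rewrite lee_fin.
have mhJ : measurable_fun setT (fun x => ((h x)%:E * (J x)%:E)%E).
  by apply: emeasurable_funM; apply/measurable_EFinP => //; exact: bh.1.
apply: (@le_trans _ _ (\int[leb]_(x in W) ((h x)%:E * (J x)%:E))%E); last first.
  apply: ge0_subset_integral => //.
  - exact: measurable_funTS.
  - by move=> x Dx; rewrite -EFinM lee_fin mulr_ge0 ?JD.
rewrite EFinM -Wv -(integral_cst leb mW); apply: ge0_le_integral => //.
- by move=> x _; rewrite lee_fin mulr_ge0.
- exact: measurable_funTS.
- by move=> x Wx; rewrite -EFinM lee_fin ler_pM ?ah ?cJ.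
Qed.

Lemma restriction_mass : (nu setT = \int[leb]_(x in D) (J x)%:E)%E.
Proof.
rewrite -[LHS]mul1e -integral_cst// nuD//.
by under eq_integral do rewrite mul1e.
Qed.

Lemma restriction_cos w :
  ((fine (nu setT) - cos_transform nu w)%:E =
   \int[leb]_(x in D) ((1 - cos (dotp w x)) * J x)%:E)%E.
Proof.
have bc : bounded_measurable (fun x => cos (dotp w x)).
  exact: bounded_measurable_cos_dotp.
have b1 : bounded_measurable (fun _ : V => 1 : R) by exact: bounded_measurable_cst.
have b1c : bounded_measurable (fun x => 1 - cos (dotp w x)).
  case: bc => mc _; split; first exact: measurable_funB.
  exists 2 => x; rewrite ger0_norm ?onemcos_ge0//.
  by have := cos_geN1 (dotp w x); lra.
have -> : fine (nu setT) - cos_transform nu w = \int[nu]_x (1 - cos (dotp w x)).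
  rewrite RintegralB//; do ?exact: bounded_measurable_integrable.
  by rewrite Rintegral_cst// mul1r.
rewrite /Rintegral fineK; last first.
  by apply: integrable_fin_num => //; exact: bounded_measurable_integrable.
rewrite nuD; last 2 first.
- by apply/measurable_EFinP; exact: b1c.1.
- by move=> x; rewrite lee_fin onemcos_ge0.
by under eq_integral do rewrite -EFinM.
Qed.

End restriction_facts.
End levy_restriction.

Section truncation.
Context {R : realType} {d : nat}.
Local Notation V := 'rV[R]_d.
Local Notation leb := (lebesgue_rV d : {sigma_finite_measure set V -> \bar R}).

Lemma cos_synthesisZ (kappa : {finite_measure set V -> \bar R}) (c : R) h y :
  bounded_measurable h ->
  cos_synthesis kappa (fun w => c * h w) y = c * cos_synthesis kappa h y.
Proof.
move=> bh; rewrite /cos_synthesis -RintegralZl//; last first.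
  apply: bounded_measurable_integrable; apply: bounded_measurableM => //.
  exact: bounded_measurable_cos_dotp.
by apply: eq_Rintegral => w _; rewrite mulrA.
Qed.

Variables (J psi : V -> R).
Hypothesis LJ : levy_density J.
Hypothesis psiE : forall w,
  ((psi w)%:E = \int[leb]_x ((1 - cos (dotp w x)) * J x)%:E)%E.

Let JD r x : 0 <= r -> far r x -> 0 <= J x.
Proof. by move=> r0; exact: levy_density_gt. Qed.

Lemma onemcosM_ge0 w x : 0 <= (1 - cos (dotp w x)) * J x.
Proof.
have [->|x0] := eqVneq x 0.
  by rewrite /dotp big1 ?cos0 ?subrr ?mul0r// => i _; rewrite mxE mulr0.
by rewrite mulr_ge0 ?onemcos_ge0//; case: LJ => _ + _; apply.
Qed.

Lemma measurable_onemcosM w : measurable_fun setT (fun x => (1 - cos (dotp w x)) * J x).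
Proof.
case: LJ => mJ _ _; apply: measurable_funM => //; apply: measurable_funB => //.
by have [] := @bounded_measurable_cos_dotp R d _ V (cst w) id (measurable_cst _) (@measurable_id _ _ _).
Qed.

(** The integrand of psi dominates its own truncations. It is integrable because psi(w) is a real
    number, and it vanishes at 0 whatever the value of J there. *)
Lemma cvg_far_integral (rho : R) w : 0 < rho ->
  (\int[leb]_(x in far (rho / n.+1%:R)) ((1 - cos (dotp w x)) * J x)%:E)%E
    @[n --> \oo] --> (psi w)%:E.
Proof.
move=> r0; pose f x := (1 - cos (dotp w x)) * J x.
under eq_fun do rewrite integral_mkcond.
rewrite psiE.
apply: (@dominated_cvg _ _ _ _ _ measurableT _ _ (EFin \o f)) => //.
- move=> n; apply/(measurable_restrictT _ (measurable_far _)).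
  by apply: measurable_funTS; apply/measurable_EFinP; exact: measurable_onemcosM.
- move=> x _; have [->|x0] := eqVneq x 0.
    rewrite (_ : (1 - cos (dotp w 0)) * J 0 = 0); last first.
      by rewrite /dotp big1 ?cos0 ?subrr ?mul0r// => i _; rewrite mxE mulr0.
    apply: cvg_near_cst; near=> n; rewrite patchE; case: ifPn => // /set_mem.
    by rewrite /far/= enorm0 ltNge divr_ge0// ltW.
  apply: cvg_near_cst; near=> n; rewrite patchE mem_set//= /far/=.
  have : n.+1%:R^-1 < enorm x / rho.
    by near: n; apply: near_infty_natSinv_lt (PosNum _); rewrite divr_gt0// enorm_gt0.
  by rewrite ltr_pdivlMr// mulrC.
- apply/integrableP; split; first by apply/measurable_EFinP; exact: measurable_onemcosM.
  under eq_integral do rewrite /= ger0_norm ?onemcosM_ge0//.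
  by rewrite -psiE ltry.
- move=> n x _; rewrite patchE; case: ifP => _.
    by rewrite abse_EFin ger0_norm// onemcosM_ge0.
  by rewrite abse0 lee_fin onemcosM_ge0.
Unshelve. all: by end_near.
Qed.

Lemma truncated_exponent (rho eps : R) (nu1 nu2 : {finite_measure set V -> \bar R}) w :
  0 < eps -> eps <= rho ->
  restriction J nu1 (annulus eps rho) -> restriction J nu2 (far rho) ->
  ((fine (nu1 setT) - cos_transform nu1 w + (fine (nu2 setT) - cos_transform nu2 w))%:E =
  \int[leb]_(x in far eps) ((1 - cos (dotp w x)) * J x)%:E)%E.
Proof.
move=> e0 er r1 r2.
rewrite EFinD (restriction_cos r1).
rewrite (restriction_cos r2) -ge0_integral_setU//.
- congr integral; apply/seteqP; split => x /=; rewrite /annulus /far /=.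
    by case=> [/andP[]//|]; exact: le_lt_trans.
  by move=> ex; have [xr|rx] := leP (enorm x) rho; [left; rewrite ex|right].
- exact: measurable_annulus.
- exact: measurable_far.
- by apply: measurable_funTS; apply/measurable_EFinP; exact: measurable_onemcosM.
- by move=> x _; rewrite lee_fin onemcosM_ge0.
- apply/disj_setPS => x /= [/andP[_ xr]]; rewrite /far/= => rx.
  by move: (lt_le_trans rx xr); rewrite ltxx.
Qed.

Lemma levy_semigroup_two_jumps (kappa : {finite_measure set V -> \bar R})
    (rho t A sigma Lambda m : R) y :
  0 < rho -> 0 <= t -> 0 < A -> 0 <= m -> t * sigma <= A ->
  (\int[leb]_(x in far rho) (J x)%:E <= Lambda%:E)%E ->
  (forall eps, 0 < eps ->
    (\int[leb]_(x in annulus eps rho) (dotp x x * J x)%:E <= sigma%:E)%E) ->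
  (forall z, 0 <= cos_synthesis kappa (fun=> 1) z) ->
  (forall nu2 : {finite_measure set V -> \bar R}, restriction J nu2 (far rho) ->
    forall z, dotp (z - y) (z - y) <= A ->
    m <= cos_synthesis kappa (fun w => cos_transform nu2 w ^+ 2) z) ->
  m * t ^+ 2 / 2 * expR (- (t * Lambda)) * (1 - t * sigma / A) <=
  cos_synthesis kappa (fun w => expR (- (t * psi w))) y.
Proof.
move=> rho0 t0 A0 m0 tA farL annS F0 Fm.
have [nu2 r2] := levy_restriction LJ rho0 (measurable_far rho) (@subset_refl _ _).
pose eps n := rho / n.+1%:R.
have eps0 n : 0 < eps n by rewrite divr_gt0.
have epsr n : eps n <= rho by rewrite ler_pdivrMr// ler_peMr ?ler1n // ltW.
have [nu1 r1] : {nu1 : nat -> {finite_measure set V -> \bar R} &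
    forall n, restriction J (nu1 n) (annulus (eps n) rho)}.
  apply: (@choice _ _ (fun n nu => restriction J (nu : {finite_measure set V -> \bar R}) (annulus (eps n) rho))) => n.
  apply: (levy_restriction LJ (eps0 n) (measurable_annulus _ _)).
  by move=> x /andP[].
pose psi_ n w := fine (nu1 n setT) - cos_transform (nu1 n) w +
  (fine (nu2 setT) - cos_transform nu2 w).
have psi_E n w : ((psi_ n w)%:E =
    \int[leb]_(x in far (eps n)) ((1 - cos (dotp w x)) * J x)%:E)%E.
  exact: truncated_exponent.
have psi_ge0 n w : 0 <= psi_ n w.
  by rewrite -lee_fin psi_E; apply: integral_ge0 => x _; rewrite lee_fin onemcosM_ge0.
have psi_cvg w : psi_ n w @[n --> \oo] --> psi w.
  have := @cvg_far_integral rho w rho0.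
  by under eq_fun do rewrite -psi_E; exact: fine_cvg.
have mpsi_ n : measurable_fun setT (psi_ n).
  apply: measurable_funD; apply: measurable_funB => //;
  exact: (bounded_measurable_cos_transform _).1.
(* The function psi is given by an integral formula only; its measurability is inherited from the
   truncations. *)
have mpsi : measurable_fun setT psi.
  by apply: (measurable_fun_cvg mpsi_) => w _; exact: psi_cvg.
have cv : cos_synthesis kappa (fun w => expR (- (t * psi_ n w))) y @[n --> \oo] -->
    cos_synthesis kappa (fun w => expR (- (t * psi w))) y.
  apply: (@cvg_cos_synthesis _ _ _ _ _ 1).
  - move=> n; apply: measurableT_comp => //; apply: measurableT_comp => //.
    exact: measurable_funM.
  - apply: measurableT_comp => //; apply: measurableT_comp => //.
    exact: measurable_funM.
  - move=> n w; rewrite ger0_norm ?expR_ge0// -[leRHS]expR0 ler_expR.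
    by rewrite oppr_le0 mulr_ge0.
  - move=> w; apply: continuous_cvg; first exact: continuous_expR.
    by apply: cvgN; exact: cvgMl_tmp (psi_cvg w).
apply: (ler_cvg_to (cvg_cst _) cv); near=> n.
have mq : measurable_fun setT (fun x : V => (dotp x x)%:E).
  by apply/measurable_EFinP; exact: measurable_dotp.
have qE : (\int[nu1 n]_x (dotp x x)%:E <= sigma%:E)%E.
  rewrite r1//; last by move=> x; rewrite lee_fin dotp_ge0.
  by under eq_integral do rewrite -EFinM; exact: annS.
have isig : (nu1 n).-integrable setT (EFin \o (fun x : V => dotp x x)).
  apply/integrableP; split => //.
  under eq_integral do rewrite /= ger0_norm ?dotp_ge0//.
  by rewrite (le_lt_trans qE)// ltry.
have sig : \int[nu1 n]_x dotp x x <= sigma.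
  rewrite -lee_fin /Rintegral fineK//.
  exact: integrable_fin_num isig.
have key := @cos_synthesis_two_jumps _ _ kappa (nu1 n) nu2 A sigma m t y A0 m0 t0 isig sig F0 (Fm _ r2).
pose c := expR (- (t * fine (nu1 n setT) + t * fine (nu2 setT))).
have -> : (fun w => expR (- (t * psi_ n w))) = (fun w => c *
    (expR (t * cos_transform nu2 w) * expR (t * cos_transform (nu1 n) w))).
  apply/funext => w; rewrite /c -!expRD; congr expR; rewrite /psi_; ring.
rewrite cos_synthesisZ; last first.
  apply: bounded_measurableM; apply: bounded_measurable_expR;
  apply: bounded_measurableM; do ?exact: bounded_measurable_cst;
  exact: bounded_measurable_cos_transform.
apply: le_trans (ler_wpM2l (expR_ge0 _) key).
set E1 := expR (t * fine (nu1 n setT)).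
(* The mass of nu1 may blow up as eps tends to 0. The factor e^(t |nu1|) produced by keeping all the
   small jumps cancels e^(-t |nu1|), and only e^(-t |nu2|) is left to bound. *)
have cE : expR (- (t * Lambda)) <= c * E1.
  rewrite /c opprD expRD mulrAC -expRD addNr expR0 mul1r ler_expR lerN2 ler_wpM2l//.
  rewrite -lee_fin fineK ?fin_num_measure//.
  by rewrite (restriction_mass r2).
rewrite -/c; have -> : c * (m * t ^+ 2 / 2 * E1 * (1 - t * sigma / A)) =
  m * t ^+ 2 / 2 * (c * E1) * (1 - t * sigma / A) by ring.
rewrite ler_wpM2r//; first by rewrite subr_ge0 ler_pdivrMr// mul1r.
by rewrite ler_wpM2l// divr_ge0// mulr_ge0// sqr_ge0.
Unshelve. all: by end_near.
Qed.

End truncation.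

(** * Steering two jumps into a cube *)

Section two_jumps.
Context {R : realType} {d : nat}.
Local Notation V := 'rV[R]_d.
Local Notation leb := (lebesgue_rV d : {sigma_finite_measure set V -> \bar R}).
Implicit Types x y z w : V.

Lemma enorm_delta (i : 'I_d) : enorm (delta_mx ord0 i : V) = 1.
Proof.
rewrite /enorm /dotp (bigD1 i)//= big1 => [|j ji]; rewrite !mxE ?eqxx ?(negbTE ji) ?andbF ?mul0r//.
by rewrite mulr1 addr0 sqrtr1.
Qed.

(* If z is far from 0, the first jump goes from z towards 0, so that the second
   jump, which covers the rest of the way, is shorter than |y|. *)
Lemma two_jump_path S y z : (0 < d)%N -> 0 < S -> enorm (z - y) <= S ->
  exists w0, forall w, enorm (w - w0) <= S ->
    S < enorm w <= 10 * S /\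
    forall x, enorm (x - (z - w)) <= S ->
      S <= enorm x /\ (enorm x <= enorm y \/ enorm x <= 17 * S).
Proof.
move=> d0 S0 zy.
(* For |z| >= 6S the first jump aims at length 3S towards 0, hence has length in [2S, 4S]. The
   second has length at least 6S - 4S - S = S, and at most |z| - 3S + 2S = |z| - S <= |y|. *)
have [z6|z6] := lerP (6 * S) (enorm z).
  have zp : 0 < enorm z by apply: lt_le_trans z6; rewrite mulr_gt0.
  pose a := 3 * S / enorm z.
  have a0 : 0 <= a by rewrite divr_ge0 ?enorm_ge0// mulr_ge0// ltW.
  have az : a * enorm z = 3 * S by rewrite /a divfK// gt_eqF.
  have a1 : a <= 1 by rewrite ler_pdivrMr// mul1r; lra.
  exists (a *: z) => w ww0.
  have nw0 : enorm (a *: z) = 3 * S by rewrite enormZ ger0_norm.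
  have h1 := enorm_le_add w (a *: z).
  have h2 := enorm_le_add (a *: z) w.
  rewrite (enormB (a *: z)) in h2.
  split; first by apply/andP; split; lra.
  move=> x xv.
  have nzw0 : enorm (z - a *: z) = enorm z - 3 * S.
    rewrite -{1}[z]scale1r -scalerBl enormZ ger0_norm ?subr_ge0// mulrBl mul1r.
    by rewrite az.
  have h3 : enorm (z - w) <= enorm (z - a *: z) + enorm (a *: z - w).
    by rewrite -[z - w](subrKA (a *: z)) enormD.
  rewrite (enormB (a *: z)) in h3.
  have h4 := enorm_le_add z w.
  have h5 := enorm_le_add x (z - w).
  have h6 := enorm_le_add (z - w) x.
  rewrite (enormB (z - w)) in h6.
  have h7 := enorm_le_add z y.
  by split; [lra|left; lra].
(* For |z| < 6S the first jump aims at length 9S in an arbitrary direction and has length in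
   [8S, 10S]. The second one then has length between 8S - 6S - S = S and 6S + 10S + S = 17S. *)
pose e := delta_mx ord0 (Ordinal d0) : V.
exists ((9 * S) *: e) => w ww0.
have nw0 : enorm ((9 * S) *: e) = 9 * S.
  by rewrite enormZ enorm_delta mulr1 ger0_norm// mulr_ge0// ltW.
have h1 := enorm_le_add w ((9 * S) *: e).
have h2 := enorm_le_add ((9 * S) *: e) w.
rewrite (enormB ((9 * S) *: e)) in h2.
split; first by apply/andP; split; lra.
move=> x xv.
have h3 := enormD z (- w).
rewrite enormN in h3.
have h4 := enorm_le_add w z.
rewrite (enormB w) in h4.
have h5 := enorm_le_add x (z - w).
have h6 := enorm_le_add (z - w) x.
rewrite (enormB (z - w)) in h6.
by split; [lra|right; lra].
Qed.

Variables (J : V -> R) (kappa nu : {finite_measure set V -> \bar R}).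
Variables (rho S delta b1 b2 : R) (y : V).
Hypotheses (LJ : levy_density J) (d0 : (0 < d)%N).
Hypotheses (rho0 : 0 < rho) (rhoS : rho < S) (delta0 : 0 < delta)
  (deltaS : d%:R * delta <= S) (b10 : 0 <= b1) (b20 : 0 <= b2).
Hypothesis kappaE : forall y,
  \prod_(i < d) tent (y ord0 i / delta) = cos_synthesis kappa (fun=> 1) y.
Hypothesis nuE : restriction J nu (far rho).
Hypothesis J1 : forall x, S <= enorm x -> enorm x <= 10 * S -> b1 <= J x.
Hypothesis J2 : forall x, S <= enorm x -> enorm x <= enorm y \/ enorm x <= 17 * S ->
  b2 <= J x.

Let JD x : far rho x -> 0 <= J x.
Proof. by apply: levy_density_gt => //; exact: ltW. Qed.

Let F0 z : 0 <= cos_synthesis kappa (fun=> 1) z.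
Proof. by rewrite -kappaE; apply: prodr_ge0 => i _; exact: tent_ge0. Qed.

Let S0 : 0 < S := lt_trans rho0 rhoS.

Let bone : bounded_measurable (fun _ : V => 1 : R).
Proof. exact: bounded_measurable_cst. Qed.

Let F1 z : 0 <= cos_synthesis kappa (cos_transform nu) z.
Proof.
have := @cos_synthesisM_ge0 _ _ kappa nu _ bone F0 z.
by under [X in cos_synthesis _ X]eq_fun do rewrite mul1r.
Qed.

(** The jump lands in the cube of half-side delta/2 and volume delta^d, on which each tent is at
    least 1/2. The other factor 1/2 comes from the symmetrization, of which one direction is
    kept. *)
Lemma one_jump_minorant v :
  (forall x, enorm (x - v) <= S -> b2 <= J x /\ S <= enorm x) ->
  (2^-1 * 2^-1 ^+ d) * b2 * delta ^+ d <= cos_synthesis kappa (cos_transform nu) v.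
Proof.
move=> hv.
have -> : cos_synthesis kappa (cos_transform nu) v =
    cos_synthesis kappa (fun w => 1 * cos_transform nu w) v.
  by under [X in _ = cos_synthesis _ X _]eq_fun do rewrite mul1r.
rewrite cos_synthesisM//.
have cubeS x : cube v (delta / 2) x -> enorm (x - v) <= S.
  move=> /cube_enorm /le_trans; apply; apply: le_trans deltaS.
  by rewrite ler_wpM2l// ler_pdivrMr// ler_peMr ?ler1n ?ltW.
apply: (restriction_ge LJ nuE (measurable_far _) JD (@measurable_cube _ _ v (delta / 2))) => //.
- by move=> x /cubeS /hv[_]; exact: lt_le_trans.
- by rewrite lebesgue_cube ?divr_ge0 ?ltW// mulrC divfK.
- by move=> x /cubeS /hv[].
- exact: bounded_measurable_cos_synthesis_shift.
- by move=> x; rewrite mulr_ge0// addr_ge0.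
move=> x xQ; rewrite ler_wpM2l//; apply: ler_wpDl => //.
rewrite -kappaE -[d in _ ^+ d]card_ord -prodr_const.
apply: ler_prod => i _; rewrite invr_ge0 ler0n/=; apply: tent_in.
rewrite normrM normfV (gtr0_norm delta0) ler_pdivrMr// mulrC !mxE distrC.
exact: xQ.
Qed.

(** The first jump is taken in a cube of half-side S/d, which lies in the ball of radius S about the
    point w0 of [two_jump_path]; from z - w, [one_jump_minorant] applies uniformly. *)
Lemma two_jumps_minorant z : dotp (z - y) (z - y) <= S ^+ 2 ->
  (2^-1 * ((2^-1 * 2^-1 ^+ d) * b2 * delta ^+ d)) * b1 * (2 * (S / d%:R)) ^+ d <=
  cos_synthesis kappa (fun w => cos_transform nu w ^+ 2) z.
Proof.
rewrite -sqr_enorm ler_pXn2r ?nnegrE ?enorm_ge0 ?(ltW S0)// => zy.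
have [w0 hw0] := two_jump_path d0 S0 zy.
under [X in cos_synthesis _ X]eq_fun do rewrite expr2.
have bc := bounded_measurable_cos_transform nu.
rewrite cos_synthesisM//.
have dR : 0 < d%:R :> R by rewrite ltr0n.
have cubeS x : cube w0 (S / d%:R) x -> enorm (x - w0) <= S.
  by move=> /cube_enorm; rewrite mulrC divfK// gt_eqF.
have a0 : 0 <= 2^-1 * 2^-1 ^+ d * b2 * delta ^+ d.
  by rewrite !mulr_ge0// exprn_ge0// ltW.
apply: (restriction_ge LJ nuE (measurable_far _) JD (@measurable_cube _ _ w0 (S / d%:R))) => //.
- by move=> w /cubeS /hw0[/andP[+ _] _]; exact: lt_trans.
- by rewrite lebesgue_cube// divr_ge0 ?ltW.
- by rewrite mulr_ge0.
- by move=> w /cubeS /hw0[/andP[Sw wS] _]; apply: J1 => //; exact: ltW.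
- exact: bounded_measurable_cos_synthesis_shift.
- by move=> w; rewrite mulr_ge0// addr_ge0.
move=> w /cubeS /hw0[_ hx]; rewrite ler_wpM2l//; apply: ler_wpDl => //.
by apply: one_jump_minorant => x /hx[Sx xy]; split => //; exact: J2.
Qed.

End two_jumps.

(** * Second moment and tail of a Levy measure from its exponent *)

Section sinc.
Context {R : realType}.
Local Notation leb := (@lebesgue_measure R).

(** A lower bound of 1 - sin(a)/a for a >= 1, that is, of the mean of 1 - cos(s a) over s in
    [0, 1]. *)
Definition sinc_gap : R := 1 - cos 2^-1.

Lemma sinc_gap_gt0 : 0 < sinc_gap.
Proof.
apply: lt_le_trans (@onemcos_ge R 2^-1 _).
  by rewrite mulr_gt0 ?exprn_gt0// divr_gt0// exprn_gt0// cos1_gt0.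
by rewrite ger0_norm// invf_le1// ler1n.
Qed.

(** For a < 2, sin a = 2 cos(a/2) sin(a/2) with sin(a/2) <= a/2 and cos(a/2) <= cos(1/2); for a >=
    2, sin a <= 1 <= a cos(1/2) because cos(1/2) >= 1/2. *)
Lemma sin_le_sinc (a : R) : 1 <= a -> sin a <= (1 - sinc_gap) * a.
Proof.
move=> a1; rewrite /sinc_gap subKr.
have pi2 := pi_ge2 R.
have c2 : 2^-1 <= cos 2^-1 :> R.
  have := @onemcos_le R 2^-1; rewrite expr2; lra.
have [a2|a2] := lerP 2 a.
  apply: (@le_trans _ _ 1); first exact: sin_le1.
  apply: (@le_trans _ _ (2^-1 * 2)); first by rewrite mulVf.
  by rewrite ler_pM.
have -> : sin a = 2 * (cos (a / 2) * sin (a / 2)).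
  by rewrite mulr_natl -sin_mulr2n -[(a / 2) *+ 2]mulr_natr divfK.
have [|c /andP[c0 ca] ->] := @sin_MVT R (a / 2); first by rewrite divr_ge0//; lra.
have cc : cos c <= 1 by exact: cos_le1.
have I1 : a / 2 \in `[0, (pi : R)] by rewrite in_itv/=; apply/andP; split; lra.
have I2 : 2^-1 \in `[0, (pi : R)] by rewrite in_itv/=; apply/andP; split; lra.
have ac : cos (a / 2) <= cos 2^-1.
  by rewrite leNgt ltr_cos// -leNgt; lra.
have a2pi : 0 <= cos (a / 2).
  apply: (@le_trans _ _ (cos 1)); first exact/ltW/cos1_gt0.
  have I3 : 1 \in `[0, (pi : R)] by rewrite in_itv/=; apply/andP; split; lra.
  by rewrite leNgt ltr_cos// -leNgt; lra.
have -> : 2 * (cos (a / 2) * (cos c * (a / 2))) = cos (a / 2) * cos c * a by field.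
rewrite ler_wpM2r//; first lra.
apply: (@le_trans _ _ (cos (a / 2) * 1)); first by rewrite ler_wpM2l.
by rewrite mulr1.
Qed.

Let integral_onemcos_ge1 (c : R) : 1 <= c ->
  (sinc_gap%:E <= \int[leb]_(s in `[0%R, 1%R]) (1 - cos (s * c))%:E)%E.
Proof.
move=> c1; have c0 : 0 < c by lra.
pose F (s : R) : R := s - c^-1 * sin (s * c).
have dF (s : R) : is_derive s 1 F (1 - cos (s * c)).
  have d1 : is_derive s 1 (fun s : R => s * c) c.
    by apply: is_derive_eq; rewrite scaler0 add0r /GRing.scale/= mulr1.
  have d2 : is_derive s 1 (fun s : R => sin (s * c)) (c * cos (s * c)).
    have := @is_derive1_comp _ sin (fun s : R => s * c) s _ _ (is_derive_sin (s * c)) d1.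
    by rewrite /GRing.scale /= mulrC.
  by apply: is_derive_eq; rewrite /GRing.scale/= mulKf// gt_eqF.
have cF (s : R) : {for s, continuous F}.
  apply/differentiable_continuous/derivable1_diffP.
  exact: (@ex_derive _ _ _ _ _ _ _ (dF s)).
rewrite (@continuous_FTC2 _ _ F)//.
- rewrite -EFinB lee_fin /F !mul1r mul0r sin0 mulr0 subr0.
  have := sin_le_sinc c1; rewrite -ler_pdivrMr//; rewrite /sinc_gap; lra.
- apply: continuous_subspaceT => s; rewrite /continuous_at.
  apply: cvgB; first exact: cvg_cst.
  have cm : {for s, continuous (fun s : R => s * c)} by exact: mulrr_continuous.
  exact: (continuous_comp cm (@continuous_cos R (s * c))).
- split.
  + by move=> s _; exact: (@ex_derive _ _ _ _ _ _ _ (dF s)).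
  + by apply: cvg_at_right_filter; exact: cF.
  + by apply: cvg_at_left_filter; exact: cF.
- by move=> s _; rewrite derive1E derive_val.
Qed.

Lemma integral_onemcos (a : R) : 1 <= `|a| ->
  (sinc_gap%:E <= \int[leb]_(s in `[0%R, 1%R]) (1 - cos (s * a))%:E)%E.
Proof.
move=> a1; have aE s : cos (s * a) = cos (s * `|a|).
  by rewrite -[LHS]cos_norm -[RHS]cos_norm !normrM normr_id.
by under eq_integral do rewrite aE; exact: integral_onemcos_ge1.
Qed.

End sinc.

Section levy_moments.
Context {R : realType} {d : nat}.
Local Notation V := 'rV[R]_d.
Local Notation leb := (lebesgue_rV d : {sigma_finite_measure set V -> \bar R}).

Variables (J psi : V -> R) (rho M : R).
Hypothesis LJ : levy_density J.
Hypothesis psiE : forall w,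
  ((psi w)%:E = \int[leb]_x ((1 - cos (dotp w x)) * J x)%:E)%E.
Hypotheses (d0 : (0 < d)%N) (rho0 : 0 < rho) (M0 : 0 <= M).
Hypothesis psiM : forall (i : 'I_d) (a : R), 0 <= a -> a <= d%:R / rho ->
  psi (a *: delta_mx ord0 i) <= M.

Lemma dotp_delta (a : R) (i : 'I_d) (x : V) : dotp (a *: delta_mx ord0 i) x = a * x ord0 i.
Proof.
rewrite dotpZl /dotp (bigD1 i)//= big1 => [|j ji]; rewrite !mxE ?eqxx ?(negbTE ji) ?andbF ?mul0r//.
by rewrite mul1r addr0.
Qed.

Let psi_dE (a : R) (i : 'I_d) : ((psi (a *: delta_mx ord0 i))%:E =
  \int[leb]_x ((1 - cos (a * x ord0 i)) * J x)%:E)%E.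
Proof. by rewrite psiE; under eq_integral do rewrite dotp_delta. Qed.

Let cosJ_ge0 (a : R) (i : 'I_d) (x : V) : 0 <= (1 - cos (a * x ord0 i)) * J x.
Proof. by rewrite -dotp_delta onemcosM_ge0. Qed.

Let mcosJ (a : R) (i : 'I_d) : measurable_fun setT (fun x : V => (1 - cos (a * x ord0 i)) * J x).
Proof.
by under eq_fun do rewrite -dotp_delta; exact: measurable_onemcosM.
Qed.

Let dR : 0 < d%:R :> R. Proof. by rewrite ltr0n. Qed.

(** Test the exponent at the frequencies e_i / rho. For |x| <= rho the phase x_i / rho is at most 1
    in absolute value, where 1 - cos is comparable to the square; summing over i recovers |x|^2. The
    bound is uniform in [eps]. *)
Lemma levy_second_moment eps : 0 < eps ->
  (\int[leb]_(x in annulus eps rho) (dotp x x * J x)%:E <=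
   (rho ^+ 2 * (d%:R * M) / (cos 1 ^+ 2 / 2))%:E)%E.
Proof.
move=> e0; set c := cos 1 ^+ 2 / 2.
have c0 : 0 < c by rewrite divr_gt0// exprn_gt0// cos1_gt0.
have mJ : measurable_fun setT J by case: LJ.
have mS : measurable_fun setT (fun x : V => (\sum_(i < d) ((1 - cos (rho^-1 * x ord0 i)) * J x)%:E)%E).
  by apply: emeasurable_sum => i; apply/measurable_EFinP; exact: mcosJ.
have S0 (x : V) : (0 <= \sum_(i < d) ((1 - cos (rho^-1 * x ord0 i)) * J x)%:E)%E.
  by apply: sume_ge0 => i _; rewrite lee_fin cosJ_ge0.
have K0 : 0 <= rho ^+ 2 / c by rewrite divr_ge0 ?sqr_ge0 ?ltW.
apply: (@le_trans _ _ (\int[leb]_x ((rho ^+ 2 / c)%:E *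
    \sum_(i < d) ((1 - cos (rho^-1 * x ord0 i)) * J x)%:E))%E).
  apply: (@le_trans _ _ (\int[leb]_(x in annulus eps rho) ((rho ^+ 2 / c)%:E *
    \sum_(i < d) ((1 - cos (rho^-1 * x ord0 i)) * J x)%:E))%E); last first.
    apply: ge0_subset_integral => //.
    - exact: measurable_annulus.
    - by apply: emeasurable_funM => //.
    - by move=> x _; rewrite mule_ge0.
  apply: ge0_le_integral => //.
  - exact: measurable_annulus.
  - move=> x /= /andP[ex _]; rewrite lee_fin mulr_ge0 ?dotp_ge0//.
    by apply: (levy_density_gt LJ _ ex); exact: ltW.
  - apply/measurable_EFinP; apply: measurable_funTS; apply: measurable_funM => //.
    exact: measurable_dotp.
  - by apply: measurable_funTS; exact: emeasurable_funM.
  move=> x /= /andP[ex xr].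
  have Jx : 0 <= J x by apply: (levy_density_gt LJ _ ex); exact: ltW.
  rewrite sumEFin -EFinM lee_fin -mulr_suml mulrA ler_wpM2r//.
  rewrite /dotp mulr_sumr; apply: ler_sum => i _.
  rewrite mulrAC ler_pdivlMr// -ler_pdivrMl ?exprn_gt0//.
  have /onemcos_ge : `|rho^-1 * x ord0 i| <= 1.
    rewrite normrM gtr0_norm ?invr_gt0// ler_pdivrMl// mulr1.
    exact: le_trans (coord_le_enorm x i) xr.
  apply: le_trans; rewrite -/c exprMn exprVn expr2 le_eqVlt; apply/orP; left; apply/eqP; ring.
rewrite ge0_integralZl//.
rewrite ge0_integral_sum//; last 2 first.
- by move=> i; apply/measurable_EFinP; exact: mcosJ.
- by move=> i x _; rewrite lee_fin cosJ_ge0.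
under eq_bigr do rewrite -psi_dE.
rewrite sumEFin -EFinM lee_fin mulrAC ler_wpM2r ?invr_ge0 ?(ltW c0)//.
rewrite ler_wpM2l ?sqr_ge0// mulr_natl -[X in _ *+ X]card_ord -sumr_const.
apply: ler_sum => i _; apply: psiM; first by rewrite invr_ge0 ltW.
by rewrite ler_peMl ?invr_ge0 ?(ltW rho0)// ler1n.
Qed.

(** A single frequency does not detect large jumps, since 1 - cos has zeros. The exponent is
    averaged over s (d / rho) e_i with s uniform in [0, 1]: if |x| > rho, some coordinate has (d /
    rho) |x_i| >= 1, and the average of 1 - cos is then at least [sinc_gap]. Tonelli exchanges the
    average with the integral against J. *)
Lemma levy_tail :
  (\int[leb]_(x in far rho) (J x)%:E <= (d%:R * M / sinc_gap)%:E)%E.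
Proof.
have g0 := @sinc_gap_gt0 R.
have mJ : measurable_fun setT J by case: LJ.
pose U : probability (measurableTypeR R) R := uniform_prob (@ltr01 R).
pose f (i : 'I_d) (p : V * measurableTypeR R) : \bar R :=
  ((1 - cos (p.2 * (d%:R / rho) * p.1 ord0 i)) * J p.1)%:E.
have f0 i p : (0 <= f i p)%E by rewrite lee_fin cosJ_ge0.
have mf i : measurable_fun setT (f i).
  apply/measurable_EFinP; apply: measurable_funM; last exact: measurableT_comp.
  apply: measurable_funB => //; apply: (bounded_measurable_cos _).1.
  apply: measurable_funM; first exact: measurable_funM.
  by apply: (measurableT_comp (measurable_coord i)).
pose H i x := (\int[U]_s f i (x, s))%E.
have H0 i x : (0 <= H i x)%E by apply: integral_ge0 => s _.
have mH i : measurable_fun setT (H i).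
  exact: (@measurable_fun_fubini_tonelli_F _ _ _ _ R U (f i) (mf i) (f0 i)).
have HJ x : far rho x -> (sinc_gap%:E * (J x)%:E <= \sum_(i < d) H i x)%E.
  move=> rx; have Jx : 0 <= J x by apply: (levy_density_gt LJ _ rx); exact: ltW.
  have [i xi] := enorm_coord rho0 d0 (ltW rx).
  rewrite (bigD1 i)//= -[leLHS]adde0 leeD ?sume_ge0//.
  have mc (a : R) : measurable_fun setT (fun s : measurableTypeR R => (1 - cos (s * a))%:E).
    apply/measurable_EFinP; apply: measurable_funB => //.
    by apply: (bounded_measurable_cos _).1; exact: measurable_funM.
  rewrite /H /f /=.
  under eq_integral do rewrite EFinM -mulrA.
  rewrite ge0_integralZr//.
  rewrite lee_wpmul2r ?lee_fin//.
  rewrite integral_uniform//.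
  rewrite subr0 invr1 mul1e; apply: integral_onemcos.
  by rewrite normrM gtr0_norm ?divr_gt0// -ler_pdivrMl ?divr_gt0// mulr1 invf_div.
rewrite EFinM lee_pdivlMr//.
rewrite muleC -ge0_integralZl//; last 4 first.
- exact: measurable_far.
- by apply/measurable_EFinP; exact: measurable_funTS.
- by move=> x rx; rewrite lee_fin; apply: (levy_density_gt LJ _ rx); exact: ltW.
- by rewrite lee_fin ltW.
apply: (@le_trans _ _ (\int[leb]_x \sum_(i < d) H i x)%E).
  apply: (@le_trans _ _ (\int[leb]_(x in far rho) \sum_(i < d) H i x)%E).
    apply: ge0_le_integral => //.
    - exact: measurable_far.
    - move=> x rx; rewrite mule_ge0 ?lee_fin ?(ltW g0)//.
      by apply: (levy_density_gt LJ _ rx); exact: ltW.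
    - by apply: measurable_funTS; apply: emeasurable_funM => //; exact/measurable_EFinP.
    - by apply: measurable_funTS; exact: emeasurable_sum.
  apply: ge0_subset_integral => //.
  - exact: measurable_far.
  - exact: emeasurable_sum.
  - by move=> x _; exact: sume_ge0.
rewrite ge0_integral_sum// EFinM.
have -> : (d%:R%:E * M%:E = \sum_(i < d) M%:E :> \bar R)%E.
  by rewrite sumEFin -EFinM sumr_const card_ord mulr_natl.
apply: lee_sum => i _; rewrite /H fubini_tonelli//.
apply: (@le_trans _ _ (\int[U]_s (cst M%:E) s)%E); last first.
  have U1 : U setT = 1%E by exact: probability_setT.
  by rewrite integral_cst// [X in (_ * X)%E]U1 mule1.
rewrite integral_uniform//; last 2 first.
- exact: (@measurable_fun_fubini_tonelli_G _ _ _ _ R leb (f i) (mf i) (f0 i)).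
- by move=> s; apply: integral_ge0.
rewrite integral_uniform//.
rewrite subr0 invr1 !mul1e; apply: ge0_le_integral => //.
- by move=> s _; apply: integral_ge0.
- by apply: measurable_funTS; exact: (@measurable_fun_fubini_tonelli_G _ _ _ _ R leb (f i) (mf i) (f0 i)).
move=> s /=; rewrite in_itv/= => /andP[s0 s1].
rewrite /f /= -psi_dE lee_fin; apply: psiM.
  by rewrite mulr_ge0// divr_ge0// ltW.
by rewrite ler_piMl// divr_ge0// ltW.
Qed.

End levy_moments.

(** * Bernstein functions *)

Section onemexp.
Context {R : realType}.
Implicit Types x l : R.

Lemma onemexp_ge0 x : 0 <= x -> 0 <= 1 - expR (- x).
Proof. by move=> x0; rewrite subr_ge0 -[leRHS]expR0 ler_expR oppr_le0. Qed.

Lemma onemexp_le1 x : 1 - expR (- x) <= 1.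
Proof. by rewrite lerBlDr lerDl expR_ge0. Qed.

Lemma onemexp_le x : 1 - expR (- x) <= x.
Proof. by have := expR_ge1Dx (- x); lra. Qed.

Lemma onemexp_mono x y : x <= y -> 1 - expR (- x) <= 1 - expR (- y).
Proof. by move=> xy; rewrite lerB// ler_expR lerN2. Qed.

Lemma onemexp_ge x : 0 <= x <= 1 -> x <= 2 * (1 - expR (- x)).
Proof.
move=> /andP[x0 x1].
have ax : expR (- x) * (1 + x) <= 1.
  by rewrite -[leRHS](expR0 R) -(addNr x) expRD ler_wpM2l ?expR_ge0// expR_ge1Dx.
have x10 : 0 < 1 + x by lra.
have xx : x * x <= x by rewrite ler_piMl.
rewrite -(ler_pM2r x10); move: ax; set a := expR _ => ax.
have -> : 2 * (1 - a) * (1 + x) = 2 * (1 + x) - 2 * (a * (1 + x)) by ring.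
rewrite mulrDr mulr1; lra.
Qed.

Lemma onemexp_ge_half x : 1 <= x -> 1 <= 2 * (1 - expR (- x)).
Proof.
move=> x1; have := @onemexp_ge 1; rewrite ler01 lexx => /(_ isT) h.
apply: le_trans h _; rewrite ler_wpM2l//; exact: onemexp_mono.
Qed.

(** Concavity of 1 - e^(-x), which vanishes at 0; obtained here from e^(-x) (1 + x) <= 1 and e^(-y)
    >= 1 - y with y = (l - 1) x. *)
Lemma onemexp_scale l x : 1 <= l -> 0 <= x ->
  1 - expR (- (l * x)) <= l * (1 - expR (- x)).
Proof.
move=> l1 x0.
have -> : - (l * x) = - x + - ((l - 1) * x) by ring.
rewrite expRD; have h := expR_ge1Dx (- ((l - 1) * x)).
have h2 : expR (- x) * (1 + x) <= 1.
  by rewrite -[leRHS](expR0 R) -(addNr x) expRD ler_wpM2l ?expR_ge0// expR_ge1Dx.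
have : expR (- x) * (1 - (l - 1) * x) <= expR (- x) * expR (- ((l - 1) * x)).
  by rewrite ler_wpM2l ?expR_ge0.
have : 0 <= (l - 1) * (1 - expR (- x) * (1 + x)) by rewrite mulr_ge0 ?subr_ge0.
set e := expR (- x); set e2 := expR (- ((l - 1) * x)).
nra.
Qed.

End onemexp.

Section bernstein_facts.
Context {R : realType}.
Local Notation leb := (@lebesgue_measure R).
Local Notation D := (`]0%R, +oo[%classic : set R).
Variables (b : R) (mu phi : R -> R).
Hypothesis Hphi : complete_bernstein b mu phi.

Lemma bernstein_density_ge0 t : 0 < t -> 0 <= mu t.
Proof.
move=> t0; have [_] := bernstein_density_cm Hphi 0 t0.
by rewrite expr0 mul1r.
Qed.

Lemma measurable_bernstein_density : measurable_fun D mu.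
Proof.
apply: open_continuous_measurable_fun; first exact: interval_open.
move=> s; rewrite inE/= in_itv/= andbT => s0.
have [ds _] := bernstein_density_cm Hphi 0 s0.
exact/differentiable_continuous/derivable1_diffP.
Qed.

Definition laplace (l : R) : \bar R :=
  (\int[leb]_(t in `]0%R, +oo[) ((1 - expR (- (l * t))) * mu t)%:E)%E.

Lemma measurable_laplace l : measurable_fun D (fun t => (1 - expR (- (l * t))) * mu t).
Proof.
apply: measurable_funM; last exact: measurable_bernstein_density.
apply: measurable_funTS; apply: measurable_funB => //.
by apply: measurableT_comp => //; apply: measurableT_comp.
Qed.

Lemma laplace_integrand_ge0 l t : 0 <= l -> D t -> (0 <= ((1 - expR (- (l * t))) * mu t)%:E)%E.
Proof.
move=> l0; rewrite /= in_itv/= andbT => t0.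
by rewrite lee_fin mulr_ge0 ?bernstein_density_ge0// onemexp_ge0// mulr_ge0// ltW.
Qed.

Lemma bernsteinE l : 0 <= l -> ((phi l)%:E = (b * l)%:E + laplace l)%E.
Proof. by move=> l0; rewrite (bernstein_exponentE Hphi l0). Qed.

Lemma laplace_ge0 l : 0 <= l -> (0 <= laplace l)%E.
Proof. by move=> l0; apply: integral_ge0 => t; exact: laplace_integrand_ge0. Qed.

(** The formula for phi equates a real number with a real number plus this integral, which is
    nonnegative. *)
Lemma laplace_fin l : 0 <= l -> laplace l \is a fin_num.
Proof.
move=> l0; have := laplace_ge0 l0; have := bernsteinE l0.
by case: (laplace l).
Qed.

Lemma bernstein_ge0 l : 0 <= l -> 0 <= phi l.
Proof.
move=> l0; rewrite -lee_fin bernsteinE// adde_ge0 ?laplace_ge0// lee_fin.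
by rewrite mulr_ge0// (bernstein_drift_ge0 Hphi).
Qed.

Lemma bernstein_mono l l' : 0 <= l -> l <= l' -> phi l <= phi l'.
Proof.
move=> l0 ll'; have l'0 := le_trans l0 ll'.
rewrite -lee_fin !bernsteinE// leeD//.
  by rewrite lee_fin ler_wpM2l// (bernstein_drift_ge0 Hphi).
apply: ge0_le_integral => //.
- by move=> t; exact: laplace_integrand_ge0.
- by apply/measurable_EFinP; exact: measurable_laplace.
- by apply/measurable_EFinP; exact: measurable_laplace.
move=> t /=; rewrite in_itv/= andbT => t0.
rewrite lee_fin ler_wpM2r ?bernstein_density_ge0//.
by apply: onemexp_mono; rewrite ler_wpM2r// ltW.
Qed.

(** This is [onemexp_scale] integrated against the Levy density. Unlike the growth condition it
    holds at all arguments; it controls the exponent at the frequencies up to d / rho and yields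
    continuity. *)
Lemma bernstein_scale a l : 1 <= a -> 0 <= l -> phi (a * l) <= a * phi l.
Proof.
move=> a1 l0; have a0 : 0 <= a by exact: le_trans a1.
rewrite -lee_fin EFinM !bernsteinE ?mulr_ge0// ge0_muleDr ?laplace_ge0//; last first.
  by rewrite lee_fin mulr_ge0// (bernstein_drift_ge0 Hphi).
apply: leeD; first by rewrite -EFinM lee_fin mulrCA.
rewrite /laplace -ge0_integralZl//; last 2 first.
- by apply/measurable_EFinP; exact: measurable_laplace.
- by move=> t; exact: laplace_integrand_ge0.
apply: ge0_le_integral => //.
- by move=> t; apply: laplace_integrand_ge0; exact: mulr_ge0.
- by apply/measurable_EFinP; exact: measurable_laplace.
- by apply: measurable_funeM; apply/measurable_EFinP; exact: measurable_laplace.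
move=> t /=; rewrite in_itv/= andbT => t0.
rewrite -EFinM lee_fin mulrA ler_wpM2r ?bernstein_density_ge0// -mulrA.
by apply: onemexp_scale => //; rewrite mulr_ge0// ltW.
Qed.

(** Dominated convergence, the dominating function being the integrand of phi at 1. *)
Lemma bernstein_cvg0 : phi n.+1%:R^-1 @[n --> \oo] --> (0 : R).
Proof.
have lap : laplace n.+1%:R^-1 @[n --> \oo] --> 0%E.
  rewrite (_ : 0%E = \int[leb]_(t in `]0%R, +oo[) (cst 0%E t))%E; last by rewrite integral0.
  apply: (@dominated_cvg _ _ _ leb _ _ _ _ (fun t => ((1 - expR (- (1 * t))) * mu t)%:E)) => //.
  - by move=> n; apply/measurable_EFinP; exact: measurable_laplace.
  - move=> t Dt; apply: cvg_EFin; first by near=> n.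
    rewrite (_ : 0 = (1 - expR (- (0 * t))) * mu t); last first.
      by rewrite mul0r oppr0 expR0 subrr mul0r.
    apply: cvgMr_tmp; apply: cvgB; first exact: cvg_cst.
    apply: continuous_cvg; first exact: continuous_expR.
    by apply: cvgN; apply: cvgMr_tmp; exact: cvg_harmonic.
  - apply/integrableP; split; first by apply/measurable_EFinP; exact: measurable_laplace.
    under eq_integral => t tD.
      rewrite gee0_abs; last by apply: laplace_integrand_ge0 => //; exact: set_mem.
      over.
    by have := laplace_fin (@ler01 R); rewrite ge0_fin_numE ?laplace_ge0.
  - move=> n t Dt; rewrite gee0_abs; last by apply: laplace_integrand_ge0; rewrite ?invr_ge0.
    move: Dt; rewrite /= in_itv/= andbT => t0.
    rewrite lee_fin ler_wpM2r ?bernstein_density_ge0//.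
    by apply: onemexp_mono; rewrite ler_wpM2r ?(ltW t0)// invf_le1// ler1n.
have bl : (b * n.+1%:R^-1)%:E @[n --> \oo] --> 0%E.
  apply: cvg_EFin; first by near=> n.
  by rewrite -(mulr0 b); apply: cvgMl_tmp; exact: cvg_harmonic.
have : (phi n.+1%:R^-1)%:E @[n --> \oo] --> 0%E.
  under eq_fun do rewrite bernsteinE ?invr_ge0//.
  by rewrite -[0%E]adde0; apply: cvgeD.
exact: fine_cvg.
Unshelve. all: by end_near.
Qed.

End bernstein_facts.

(** * The growth condition and the inverse of Phi *)

Section growth.
Context {R : realType}.
Local Notation leb := (@lebesgue_measure R).
Local Notation D := (`]0%R, +oo[%classic : set R).
Variables (b : R) (mu phi : R -> R).
Hypotheses (Hphi : complete_bernstein b mu phi) (Hgrow : growth_condition phi).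

(** The zero function is a complete Bernstein function that satisfies the growth condition, so that
    it has to be set apart. *)
Lemma growth_degenerate : (exists2 l, 0 <= l & 0 < phi l) \/
  (forall l, 0 <= l -> phi l = 0).
Proof.
have [h|h] := pselect (exists2 l, 0 <= l & 0 < phi l); [by left|right => l l0].
apply/eqP; rewrite eq_le (bernstein_ge0 Hphi l0) andbT leNgt.
by apply/negP => pl; apply: h; exists l.
Qed.

Hypothesis phi_pos : exists2 l, 0 <= l & 0 < phi l.

(** A zero at r >= R0 would spread to all larger arguments by the upper growth bound and to all
    smaller ones by monotonicity. *)
Lemma growth_base_gt0 (d2 a2 R0 : R) : 0 < R0 ->
  (forall l r, 1 <= l -> R0 <= r -> phi (l * r) <= a2 * l `^ d2 * phi r) ->
  forall r, R0 <= r -> 0 < phi r.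
Proof.
move=> R00 up r rR0; have r0 : 0 < r by exact: lt_le_trans rR0.
rewrite lt_neqAle (bernstein_ge0 Hphi (ltW r0)) andbT; apply/negP => /eqP pr.
case: phi_pos => l l0; rewrite ltNge => /negP; apply.
have [lr|rl] := lerP l r; first by rewrite pr (bernstein_mono Hphi).
have := up (l / r) r; rewrite divfK ?gt_eqF// -pr mulr0; apply => //.
by rewrite ler_pdivlMr// mul1r ltW.
Qed.

(** The lower growth bound from R0, at the ratio l with l^delta1 = 1 + |C / (a1 phi(R0))|. *)
Lemma bernstein_unbounded C : exists2 l, 0 < l & C <= phi l.
Proof.
case: Hgrow => d1 [d2 [a1 [a2 [R0 [[/andP[d10 _] _ /andP[a10 _] _ R00] gr]]]]].
have pR : 0 < phi R0.
  by apply: (@growth_base_gt0 d2 a2 R0 R00 _ R0 (lexx R0)) => l r l1 rR; have /andP[] := gr l r l1 rR.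
pose X := 1 + `|C / (a1 * phi R0)|.
have X1 : 1 <= X by rewrite lerDl.
pose l := X `^ d1^-1.
have l1 : 1 <= l.
  by have := @ler_powR _ X X1 0 d1^-1; rewrite powRr0; apply; rewrite invr_ge0 ltW.
exists (l * R0); first by rewrite mulr_gt0// (lt_le_trans _ l1).
have /andP[+ _] := gr l R0 l1 (lexx _); apply: le_trans.
rewrite /l -powRrM mulVf ?gt_eqF// powRr1 ?(le_trans ler01)//.
rewrite mulrAC -ler_pdivrMl ?mulr_gt0// mulrC /X.
by rewrite (le_trans (ler_norm _))// lerDr.
Qed.

(** Monotonicity together with phi(v) <= (v/u) phi(u) for u <= v gives l |phi(l) - phi(l')| <= |l -
    l'| phi(l). *)
Lemma bernstein_continuous : {in D, continuous phi}.
Proof.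
move=> l; rewrite inE/= in_itv/= andbT => l0.
apply/(@cvgrPdist_le R R) => e e0.
have p0 := bernstein_ge0 Hphi (ltW l0).
have de : 0 < l * e / (phi l + 1) by rewrite divr_gt0 ?mulr_gt0// ltr_wpDl.
have nl : x @[x --> l] --> l by exact: cvg_id.
have /(@cvgrPdist_le R R) /(_ _ de) nd := nl.
near=> l'.
have l'0 : 0 < l' by near: l'; exact: lt_nbhsr.
have dl : `|l - l'| * phi l <= l * e.
  have : `|l - l'| <= l * e / (phi l + 1).
    by near: l'.
  rewrite ler_pdivlMr ?ltr_wpDl//; apply: le_trans.
  by rewrite ler_wpM2l// lerDl.
have key u v : 0 < u -> u <= v -> phi v <= v / u * phi u.
  move=> u0 uv; have := @bernstein_scale _ _ _ _ Hphi (v / u) u.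
  by rewrite divfK ?gt_eqF//; apply; rewrite ?(ltW u0)// ler_pdivlMr// mul1r.
rewrite -(ler_pM2l l0); apply: le_trans dl.
have [ll|ll] := lerP l l'.
- have pm : phi l <= phi l' by exact: (bernstein_mono Hphi (ltW l0) ll).
  rewrite (ler0_norm (_ : phi l - phi l' <= 0)) ?subr_le0//.
  have := key l l' l0 ll; rewrite -(ler_pM2l l0) mulrA [l * (_ / _)]mulrC divfK ?gt_eqF//.
  rewrite ?opprB; nra.
- have ll' := ltW ll.
  have pm : phi l' <= phi l by exact: (bernstein_mono Hphi (ltW l'0) ll').
  rewrite (ger0_norm (_ : 0 <= phi l - phi l')) ?subr_ge0//.
  have := key l' l l'0 ll'.
  rewrite -(ler_pM2l l'0) mulrA [l' * (_ / _)]mulrC divfK ?gt_eqF//; nra.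
Unshelve. all: by end_near.
Qed.

Lemma bernstein_small e : 0 < e -> exists2 l, 0 < l & phi l < e.
Proof.
move=> e0.
have := @bernstein_cvg0 _ _ _ _ Hphi => /(@cvgr_lt R _ _ _ _ _) /(_ _ e0) [n _ /(_ n (leqnn _))] /=.
by move=> pn; exists n.+1%:R^-1 => //; rewrite invr_gt0.
Qed.

Lemma bernstein_surj C : 0 < C -> exists2 l, 0 < l & phi l = C.
Proof.
move=> C0; have [l1 l10 p1] := bernstein_small C0.
have [l2 l20 p2] := bernstein_unbounded C.
have l12 : l1 <= l2.
  rewrite leNgt; apply/negP => l21.
  have := bernstein_mono Hphi (ltW l20) (ltW l21); rewrite leNgt.
  by rewrite (lt_le_trans p1 p2).
have cw : {within `[l1, l2], continuous phi}.
  apply: continuous_in_subspaceT => l; rewrite inE/= in_itv/= => /andP[h _].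
  by apply: bernstein_continuous; rewrite inE/= in_itv/= andbT (lt_le_trans l10).
have [|l] := IVT l12 cw (v := C).
  by rewrite ge_min le_max (ltW p1) p2 orbT.
rewrite in_itv/= => /andP[h _] pl; exists l => //; exact: lt_le_trans h.
Qed.

(** Surjectivity of Phi on the positive half-line makes the partial inverse a right inverse with
    positive values. *)
Lemma Phi_invP t : 0 < t -> 0 < Phi_inv phi t /\ phi (Phi_inv phi t ^- 2) = t^-1.
Proof.
move=> t0.
have sj : set_surj (`]0, +oo[ : set R) (`]0, +oo[ : set R) (Phi phi).
  move=> s /=; rewrite in_itv/= andbT => s0.
  have is0 : 0 < s^-1 by rewrite invr_gt0.
  have [l l0 pl] := bernstein_surj is0.
  exists (Num.sqrt l^-1); first by rewrite /= in_itv/= andbT sqrtr_gt0 invr_gt0.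
  by rewrite /Phi sqr_sqrtr ?invr_ge0 ?ltW// invrK pl invrK.
have tD : (`]0, +oo[%classic : set R) t by rewrite /= in_itv/= andbT.
have pK : Phi phi (Phi_inv phi t) = t by apply: (surjpK _ sj); exact: mem_set.
split; last by rewrite -[in RHS]pK /Phi invrK.
have : (`]0, +oo[%classic : set R) (Phi_inv phi t).
  by apply: (surjpinv_image_sub sj); exists t.
by rewrite /= in_itv/= andbT.
Qed.

(** The only place where the horizon enters: phi tends to 0 at 0, so that phi(r^-2) >= 1/T keeps
    r^-2 away from 0. From r^2 < 1/l it follows that r <= 1 + 1/l. *)
Lemma Phi_inv_bounded T : 0 < T -> exists2 rmax, 0 < rmax &
  forall t r, 0 < t <= T -> 0 < r -> phi (r ^- 2) = t^-1 -> r <= rmax.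
Proof.
move=> T0; have iT0 : 0 < T^-1 by rewrite invr_gt0.
have [l l0 pl] := bernstein_small iT0.
exists (1 + l^-1); first by rewrite ltr_wpDr// invr_ge0 ltW.
move=> t r /andP[t0 tT] r0 pr.
have il0 : 0 < l^-1 by rewrite invr_gt0.
have r2 : r ^+ 2 < l^-1.
  rewrite -[r ^+ 2]invrK ltf_pV2 ?posrE ?invr_gt0 ?exprn_gt0// ltNge.
  apply/negP => rl; have ir0 : 0 <= r ^- 2 by rewrite invr_ge0 exprn_ge0// ltW.
  have := le_lt_trans (bernstein_mono Hphi ir0 rl) pl.
  by rewrite pr ltf_pV2 ?posrE// ltNge tT.
rewrite expr2 in r2; nra.
Qed.

End growth.

(** * The jump kernel *)

Section jump_kernel.
Context {R : realType}.
Local Notation leb := (@lebesgue_measure R).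
Local Notation D := (`]0%R, +oo[%classic : set R).
Variables (b : R) (mu phi : R -> R).
Hypotheses (Hphi : complete_bernstein b mu phi) (Hgrow : growth_condition phi).
Hypothesis phi_pos : exists2 l, 0 <= l & 0 < phi l.

Let mu0 t : 0 < t -> 0 <= mu t. Proof. exact: (bernstein_density_ge0 Hphi). Qed.

Let laplace_fE l : 0 <= l -> laplace mu l = (phi l - b * l)%:E.
Proof.
by move=> l0; rewrite EFinB (bernsteinE Hphi l0) addeAC subee// add0e.
Qed.

(* alpha u and beta u cut the Laplace integral of phi at 1/u into three pieces; the
   two outer ones are bounded by phi(1/(alpha u)) and phi(1/(beta u)), which
   the growth condition makes small with respect to phi(1/u). *)
Lemma levy_mass_middle : exists alpha beta U : R,
  [/\ 0 < alpha, 0 < beta, 0 < U & forall u, 0 < u <= U ->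
  ((phi u^-1 / 2)%:E <=
    \int[leb]_(t in `[(alpha * u)%R, (beta * u)%R]) (mu t)%:E)%E].
Proof.
case: Hgrow => d1 [d2 [a1 [a2 [R0 [[/andP[d10 _] /andP[d20 d21] /andP[a10 a11] a21 R00] gr]]]]].
(* Chosen so that a2 la^delta2 = la / 8, which is possible because delta2 < 1. *)
pose la := (8 * a2) `^ (1 - d2)^-1.
have a20 : 0 < a2 by exact: lt_trans ltr01 a21.
have e0 : 0 < 1 - d2 by rewrite subr_gt0.
have la_e : la `^ (1 - d2) = 8 * a2.
  by rewrite /la -powRrM mulVf ?gt_eqF// powRr1// mulr_ge0// ltW.
have la1 : 1 <= la.
  have := @ler_powR _ (8 * a2) _ 0 (1 - d2)^-1; rewrite powRr0; apply.
    by rewrite -[leLHS]mul1r ler_pM ?ler1n// ltW.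
  by rewrite invr_ge0 ltW.
have la0 : 0 < la by exact: lt_le_trans ltr01 la1.
have la_d2 : la `^ d2 * (8 * a2) = la.
  rewrite -la_e -powRD; last by rewrite (lt0r_neq0 la0) implybT.
  by rewrite addrC subrK powRr1// ltW.
(* Chosen so that a1 be^delta1 = 8. *)
pose be := (8 / a1) `^ d1^-1.
have be_d1 : a1 * be `^ d1 = 8.
  rewrite /be -powRrM mulVf ?gt_eqF// powRr1 ?divr_ge0 ?ltW//.
  by rewrite mulrCA divff ?mulr1// gt_eqF.
have be1 : 1 <= be.
  have := @ler_powR _ (8 / a1) _ 0 d1^-1; rewrite powRr0; apply.
    by rewrite ler_pdivlMr// mul1r (le_trans (ltW a11))// ler1n.
  by rewrite invr_ge0 ltW.
have be0 : 0 < be by exact: lt_le_trans ltr01 be1.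
(* The bound u <= 1 / (be R0) makes the growth condition available at 1 / (be u), hence also at
   1/u. *)
exists la^-1, be, (be * R0)^-1; split; rewrite ?invr_gt0 ?mulr_gt0//.
move=> u /andP[u0 uU].
have iu0 : 0 < u^-1 by rewrite invr_gt0.
have R0u : R0 <= (be * u)^-1.
  have : be * R0 <= u^-1.
    by rewrite -[be * R0]invrK lef_pV2 ?posrE ?invr_gt0 ?mulr_gt0.
  by rewrite invfM -ler_pdivrMl ?invr_gt0// invrK.
have R0u1 : R0 <= u^-1.
  by apply: le_trans R0u _; rewrite lef_pV2 ?posrE ?mulr_gt0// ler_peMl// ltW.
have p0 : 0 <= phi u^-1 by apply: (bernstein_ge0 Hphi); exact: ltW.
have h1 : phi (la * u^-1) <= la / 8 * phi u^-1.
  have /andP[_ /le_trans] := gr la u^-1 la1 R0u1; apply.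
  rewrite ler_wpM2r// -[X in _ <= X / 8]la_d2 le_eqVlt; apply/orP; left; apply/eqP.
  by field.
have h2 : 8 * phi (be * u)^-1 <= phi u^-1.
  have /andP[+ _] := gr be (be * u)^-1 be1 R0u.
  by rewrite be_d1 invfM mulrA divff ?gt_eqF// mul1r.
pose mid := `[la^-1 * u, be * u]%classic : set R.
have mmid : measurable mid by exact: measurable_itv.
have midD : mid `<=` D.
  move=> t; rewrite /mid /= !in_itv/= andbT => /andP[h _].
  by apply: lt_le_trans h; rewrite mulr_gt0// invr_gt0.
have mmu := measurable_bernstein_density Hphi.
have lau : 0 <= la * u^-1 by rewrite mulr_ge0 ?ltW.
have beu : 0 <= (be * u)^-1 by rewrite invr_ge0 mulr_ge0 ?ltW.
(* Pointwise, 1 - e^(-t/u) is at most t/u <= (2 / la) (1 - e^(-la t/u)) for t < u / la, at most 1 on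
   the middle interval, and at most 1 <= 2 (1 - e^(-t/(be u))) beyond it. *)
have key : (laplace mu u^-1 <= (2 / la)%:E * laplace mu (la * u^-1) +
    (\int[leb]_(t in mid) (mu t)%:E + 2%:E * laplace mu (be * u)^-1))%E.
  have ml l : measurable_fun D (fun t => ((1 - expR (- (l * t))) * mu t)%:E).
    by apply/measurable_EFinP; exact: (measurable_laplace Hphi).
  have l0 l t : 0 <= l -> D t -> (0 <= ((1 - expR (- (l * t))) * mu t)%:E)%E.
    exact: (laplace_integrand_ge0 Hphi).
  have m1 : measurable_fun D (fun t => ((2 / la)%:E * ((1 - expR (- (la * u^-1 * t))) * mu t)%:E)%E).
    exact: measurable_funeM.
  have m3 : measurable_fun D (fun t => (2%:E * ((1 - expR (- ((be * u)^-1 * t))) * mu t)%:E)%E).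
    exact: measurable_funeM.
  have m2 : measurable_fun D (fun t => (\1_mid t * mu t)%:E).
    by apply/measurable_EFinP; apply: measurable_funM => //; exact: measurable_funTS.
  have c1 : 0 <= 2 / la by rewrite divr_ge0// ltW.
  have n1 t : D t -> (0 <= (2 / la)%:E * ((1 - expR (- (la * u^-1 * t))) * mu t)%:E)%E.
    by move=> Dt; rewrite mule_ge0 ?l0// lee_fin.
  have n3 t : D t -> (0 <= 2%:E * ((1 - expR (- ((be * u)^-1 * t))) * mu t)%:E)%E.
    by move=> Dt; rewrite mule_ge0 ?l0// lee_fin.
  have n2 t : D t -> (0 <= (\1_mid t * mu t)%:E)%E.
    rewrite /= in_itv/= andbT => t0; rewrite lee_fin mulr_ge0 ?mu0//.
  have midE : (\int[leb]_(t in mid) (mu t)%:E = \int[leb]_(t in `]0%R, +oo[) (\1_mid t * mu t)%:E)%E.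
    rewrite integral_mkcond [RHS]integral_mkcond; apply: eq_integral => t _.
    rewrite !patchE indicE; case: (boolP (t \in mid)) => tm.
      by rewrite mul1r mem_set//; apply: midD; exact: set_mem.
    by rewrite mul0r; case: ifP.
  rewrite midE /laplace -!ge0_integralZl//; do ?[exact: ml | by move=> t; exact: l0 | by rewrite lee_fin].
  rewrite -!ge0_integralD//; last 2 first.
  - by move=> t Dt; rewrite adde_ge0// ?n2// n3.
  - exact: (emeasurable_funD m2 m3).
  apply: ge0_le_integral => //.
  - by move=> t Dt; exact: (l0 u^-1 t (ltW iu0) Dt).
  - exact: ml.
  - exact: (emeasurable_funD m1 (emeasurable_funD m2 m3)).
  move=> t Dt; have t0 : 0 < t by move: Dt; rewrite /= in_itv/= andbT.
  rewrite -!EFinM -!EFinD lee_fin !mulrA -!mulrDl ler_wpM2r ?mu0//.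
  have E1 : 0 <= 1 - expR (- (la / u * t)) by apply: onemexp_ge0; rewrite mulr_ge0 ?divr_ge0 ?ltW.
  have E3 : 0 <= 1 - expR (- ((be * u)^-1 * t)) by apply: onemexp_ge0; rewrite mulr_ge0 ?(ltW t0).
  have I0 : 0 <= \1_mid t :> R by [].
  have E1' : 0 <= 2 / la * (1 - expR (- (la / u * t))) by rewrite mulr_ge0.
  have [t1|t1] := ltP t (la^-1 * u).
    apply: (@le_trans _ _ (2 / la * (1 - expR (- (la / u * t))))); last first.
      by rewrite lerDl addr_ge0// mulr_ge0.
    apply: le_trans (onemexp_le _) _.
    have -> : 2 / la * (1 - expR (- (la / u * t))) =
      la^-1 * (2 * (1 - expR (- (la / u * t)))) by rewrite mulrA (mulrC la^-1).
    have -> : u^-1 * t = la^-1 * (la / u * t) by field; rewrite !gt_eqF.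
    rewrite ler_wpM2l ?invr_ge0 ?(ltW la0)//.
    apply: onemexp_ge; apply/andP; split; first by rewrite mulr_ge0 ?divr_ge0 ?ltW.
    rewrite mulrAC ler_pdivrMr// mul1r -ler_pdivlMl//; exact: ltW.
  have [t2|t2] := leP t (be * u).
    have -> : \1_mid t = 1 :> R.
      by rewrite indicE mem_set// /mid /= in_itv/= t1 t2.
    apply: le_trans (onemexp_le1 _) _.
    by rewrite addrCA lerDl addr_ge0// mulr_ge0.
  apply: le_trans (onemexp_le1 _) _.
  have : 1 <= 2 * (1 - expR (- ((be * u)^-1 * t))).
    apply: onemexp_ge_half; rewrite mulrC ler_pdivlMr ?mulr_gt0// mul1r; exact: ltW.
  by move=> /le_trans; apply; rewrite addrA lerDr addr_ge0.
have b0 := bernstein_drift_ge0 Hphi.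
(* Each outer piece contributes at most phi(1/u) / 4. The drift terms have the favourable sign: the
   first outer piece brings -2b/u against -b/u on the left. *)
move: key; rewrite !laplace_fE ?(ltW iu0)//.
have : (0 <= \int[leb]_(t in mid) (mu t)%:E)%E.
  by apply: integral_ge0 => t /midD; rewrite /= in_itv/= andbT => t0; rewrite lee_fin mu0.
case: (\int[leb]_(t in mid) (mu t)%:E)%E => [r| |]//.
  rewrite !lee_fin => r0.
  have -> : 2 / la * (phi (la / u) - b * (la / u)) = 2 / la * phi (la / u) - 2 * (b * u^-1).
    by field; rewrite !gt_eqF.
  have h3 : 2 / la * phi (la / u) <= phi u^-1 / 4.
    apply: le_trans (ler_wpM2l _ h1) _; first by rewrite divr_ge0// ltW.
    by rewrite le_eqVlt; apply/orP; left; apply/eqP; field; rewrite !gt_eqF.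
  have h4 : 0 <= b * (be * u)^-1 by rewrite mulr_ge0.
  have h5 : 0 <= b * u^-1 by rewrite mulr_ge0 ?(ltW iu0).
  clear - h2 h3 h4 h5; lra.
by move=> _ _; rewrite leey.
Qed.

Section jfun.
Variable d : nat.

Let kernel (r t : R) : R := (4 * pi * t) `^ (- (d%:R / 2)) * expR (- (r ^+ 2 / (4 * t))).

Let kernel_ge0 r t : 0 <= kernel r t.
Proof. by rewrite mulr_ge0 ?powR_ge0 ?expR_ge0. Qed.

Let measurable_kernel r : measurable_fun D (fun t => kernel r t * mu t).
Proof.
apply: measurable_funM; last exact: (measurable_bernstein_density Hphi).
apply: measurable_funM.
  have m4 : measurable_fun setT (fun t : R => 4 * pi * t) by exact: measurable_funM.
  exact: measurable_funTS (measurableT_comp (measurable_powR (- (d%:R / 2))) m4).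
apply: open_continuous_measurable_fun; first exact: interval_open.
move=> t; rewrite inE/= in_itv/= andbT => t0; rewrite /continuous_at.
apply: continuous_cvg; first exact: continuous_expR.
apply: cvgN; apply: cvgMl_tmp; apply: cvgV; first by rewrite mulf_neq0// gt_eqF.
exact: mulrl_continuous.
Qed.

Let kernelmu_ge0 r t : D t -> (0 <= (kernel r t * mu t)%:E)%E.
Proof. by rewrite /= in_itv/= andbT => t0; rewrite lee_fin mulr_ge0// mu0. Qed.

Lemma jfun_ge0 r : (0 <= jfun d mu r)%E.
Proof. by apply: integral_ge0 => t Dt; exact: kernelmu_ge0. Qed.

Lemma jfun_antitone r r' : 0 <= r -> r <= r' -> (jfun d mu r' <= jfun d mu r)%E.
Proof.
move=> r0 rr'; apply: ge0_le_integral => //.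
- by move=> t Dt; exact: kernelmu_ge0.
- by apply/measurable_EFinP; exact: measurable_kernel.
- by apply/measurable_EFinP; exact: measurable_kernel.
move=> t; rewrite /= in_itv/= andbT => t0.
rewrite lee_fin ler_wpM2r ?mu0// ler_wpM2l ?powR_ge0// ler_expR lerN2.
by rewrite ler_wpM2r ?invr_ge0 ?mulr_ge0 ?(ltW t0)// lerXn2r// nnegrE (le_trans r0).
Qed.

(** The integral defining j(K r) is restricted to times t of the order of r^2. There the Gaussian
    kernel is at least a constant times r^-d, and [levy_mass_middle] says that the mass of mu is at
    least phi(u^-1) / 2 >= phi(r^-2) / 2. *)
Lemma jfun_lower K rmax : 0 <= K -> 0 < rmax -> exists2 c, 0 < c &
  forall r, 0 < r <= rmax ->
  ((c * r ^- d * phi (r ^- 2))%:E <= jfun d mu (K * r))%E.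
Proof.
move=> K0 rm0; have [al [be [U [al0 be0 U0 Hmid]]]] := levy_mass_middle.
(* The second entry makes u = ka r^2 at most U for all r <= rmax; the first makes u at most r^2,
   hence phi(u^-1) >= phi(r^-2). *)
pose ka := Num.min 1 (U / rmax ^+ 2).
have ka0 : 0 < ka by rewrite lt_min ltr01 divr_gt0// exprn_gt0.
have ka1 : ka <= 1 by rewrite ge_min lexx.
pose c := (4 * pi * be * ka) `^ (- (d%:R / 2)) * expR (- (K ^+ 2 / (4 * al * ka))) / 2.
have pi0 := pi_gt0 R.
have bk0 : 0 < 4 * pi * be * ka by rewrite !mulr_gt0.
exists c; first by rewrite divr_gt0// mulr_gt0 ?expR_gt0 ?powR_gt0.
move=> r /andP[r0 rm].
have r20 : 0 < r ^+ 2 by rewrite exprn_gt0.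
pose u := ka * r ^+ 2.
have u0 : 0 < u by rewrite mulr_gt0.
have uU : u <= U.
  apply: (@le_trans _ _ (U / rmax ^+ 2 * rmax ^+ 2)); last by rewrite divfK// gt_eqF// exprn_gt0.
  rewrite ler_pM ?(ltW ka0) ?(ltW r20)//; first by rewrite ge_min lexx orbT.
  by rewrite lerXn2r// nnegrE ltW.
have := Hmid u; rewrite u0 uU => /(_ isT) Hu.
pose mid := `[al * u, be * u]%classic : set R.
have midD : mid `<=` D.
  move=> t; rewrite /mid /= !in_itv/= andbT => /andP[h _].
  by apply: lt_le_trans h; rewrite mulr_gt0.
have mmid : measurable mid by exact: measurable_itv.
pose k0 := (4 * pi * (be * u)) `^ (- (d%:R / 2)) * expR (- ((K * r) ^+ 2 / (4 * (al * u)))).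
have k00 : 0 <= k0 by rewrite mulr_ge0 ?powR_ge0 ?expR_ge0.
have mmu : measurable_fun mid mu.
  exact: measurable_funS (measurable_bernstein_density Hphi).
apply: (@le_trans _ _ (k0%:E * (phi u^-1 / 2)%:E)%E).
  rewrite -EFinM lee_fin.
  have -> : k0 = 2 * c * r ^- d.
    rewrite /k0 /c.
    have -> : 4 * pi * (be * u) = 4 * pi * be * ka * r ^+ 2 by rewrite /u; ring.
    have -> : (K * r) ^+ 2 / (4 * (al * u)) = K ^+ 2 / (4 * al * ka).
      by rewrite /u; field; rewrite !gt_eqF.
    rewrite powRM ?(ltW r20)//; last by rewrite !mulr_ge0 ?(ltW pi0)// ltW.
    have -> : (r ^+ 2) `^ (- (d%:R / 2)) = r ^- d.
      rewrite -powR_mulrn ?(ltW r0)// -powRrM -powR_mulrn ?(ltW r0)// -powRN; congr (_ `^ _).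
      by field.
    by move: (r ^- d) (_ `^ _) (expR _) => x1 x2 x3; field.
  have pu : phi (r ^- 2) <= phi u^-1.
    apply: (bernstein_mono Hphi); first by rewrite invr_ge0 ltW.
    by rewrite lef_pV2 ?posrE// ler_piMl// ltW.
  have c0 : 0 <= c by rewrite divr_ge0// mulr_ge0 ?powR_ge0 ?expR_ge0.
  have -> : 2 * c * r ^- d * (phi u^-1 / 2) = c * r ^- d * phi u^-1.
    by move: (r ^- d) => x1; field.
  by rewrite ler_wpM2l// mulr_ge0// invr_ge0 exprn_ge0// ltW.
apply: (@le_trans _ _ (k0%:E * \int[leb]_(t in mid) (mu t)%:E)%E).
  by rewrite lee_wpmul2l.
rewrite -ge0_integralZl//; last 2 first.
- exact/measurable_EFinP.
- by move=> t /midD; rewrite /= in_itv/= andbT => t0; rewrite lee_fin mu0.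
apply: (@le_trans _ _ (\int[leb]_(t in mid) (kernel (K * r) t * mu t)%:E)%E); last first.
  apply: ge0_subset_integral => //.
  - by apply/measurable_EFinP; exact: measurable_kernel.
  - by move=> t Dt; exact: kernelmu_ge0.
apply: ge0_le_integral => //.
- move=> t /midD; rewrite /= in_itv/= andbT => t0.
  by rewrite -EFinM lee_fin mulr_ge0 ?mu0.
- by apply: measurable_funeM; exact/measurable_EFinP.
- apply/measurable_EFinP; exact: measurable_funS (measurable_kernel (K * r)).
move=> t mt; have t0 : 0 < t by move/midD : mt; rewrite /= in_itv/= andbT.
move: mt; rewrite /mid /= in_itv/= => /andP[t1 t2].
rewrite -EFinM lee_fin ler_wpM2r ?mu0// /k0 /kernel ler_pM ?powR_ge0 ?expR_ge0//.
  rewrite !powRN lef_pV2 ?posrE ?powR_gt0 ?mulr_gt0//.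
  have fp0 : 0 < 4 * pi :> R by rewrite mulr_gt0.
  apply: ge0_ler_powR.
  - by rewrite divr_ge0.
  - by rewrite nnegrE ltW// mulr_gt0.
  - by rewrite nnegrE ltW// !mulr_gt0.
  - by rewrite ler_wpM2l// ltW.
rewrite ler_expR lerN2 ler_wpM2l ?sqr_ge0// lef_pV2 ?posrE ?mulr_gt0//.
by rewrite ler_wpM2l.
Qed.

End jfun.
End jump_kernel.

(** * Transition densities *)

Section integral_upper.
Context d (T : measurableType d) (R : realType).
Import HBNNSimple.

(** The integral is a supremum over the simple functions below f, each of which is below c on D;
    measurability of f does not intervene, so that it applies directly to p(t, x, .). *)
Lemma ge0_integral_le_cst (m : {measure set T -> \bar R}) (D : set T)
    (f : T -> \bar R) (c : R) : measurable D ->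
  (forall x, D x -> (0 <= f x)%E) -> (forall x, D x -> (f x <= c%:E)%E) ->
  (\int[m]_(x in D) f x <= c%:E * m D)%E.
Proof.
move=> mD f0 fc; have [->|/set0P[x0 Dx0]] := eqVneq D set0.
  by rewrite integral_set0 measure0 mule0.
have c0 : (0 <= c%:E)%E by exact: le_trans (f0 _ Dx0) (fc _ Dx0).
rewrite -integral_cst// !ge0_integralE//.
apply: ereal_sup_le => _ [h/= hf <-]; exists h => // x.
apply: le_trans (hf x) _; rewrite !patchE; case: ifPn => // /set_mem; exact: fc.
Qed.

End integral_upper.

Section process.
Context {R : realType} {d : nat} {disp : measure_display}
  {Omega : measurableType disp}.
Local Notation V := 'rV[R]_d.
Variables (P : V -> probability Omega R) (X : R -> Omega -> V)
  (psi : V -> R) (p : R -> V -> V -> R).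
Hypotheses (LX : levy_process P X) (Epsi : levy_exponent P X psi).
Hypothesis dens : continuous_transition_density P X p.

Let mX t : 0 <= t -> measurable_fun setT (X t).
Proof. exact: (levy_measurable LX). Qed.

(** Fubini, then the characteristic function under the integral. In the expansion of cos(u . (Y -
    y)) the sine term integrates to 0, the characteristic function being real. *)
Lemma levy_expectation (kappa : {finite_measure set V -> \bar R}) x y t : 0 <= t ->
  \int[P x]_w cos_synthesis kappa (fun=> 1) (X t w - X 0 w - y) =
  cos_synthesis kappa (fun u => expR (- (t * psi u))) y.
Proof.
move=> t0; pose Y w := X t w - X 0 w.
have mY : measurable_fun setT Y.
  by apply: measurable_addrV; [exact: mX|apply: measurable_opprV; exact: mX].
have mYy : measurable_fun setT (fun w => Y w - y).
  exact: measurable_addrV.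
under eq_Rintegral do rewrite cos_synthesis1.
have bf : bounded_measurable (fun q : Omega * V => cos (dotp q.2 (Y q.1 - y))).
  apply: bounded_measurable_cos_dotp => //.
  exact: (measurableT_comp mYy).
rewrite (bounded_fubini (P x) kappa bf).
apply: eq_Rintegral => u _ /=.
have mdY : measurable_fun setT (fun w => dotp u (Y w)) by exact: measurable_dotp.
have bcos : bounded_measurable (fun w => cos (dotp u (Y w))) by exact: bounded_measurable_cos.
have bsin : bounded_measurable (fun w => sin (dotp u (Y w))).
  split; last by exists 1 => w; exact: sin_max.
  exact: measurableT_comp (continuous_measurable_fun (@continuous_sin R)) mdY.
under eq_Rintegral do rewrite dotpDr dotpNr cosB mulrC [X in _ + X]mulrC.
have b1 : bounded_measurable (fun w => cos (dotp u y) * cos (dotp u (Y w))).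
  by apply: bounded_measurableM => //; exact: bounded_measurable_cst.
have b2 : bounded_measurable (fun w => sin (dotp u y) * sin (dotp u (Y w))).
  by apply: bounded_measurableM => //; exact: bounded_measurable_cst.
rewrite RintegralD//; do ?exact: bounded_measurable_integrable.
rewrite !RintegralZl//; do ?exact: bounded_measurable_integrable.
have := Epsi x u t0; rewrite /char_fun => -[-> ->].
by rewrite mulr0 addr0 mulrC.
Qed.

(** This makes singletons measurable for the product sigma-algebra, so that the event X_0 = x is
    measurable. *)
Lemma cube0 x : cube x 0 = [set x] :> set V.
Proof.
apply/seteqP; split => z /=; last by move=> -> i; rewrite subrr normr0.
move=> h; apply/rowP => i; apply/eqP; rewrite -subr_eq0 -normr_le0; exact: h.
Qed.

(** The product of tents is at most 1 and vanishes unless X_t lies in the cube about x + y or X_0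
    differs from x; the latter event is null. *)
Lemma expectation_tent_le x y t delta B : 0 < t -> 0 < delta ->
  (forall v, cube (x + y) delta v -> p t x v <= B) ->
  \int[P x]_w (\prod_(i < d) tent ((X t w - X 0 w - y) ord0 i / delta)) <=
  B * (2 * delta) ^+ d.
Proof.
move=> t0 de0 pB.
pose N := ~` (X 0 @^-1` [set x]).
pose C := X t @^-1` (cube (x + y) delta).
have mx : measurable [set x] by rewrite -cube0; exact: measurable_cube.
have mN0 : measurable (X 0 @^-1` [set x]).
  by rewrite -[X in measurable X]setTI; exact: (mX (lexx 0)).
have mN : measurable N by exact: measurableC.
have mC : measurable C.
  by rewrite -[X in measurable X]setTI; apply: (mX (ltW t0)) => //; exact: measurable_cube.
have mY : measurable_fun setT (fun w => X t w - X 0 w - y).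
  apply: measurable_addrV => //.
  by apply: measurable_addrV; [exact/mX/ltW|apply: measurable_opprV; exact: mX].
pose f w := \prod_(i < d) tent ((X t w - X 0 w - y) ord0 i / delta).
have f0 w : 0 <= f w by apply: prodr_ge0 => i _; exact: tent_ge0.
have f1 w : f w <= 1.
  by apply: prodr_ile1 => i _; rewrite tent_ge0 tent_le1.
have mf : measurable_fun setT f.
  apply: measurable_prod => i _.
  apply: (@measurable_maxr _ _ _ _ (fun=> 0)) => //.
  apply: measurable_funB => //; apply: measurableT_comp => //.
  apply: measurable_funM => //; exact: (measurableT_comp (measurable_coord i) mY).
have fNC w : f w <= \1_(N `|` C) w.
  rewrite indicE; case: (boolP (w \in N `|` C)) => [_|/negP wNC]; first exact: f1.
  have Xx : X 0 w = x.
    by apply: contrapT => nx; apply: wNC; rewrite inE; left.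
  have [i /negP] : exists i, ~ `|X t w ord0 i - (x + y) ord0 i| <= delta.
    by apply/existsNP => Cw; apply: wNC; rewrite inE; right.
  rewrite -ltNge => hi.
  rewrite /f (bigD1 i)//= tent_out ?mul0r//.
  rewrite normrM normfV (gtr0_norm de0) ler_pdivlMr// mul1r.
  by move: (ltW hi); rewrite Xx !mxE opprD addrA.
have if_ : (P x).-integrable setT (EFin \o f).
  apply: bounded_measurable_integrable; split => //.
  by exists 1 => w; rewrite ger0_norm.
rewrite -lee_fin /Rintegral fineK; last exact: integrable_fin_num if_.
apply: (@le_trans _ _ (\int[P x]_w (\1_(N `|` C) w)%:E)%E).
  apply: ge0_le_integral => //.
  - by move=> w _; rewrite lee_fin; exact: f0.
  - by apply/measurable_EFinP; exact: mf.
  - by apply/measurable_EFinP; apply: measurable_indic; exact: measurableU.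
  - by move=> w _; rewrite lee_fin; exact: fNC.
rewrite integral_indic//; last exact: measurableU.
rewrite setIT; apply: (@le_trans _ _ (P x N + P x C)%E); first exact: measureU2.
have -> : P x N = 0%E by rewrite probability_setC// (levy_start LX x) subee.
rewrite add0e.
have -> : P x C = (\int[lebesgue_rV d]_(v in cube (x + y) delta) (p t x v)%:E)%E.
  exact: (density_transition dens x t0 (measurable_cube _ _)).
rewrite EFinM -(lebesgue_cube (x + y) (ltW de0)).
apply: ge0_integral_le_cst; first exact: measurable_cube.
- by move=> v _; rewrite lee_fin (density_ge0 dens).
- by move=> v vC; rewrite lee_fin pB.
Qed.

Lemma density_near x y t c : 0 < t -> p t x (x + y) < c -> exists2 delta, 0 < delta &
  forall v, cube (x + y) delta v -> p t x v <= c.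
Proof.
move=> t0 pc.
have cp : {for (t, x, x + y), continuous
    (fun z : R * V * V => p z.1.1 z.1.2 z.2)} by exact: (density_continuous dens).
have cq : {for (x + y), continuous (fun v : V => (t, x, v))}.
  move=> A [[B C] [/= B1 C1] BC]; apply: filterS C1 => v Cv.
  by apply: BC; split => //=; exact: nbhs_singleton.
have cf : p t x v @[v --> x + y] --> p t x (x + y).
  exact: (@continuous_comp _ _ _ (fun v : V => (t, x, v)) (fun z => p z.1.1 z.1.2 z.2) _ cq cp).
have nb : nbhs (x + y) [set v | p t x v < c] by exact: (cvgr_lt _ cf _ pc).
have [e /= e0 he] := (nbhs_ballP _ _).1 nb.
(* Balls of the ambient norm are open cubes, since it is the sup norm; the closed cube of half-side
   e/2 lies in the ball of radius e. *)
exists (e / 2); first by rewrite divr_gt0.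
move=> v vC; apply: ltW; apply: he; split => // i j.
rewrite /ball/= (ord1 i) distrC; apply: le_lt_trans (vC j) _.
by rewrite ltr_pdivrMr// ltr_pMr// ltr1n.
Qed.

End process.

(** * The lower bound at given scales *)

Section lower_bound.
Context {R : realType} {d : nat} {disp : measure_display}
  {Omega : measurableType disp}.
Local Notation V := 'rV[R]_d.
Variables (P : V -> probability Omega R) (X : R -> Omega -> V)
  (psi J : V -> R) (p : R -> V -> V -> R).
Hypotheses (LX : levy_process P X) (pd : purely_discontinuous P X psi J).
Hypothesis dens : continuous_transition_density P X p.

Let Epsi : levy_exponent P X psi. Proof. by case: pd. Qed.
Let LJ : levy_density J. Proof. by case: pd. Qed.

Lemma cube_le (z : V) r s : r <= s -> cube z r `<=` cube z s.
Proof. by move=> rs x h i; exact: le_trans (h i) rs. Qed.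

(* Without jumps X does not move, which is incompatible with a density. *)
Lemma exponent_neq0 (t : R) : (0 < d)%N -> 0 < t -> ~ (forall u, psi u = 0).
Proof.
move=> d0 t0 psi0.
pose B := p t 0 (0 + 0) + 1.
have B1 : 1 <= B by rewrite lerDr (density_ge0 dens).
have B0 : 0 < B by exact: lt_le_trans B1.
have pB : p t 0 (0 + 0) < B by rewrite ltrDl.
have [e e0 he] := density_near dens t0 pB.
(* With exponent 0 the expectation of the tents at y = 0 is 1, whereas this choice makes its upper
   bound B (2 de)^d at most 1/2; B >= 1 ensures 2 de <= 1. *)
pose de := Num.min e (4 * B)^-1.
have de0 : 0 < de by rewrite lt_min e0 invr_gt0 mulr_gt0.
have [kappa kE] := @cos_positive_prod_tent R d de.
have he' v : cube (0 + 0) de v -> p t 0 v <= B.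
  by move=> vc; apply: he; apply: cube_le vc; rewrite ge_min lexx.
have := expectation_tent_le LX dens t0 de0 he'.
under eq_Rintegral do rewrite kE.
rewrite (levy_expectation LX Epsi)//; last exact: ltW.
have -> : (fun u => expR (- (t * psi u))) = (fun _ : V => 1 : R).
  by apply/funext => u; rewrite psi0 mulr0 oppr0 expR0.
rewrite -kE big1 => [|i _]; last first.
  by rewrite mxE mul0r /tent normr0 subr0 max_r.
have de1 : 2 * de <= 2^-1 / B.
  have : de <= (4 * B)^-1 by rewrite ge_min lexx orbT.
  have -> : 2^-1 / B = 2 * (4 * B)^-1 by field; rewrite gt_eqF.
  by rewrite ler_pM2l.
have de2 : 2 * de <= 1.
  have h2 : 2^-1 <= 1 :> R by rewrite invf_le1// ler1n.
  by apply: le_trans de1 _; rewrite ler_pdivrMr// mul1r (le_trans h2).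
have : (2 * de) ^+ d <= 2 * de.
  have de20 : 0 <= 2 * de by rewrite mulr_ge0// ltW.
  by have := ler_wiXn2l de20 de2 d0; rewrite expr1.
move=> h1 h2; have : (1 : R) <= 2^-1.
  apply: le_trans h2 _; apply: (@le_trans _ _ (B * (2^-1 / B))).
    by rewrite ler_wpM2l ?(ltW B0)// (le_trans h1).
  by rewrite mulrCA divff ?mulr1// gt_eqF.
by apply/negP; rewrite -ltNge invf_lt1// ltr1n.
Qed.

Variables (rho t M C q a : R) (x y : V).
Hypotheses (d0 : (0 < d)%N) (t0 : 0 < t) (rho0 : 0 < rho) (M0 : 0 <= M).
Hypotheses (C1 : 1 < C) (q0 : 0 <= q) (a0 : 0 <= a).
Hypothesis psiM : forall (i : 'I_d) (s : R), 0 <= s -> s <= d%:R / rho ->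
  psi (s *: delta_mx ord0 i) <= M.
Hypothesis CM : 2 * (t * (d%:R * M) / (cos 1 ^+ 2 / 2)) <= C ^+ 2.
Hypothesis J1 : forall x, C * rho <= enorm x -> enorm x <= 10 * (C * rho) -> q <= J x.
Hypothesis J2 : forall x, C * rho <= enorm x ->
  enorm x <= enorm y \/ enorm x <= 17 * (C * rho) -> a <= J x.

(** If the bound failed, continuity would give a cube on which p stays below a number c smaller than
    the bound. Both estimates of the expectation are proportional to the d-th power of the half-side
    of the cube, which therefore cancels; the trailing 2^-d compares de^d with the volume (2 de)^d.
    The 4 is 2 from t^2 / 2 times 2 from 1 - t sigma / S^2 >= 1/2. *)
Lemma density_lower :
  (2^-1 * (2^-1 * 2^-1 ^+ d)) * a * q * (2 * (C * rho / d%:R)) ^+ d * t ^+ 2 / 4 *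
    expR (- (t * (d%:R * M / sinc_gap))) * 2^-1 ^+ d <= p t x (x + y).
Proof.
rewrite leNgt; apply/negP; set lhs := (X in _ < X) => plt.
pose c := (p t x (x + y) + lhs) / 2.
have pc : p t x (x + y) < c by rewrite /c; lra.
have cl : c < lhs by rewrite /c; lra.
have [e e0 he] := density_near dens t0 pc.
pose S := C * rho.
have dR : 0 < d%:R :> R by rewrite ltr0n.
have S0 : 0 < S by rewrite mulr_gt0// (lt_trans ltr01).
have rhoS : rho < S by rewrite ltr_pMl.
(* The second entry keeps the cube inside the ball of radius S, as [one_jump_minorant] requires. *)
pose de := Num.min e (S / d%:R).
have de0 : 0 < de by rewrite lt_min e0 divr_gt0.
have deS : d%:R * de <= S.
  by rewrite mulrC -ler_pdivlMr// ge_min lexx orbT.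
have [kappa kE] := @cos_positive_prod_tent R d de.
have he' v : cube (x + y) de v -> p t x v <= c.
  by move=> vc; apply: he; apply: cube_le vc; rewrite ge_min lexx.
have := expectation_tent_le LX dens t0 de0 he'.
under eq_Rintegral do rewrite kE.
rewrite (levy_expectation LX Epsi)//; last exact: ltW.
case: (pd) => _ _ psiE.
pose m := (2^-1 * ((2^-1 * 2^-1 ^+ d) * a * de ^+ d)) * q * (2 * (S / d%:R)) ^+ d.
pose sigma := rho ^+ 2 * (d%:R * M) / (cos 1 ^+ 2 / 2).
have Sd : 0 <= S / d%:R := divr_ge0 (ltW S0) (ltW dR).
have m0 : 0 <= m.
  by rewrite /m; do ![exact: Sd | exact: ltW | done | apply: exprn_ge0 | apply: mulr_ge0].
(* This is what the size of C is for: the small jumps displace the starting point by more than S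
   with probability at most 1/2. *)
have tS : t * sigma <= S ^+ 2 / 2.
  have -> : t * sigma = rho ^+ 2 * (2 * (t * (d%:R * M) / (cos 1 ^+ 2 / 2))) / 2.
    by rewrite /sigma; set k := (cos 1 ^+ 2 / 2)^-1; field.
  rewrite ler_wpM2r// /S exprMn mulrC ler_wpM2r ?sqr_ge0//.
have S20 : 0 < S ^+ 2 by rewrite exprn_gt0.
have F0 z : 0 <= cos_synthesis kappa (fun=> 1) z.
  by rewrite -kE; apply: prodr_ge0 => i _; exact: tent_ge0.
have tS2 : t * sigma <= S ^+ 2 by rewrite (le_trans tS)// ler_pdivrMr// ler_peMr ?ler1n// ltW.
have := @levy_semigroup_two_jumps _ _ J psi LJ psiE kappa rho t (S ^+ 2) sigma
  (d%:R * M / sinc_gap) m y rho0 (ltW t0) S20 m0 tS2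
  (levy_tail LJ psiE d0 rho0 M0 psiM)
  (@levy_second_moment _ _ J psi rho M LJ psiE d0 rho0 psiM)
  F0 (fun nu nuE z => two_jumps_minorant LJ d0 rho0 rhoS de0 deS q0 a0 kE nuE J1 J2 (z := z)).
move=> /le_trans h /h{h}; apply/negP; rewrite -ltNge.
have pos : 0 <= m * t ^+ 2 / 2 * expR (- (t * (d%:R * M / sinc_gap))).
  by rewrite mulr_ge0 ?expR_ge0// divr_ge0// mulr_ge0// sqr_ge0.
apply: (@lt_le_trans _ _ (lhs * (2 * de) ^+ d)).
  by rewrite ltr_pM2r// exprn_gt0// mulr_gt0.
apply: (@le_trans _ _ (m * t ^+ 2 / 2 * expR (- (t * (d%:R * M / sinc_gap))) * 2^-1)).
  have h2 : 2^-1 ^+ d * 2 ^+ d = 1 :> R by rewrite -exprMn mulVf ?expr1n.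
  rewrite /lhs /m [(2 * de) ^+ d]exprMn /S le_eqVlt; apply/orP; left; apply/eqP.
  have alg (h k u w E : R) : h * k = 1 ->
      2^-1 * (2^-1 * h) * a * q * w * t ^+ 2 / 4 * E * h * (k * u) =
      2^-1 * (2^-1 * h * a * u) * q * w * t ^+ 2 / 2 * E / 2.
    move=> hk; transitivity (2^-1 * (2^-1 * h * a * u) * q * w * t ^+ 2 / 2 * E / 2 * (h * k)).
      by field.
    by rewrite hk mulr1.
  exact: alg.
rewrite ler_wpM2l// lerBrDr -lerBrDl ler_pdivrMr//.
have -> : (1 - 2^-1) * S ^+ 2 = S ^+ 2 / 2 by field.
exact: tS.
Qed.

End lower_bound.

Section subordinate_bound.
Context {R : realType} {d : nat} {disp : measure_display}
  {Omega : measurableType disp}.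
Local Notation V := 'rV[R]_d.
Variables (b : R) (mu phi : R -> R) (gamma c0 rmax C : R).
Hypotheses (Hphi : complete_bernstein b mu phi) (d0 : (0 < d)%N).
Hypotheses (g0 : 0 < gamma) (c00 : 0 < c0) (C1 : 1 < C).
Hypothesis CM : 2 * (gamma * d%:R ^+ 3 / (cos 1 ^+ 2 / 2)) <= C ^+ 2.
Hypothesis jlow : forall r, 0 < r <= rmax ->
  ((c0 * r ^- d * phi (r ^- 2))%:E <= jfun d mu (17 * C * r))%E.

(** The bound of [density_lower] for the [q], [a] and [M] of [transition_density_lower]: there a q
    rho^d t^2 = gamma^-2 c0 min(1, c0) v, so that t and rho disappear apart from v. *)
Definition lower_constant : R :=
  2^-1 * (2^-1 * 2^-1 ^+ d) * gamma ^- 2 * c0 * (2 * (C / d%:R)) ^+ d / 4 *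
  expR (- (gamma * d%:R ^+ 3 / sinc_gap)) * 2^-1 ^+ d * Num.min 1 c0.

Lemma lower_constant_gt0 : 0 < lower_constant.
Proof.
have m0 : 0 < Num.min 1 c0 by rewrite lt_min ltr01.
have dR : 0 < d%:R :> R by rewrite ltr0n.
have h2 : 0 < 2^-1 :> R by [].
have C0 := lt_trans ltr01 C1.
rewrite /lower_constant.
by do ![exact: expR_gt0 | done | apply: divr_gt0 | apply: mulr_gt0 | apply: exprn_gt0 |
  rewrite invr_gt0].
Qed.

Variables (P : V -> probability Omega R) (X : R -> Omega -> V)
  (Psi jX : R -> R) (p : R -> V -> V -> R).
Hypotheses (LX : levy_process P X)
  (pd : purely_discontinuous P X (fun xi => Psi (enorm xi)) (fun x => jX (enorm x)))
  (dens : continuous_transition_density P X p).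
Hypothesis Psi_le : forall xi : V, Psi (enorm xi) <= gamma * phi (enorm xi ^+ 2).
Hypothesis jX_ge : forall r, 0 < r -> ((gamma^-1)%:E * jfun d mu r <= (jX r)%:E)%E.

(** The minimum in the theorem is replaced by a real number v below both of its entries, since
    [Jfun] may be infinite. *)
Lemma transition_density_lower (t rho v : R) (x y : V) :
  0 < t -> 0 < rho <= rmax -> phi (rho ^- 2) = t^-1 -> 0 <= v -> v <= rho ^- d ->
  (v%:E <= t%:E * Jfun mu x y)%E -> lower_constant * v <= p t x y.
Proof.
move=> t0 rhom phirho v0 vrho vJ; have /andP[rho0 _] := rhom.
have m0 : 0 < Num.min 1 c0 by rewrite lt_min ltr01.
have m1 : Num.min 1 c0 <= 1 by rewrite ge_min lexx.
have mc : Num.min 1 c0 <= c0 by rewrite ge_min lexx orbT.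
have dR : 0 < d%:R :> R by rewrite ltr0n.
have C0 := lt_trans ltr01 C1.
have ig0 : 0 < gamma^-1 by rewrite invr_gt0.
have rd0 : 0 < rho ^- d by rewrite invr_gt0 exprn_gt0.
(* The lower bound of the jump density up to radius 17 C rho, from [jlow] at r = rho with
   phi(rho^-2) = 1/t. *)
pose q := gamma^-1 * (c0 * rho ^- d / t).
(* The factor min(1, c0) serves both cases of the second jump: as it is at most c0, a <= q covers
   the lengths up to 17 C rho; as it is at most 1, a is below j(|y - x|) / gamma. *)
pose a := gamma^-1 * (Num.min 1 c0 * v / t).
(* For s <= d / rho, gamma phi(s^2) <= gamma d^2 phi(rho^-2) = gamma d^2 / t. *)
pose M := gamma * d%:R ^+ 2 / t.
have q0 : 0 <= q by rewrite ltW// mulr_gt0// divr_gt0// mulr_gt0.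
have a0 : 0 <= a by rewrite mulr_ge0 ?(ltW ig0)// divr_ge0 ?(ltW t0)// mulr_ge0// ltW.
have M0 : 0 <= M by rewrite divr_ge0 ?(ltW t0)// mulr_ge0 ?(ltW g0)// sqr_ge0.
have aq : a <= q.
  rewrite ler_pM2l// ler_pM2r ?invr_gt0//.
  by apply: (@le_trans _ _ (c0 * v)); [rewrite ler_wpM2r|rewrite ler_pM2l].
have jq r : 0 < r -> r <= 17 * C * rho -> q <= jX r.
  move=> r0 rC; rewrite -lee_fin; apply: le_trans (jX_ge r0).
  rewrite EFinM lee_pmul2l// ?lte_fin//.
  apply: le_trans (jfun_antitone Hphi d (ltW r0) rC).
  by rewrite -phirho; exact: jlow.
have psiM (i : 'I_d) s : 0 <= s -> s <= d%:R / rho ->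
    Psi (enorm (s *: delta_mx ord0 i : V)) <= M.
  move=> s0 sd; apply: le_trans (Psi_le _) _.
  rewrite enormZ enorm_delta mulr1 ger0_norm// /M -mulrA ler_pM2l//.
  rewrite -phirho; apply: le_trans (bernstein_scale Hphi _ _).
  - apply: (bernstein_mono Hphi); first exact: sqr_ge0.
    rewrite -exprVn -exprMn; apply: lerXn2r => //; rewrite nnegrE//.
    by rewrite divr_ge0 ?ltW.
  - by rewrite -natrX ler1n expn_gt0 d0.
  - by rewrite invr_ge0 exprn_ge0// ltW.
have CM' : 2 * (t * (d%:R * M) / (cos 1 ^+ 2 / 2)) <= C ^+ 2.
  have -> : t * (d%:R * M) = gamma * d%:R ^+ 3 by rewrite /M; field; rewrite gt_eqF.
  exact: CM.
have S0 : 0 < C * rho by rewrite mulr_gt0.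
have J1 (z : V) : C * rho <= enorm z -> enorm z <= 10 * (C * rho) -> q <= jX (enorm z).
  move=> Sz zS; apply: jq; first exact: lt_le_trans Sz.
  by apply: le_trans zS _; rewrite -mulrA ler_pM2r// ler_nat.
have J2 (z : V) : C * rho <= enorm z ->
    enorm z <= enorm (y - x) \/ enorm z <= 17 * (C * rho) -> a <= jX (enorm z).
  move=> Sz; have z0 := lt_le_trans S0 Sz; case=> [zy|zS]; last first.
    by apply: le_trans aq _; apply: jq => //; rewrite -mulrA.
  rewrite -lee_fin; apply: le_trans (jX_ge z0).
  rewrite EFinM lee_pmul2l// ?lte_fin//.
  apply: le_trans (jfun_antitone Hphi d (ltW z0) zy).
  (* In this case 0 < |z| <= |y - x|, so that the infinite value of [Jfun] on the diagonal does not
     occur. *)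
  have xy : x != y.
    apply/eqP => xy; move: (lt_le_trans z0 zy).
    by rewrite xy subrr enorm0 ltxx.
  move: vJ; rewrite /Jfun (negbTE xy) enormB.
  have := jfun_ge0 Hphi d (enorm (y - x)).
  case: (jfun _ _ _) => [j||]//; rewrite ?leey// -EFinM !lee_fin => j0 vj.
  rewrite ler_pdivrMr// [j * t]mulrC; apply: le_trans vj.
  by rewrite ler_piMl.
have := density_lower LX pd dens x d0 t0 rho0 M0 C1 q0 a0 psiM CM' J1 J2.
rewrite addrC subrK; apply: le_trans.
rewrite le_eqVlt; apply/orP; left; apply/eqP.
have -> : t * (d%:R * M / sinc_gap) = gamma * d%:R ^+ 3 / sinc_gap.
  by rewrite /M; field; rewrite !gt_eqF// sinc_gap_gt0.
have -> : 2 * (C * rho / d%:R) = rho * (2 * (C / d%:R)) by field; rewrite gt_eqF.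
rewrite exprMn /lower_constant /a /q.
have rdn : rho ^+ d != 0 by rewrite expf_neq0// gt_eqF.
move: (expR _) ((2 * _) ^+ d) (2^-1 ^+ d) (Num.min _ _) rdn => E W h m.
move: (rho ^+ d) => r rn.
by field; rewrite rn !gt_eqF.
Qed.

End subordinate_bound.

Theorem theorem3p7 (R : realType) (d : nat) (b : R) (mu phi : R -> R)
    (gamma T : R) :
  (0 < d)%N ->
  complete_bernstein b mu phi -> growth_condition phi ->
  1 < gamma -> 0 < T ->
  exists c : R, 0 < c /\
    forall (disp : measure_display) (Omega : measurableType disp)
      (P : 'rV[R]_d -> probability Omega R) (X : R -> Omega -> 'rV[R]_d)
      (Psi jX : R -> R) (p : R -> 'rV[R]_d -> 'rV[R]_d -> R),
    levy_process P X ->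
    rotationally_symmetric P X ->
    purely_discontinuous P X (fun xi => Psi (enorm xi))
      (fun x => jX (enorm x)) ->
    (forall r : R, 0 < r -> {for r, continuous jX}) ->
    (forall xi : 'rV[R]_d,
      gamma^-1 * phi (enorm xi ^+ 2) <= Psi (enorm xi)
        <= gamma * phi (enorm xi ^+ 2)) ->
    (forall r : R, 0 < r ->
      ((gamma^-1)%:E * jfun d mu r <= (jX r)%:E
        <= gamma%:E * jfun d mu r)%E) ->
    continuous_transition_density P X p ->
    forall (t : R) (x y : 'rV[R]_d), 0 < t <= T ->
      (c%:E * Order.min (Phi_inv phi t ^- d)%:E (t%:E * Jfun mu x y)
        <= (p t x y)%:E)%E.
Proof.
move=> d0 Hphi Hgrow g1 T0; have g0 := lt_trans ltr01 g1.
have [phi_pos|phi0] := growth_degenerate Hphi; last first.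
  (* Any positive constant will do, as no process satisfies the hypotheses when phi = 0. *)
  exists 1; split=> // disp Omega P X Psi jX p LX _ pd _ hPsi _ dens t x y /andP[t0 _].
  exfalso; apply: (exponent_neq0 LX pd dens d0 t0) => u.
  have := hPsi u; rewrite phi0 ?sqr_ge0// !mulr0 => h.
  by apply/eqP; rewrite eq_le andbC.
have [rmax rm0 hrm] := Phi_inv_bounded Hphi T0.
pose h := gamma * d%:R ^+ 3 / (cos 1 ^+ 2 / 2).
have h0 : 0 < h.
  by rewrite /h !(divr_gt0, mulr_gt0, exprn_gt0)// ?ltr0n// cos1_gt0.
(* This gives both C > 1, so that C rho exceeds the cutoff rho, and C^2 >= 2 h. *)
pose C := 1 + 2 * h.
have C1 : 1 < C by rewrite ltrDl mulr_gt0.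
have CM : 2 * h <= C ^+ 2.
  by rewrite /C; nra.
have C170 : 0 <= 17 * C by rewrite mulr_ge0// ltW// (lt_trans ltr01).
have [c0 c00 jlow] := jfun_lower Hphi Hgrow d C170 rm0.
exists (lower_constant (d := d) gamma c0 C); split; first exact: lower_constant_gt0.
move=> disp Omega P X Psi jX p LX _ pd _ hPsi hj dens t x y tT.
have /andP[t0 _] := tT.
have [rho0 phirho] := Phi_invP Hphi Hgrow phi_pos t0.
move: (Phi_inv phi t) rho0 phirho => rho rho0 phirho.
have rhom : 0 < rho <= rmax by rewrite rho0 (hrm t).
set w := Order.min _ _.
have w1 : (w <= (rho ^- d)%:E)%E by rewrite ge_min lexx.
have w2 : (w <= t%:E * Jfun mu x y)%E by rewrite ge_min lexx orbT.
have w0 : (0 <= w)%E.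
  rewrite le_min lee_fin invr_ge0 exprn_ge0 ?(ltW rho0)//= mule_ge0 ?lee_fin ?(ltW t0)//.
  by rewrite /Jfun; case: ifP => // _; exact: (jfun_ge0 Hphi).
(* The minimum lies between 0 and a real number, hence is a real number v. *)
move: w w0 w1 w2 => [v||]//; rewrite !lee_fin => v0 v1 v2.
have Psi_le xi : Psi (enorm xi) <= gamma * phi (enorm (xi : 'rV[R]_d) ^+ 2).
  by have /andP[] := hPsi xi.
have jX_ge r : 0 < r -> ((gamma^-1)%:E * jfun d mu r <= (jX r)%:E)%E.
  by move=> /hj /andP[].
exact: (transition_density_lower Hphi d0 g0 c00 C1 CM jlow LX pd dens Psi_le jX_ge t0 rhom).
Qed.
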